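(* Let $X$ be a CB process with branching mechanism $\Phi(\lambda)=c\lambda^\gamma$, where $c>0$ and $\gamma\in(1,2]$, with natural filtration $(\mathcal{F}_t)$, and let $x>0$. Let $\sigma=\int_0^\infty X_s\,ds$. Then for any $t\in[0,\infty)$ and any $\mathcal{F}_t$-measurable bounded random variable $F$, as $r\to\infty$, $$\mathbf{E}_x[F\mid\sigma=r]\to\frac1x\,\mathbf{E}_x[X_tF]\quad\text{and}\quad\mathbf{E}_x[F\mid\sigma>r]\to\frac1x\,\mathbf{E}_x[X_tF].$$
   Context: A CB process with branching mechanism $\Phi$ is an rcll $[0,\infty)$-valued Markov process $X=(X_t)_{t\ge0}$ such that, writing $\mathbf{P}_x$ for its law when $X_0=x$ and $\mathbf{E}_x$ for the expectation, $\mathbf{E}_x[e^{-\lambda X_t}]=e^{-xv_t(\lambda)}$ for $\lambda\ge0$, where $v_t(\lambda)$ is the unique locally bounded nonnegative solution of $v_t(\lambda)=\lambda-\int_0^t\Phi(v_s(\lambda))\,ds$. Under $\mathbf{P}_x$ the total mass $\sigma$ has a continuous density on $(0,\infty)$. $\mathbf{E}_x[F\mid\sigma=r]$ denotes the conditional expectation of $F$ given $\sigma=r$ (from a disintegration of $\mathbf{P}_x$ with respect to $\sigma$); it is determined for Lebesgue-almost every $r>0$ (up to null sets for the law of $\sigma$), and the limit $r\to\infty$ is understood accordingly, i.e. off a null set of values $r$. *)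

(* Defs.v *)
From HB Require Import structures.
From mathcomp Require Import all_boot all_order all_algebra.
From mathcomp Require Import all_classical all_reals all_analysis.
From mathcomp Require Import measurable_realfun.
Set Implicit Arguments.
Unset Strict Implicit.
Unset Printing Implicit Defensive.
Import Order.TTheory GRing.Theory Num.Theory.
Import numFieldNormedType.Exports.
Local Open Scope classical_set_scope.
Local Open Scope ring_scope.

(* Time is indexed by R, but only times t >= 0 and starting points x >= 0 are
   ever constrained: [X t] for t < 0 and [P x] for x < 0 are junk values. *)

(* [u] is a locally bounded nonnegative solution, on [0, +oo[, of
   u(t) = l - \int_0^t Phi(u(s)) ds. *)
Definition cumulant_solution (R : realType) (Phi : R -> R) (l : R)
    (u : R -> R) : Prop :=
  [/\ forall t : R, 0 <= t -> 0 <= u t,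
      forall t : R, 0 <= t -> exists M : R, forall s : R, 0 <= s <= t -> u s <= M,
      forall t : R, 0 <= t ->
        (@lebesgue_measure R).-integrable `[0, t] (fun s => (Phi (u s))%:E)
    & forall t : R, 0 <= t ->
        u t = l - \int[@lebesgue_measure R]_(s in `[0, t]) Phi (u s)].

Definition unique_cumulant_solution (R : realType) (Phi : R -> R) (l : R)
    (u : R -> R) : Prop :=
  cumulant_solution Phi l u /\
  forall u', cumulant_solution Phi l u' -> forall t : R, 0 <= t -> u' t = u t.

Definition rcll (R : realType) (f : R -> R) : Prop :=
  (forall t : R, 0 <= t -> f s @[s --> t^'+] --> f t) /\
  (forall t : R, 0 < t -> cvg (f s @[s --> t^'-])).

Section process.
Context {R : realType} {d : measure_display} {T : measurableType d}.

Definition past_events (X : R -> T -> R) (t : R) : set (set T) :=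
  \bigcup_(s in `[0, t]) preimage_set_system setT (X s) measurable.

Definition natural_filtration (X : R -> T -> R) (t : R) : set (set T) :=
  <<s past_events X t >>.

(* Time-homogeneous Markov family with state space [0, +oo[.  The last clause
   is P_x(X_(t+s) \in B | F_t) = P_(X_t)(X_s \in B), P_x-almost surely,
   written by integrating both sides over an arbitrary event A of F_t. *)
Definition markov_family (P : R -> probability T R) (X : R -> T -> R) : Prop :=
  [/\ forall t : R, 0 <= t -> measurable_fun setT (X t),
      forall (t : R) w, 0 <= t -> 0 <= X t w,
      forall x : R, 0 <= x -> P x [set w | X 0 w = x] = 1%E,
      forall (t : R) (B : set R), 0 <= t -> measurable B ->
        measurable_fun (`[0, +oo[ : set R) (fun x => P x (X t @^-1` B))
    & forall (x s t : R) (A : set T) (B : set R), 0 <= x -> 0 <= s -> 0 <= t ->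
        natural_filtration X t A -> measurable B ->
        P x (A `&` X (t + s) @^-1` B) =
        (\int[P x]_(w in A) P (X t w) (X s @^-1` B))%E].

Definition CB_process (Phi : R -> R) (P : R -> probability T R)
    (X : R -> T -> R) : Prop :=
  [/\ markov_family P X,
      forall w, rcll (X ^~ w)
    & exists v : R -> R -> R, forall l : R, 0 <= l ->
        unique_cumulant_solution Phi l (v ^~ l) /\
        forall x t : R, 0 <= x -> 0 <= t ->
          ('E_(P x)[fun w => expR (- l * X t w)] =
           (expR (- x * v t l))%:E)%E].

Definition total_mass (X : R -> T -> R) (w : T) : \bar R :=
  (\int[@lebesgue_measure R]_(s in `[0%R, +oo[) (X s w)%:E)%E.

(* [g] is a version of y |-> E[F | Y = y], i.e. of the disintegration of E[F]
   with respect to Y:  E[F; Y \in B] = \int_B g(y) P(Y \in dy), the right-hand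
   side being written as E[g(Y); Y \in B].  Such a [g] is determined up to
   null sets for the law of Y. *)
Definition cond_expectation_given (d' : measure_display)
    (T' : measurableType d') (P : probability T R) (F : T -> R) (Y : T -> T')
    (g : T' -> R) : Prop :=
  [/\ measurable_fun setT g,
      P.-integrable setT (fun w => (g (Y w))%:E)
    & forall B, measurable B ->
        (\int[P]_(w in Y @^-1` B) (F w)%:E =
         \int[P]_(w in Y @^-1` B) (g (Y w))%:E)%E].

Definition cond_expectation_event (P : probability T R) (F : T -> R)
    (A : set T) : R :=
  (\int[P]_(w in A) F w) / fine (P A).

End process.

(* Main.v *)
Require Import Defs.
From HB Require Import structures.
From mathcomp Require Import all_boot all_order all_algebra.
From mathcomp Require Import all_classical all_reals all_analysis.
From mathcomp Require Import measurable_realfun.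
From mathcomp Require Import finmap ring lra.
Set Implicit Arguments.
Unset Strict Implicit.
Unset Printing Implicit Defensive.
Import Order.TTheory GRing.Theory Num.Theory.
Import numFieldNormedType.Exports.
Local Open Scope classical_set_scope.
Local Open Scope ring_scope.

(* Idea.  Fix [t] and split the total mass as [sigma = A + B], with [A] the mass
   accumulated before [t].  Put [a = gamma^-1] and [Z = c `^ (- a) * X_t].
   Iterating the Markov property along a grid whose mesh tends to [0] shows that
   [expR (- l X_s - c l^gamma \int_0^s X)] is a martingale, whence
   [E[W expR (- l B)] = E[W expR (- Z l^a)]] for all [F_t]-measurable [W >= 0].
   Differentiating [n] times in [l] with [n (1 - a) > 1], and inverting Laplace
   transforms, the measure [E[W B^n; sigma \in dr]] has the explicit density
   [\sum_(j <= n) k_j E[W Z^j (r - A)_+^(n - j a - 1)]].  As [r] tends to infinity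
   the term [j = 1] dominates ([k_0 = 0]), so that this density is equivalent to
   [k_1 E[W Z] r^(n - a - 1)].  Since [B <= sigma], it bounds
   [r^n E[W; sigma \in dr]] from below, whereas for [t = 0] one has [B = sigma] and
   the density is exact.  Comparing the two for [W = M + F] and [W = M - F],
   truncated to [X_t <= K], gives lower bounds for both [M + F] and [M - F]; they
   sum to the constant [2 M] because [E_x[X_t] = x], hence they are sharp. *)

(** * Weighted laws and Laplace transforms *)

Import HBNNSimple.

(** No density of a stable law has to be computed. After [n] derivatives in [l], a second use of the
    same Laplace identity, now with weights W Z^j exp(-l A), turns exp(-Z l^a) back into exp(-l B).
    What remains is a power of [l] times a Laplace transform of [sigma] itself, so the explicit
    kernel is evaluated at [r - sigma], with sigma = A + B. This is harmless: only [sigma >= 0],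
    monotonicity in [r] and the limit of the kernel for large [r] enter the asymptotics. The
    truncation in X_t is forced by the powers Z^j with [j <= n], since in general X_t has little
    more than a first moment. Every estimate is uniform over all measurable sets D inside [r0, +oo[,
    with an error proportional to the probability that [sigma] lies in D. Half-lines then give the
    tail statement, and sets where a version of the conditional expectation deviates from the limit
    give the disintegration. Since the density is strictly positive far out, sets of law zero there
    are Lebesgue-null. *)

Lemma ge0_measurable_fun_ind (d : measure_display) (T : measurableType d)
    (R : realType) (Q : (T -> R) -> Prop) :
  (forall A, measurable A -> Q \1_A) ->
  (forall f g : T -> R, measurable_fun setT f -> measurable_fun setT g ->
    (forall x, 0 <= f x) -> (forall x, 0 <= g x) ->
    Q f -> Q g -> Q (fun x => f x + g x)) ->
  (forall (k : R) (f : T -> R), 0 <= k -> measurable_fun setT f -> (forall x, 0 <= f x) ->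
    Q f -> Q (fun x => k * f x)) ->
  (forall (f_ : (T -> R)^nat) (f : T -> R), (forall n, measurable_fun setT (f_ n)) ->
    (forall n x, 0 <= f_ n x) ->
    (forall x, nondecreasing_seq (f_ ^~ x)) ->
    measurable_fun setT f -> (forall x, 0 <= f x) ->
    (forall x, f_ n x @[n --> \oo] --> f x) ->
    (forall n, Q (f_ n)) -> Q f) ->
  forall f : T -> R, measurable_fun setT f -> (forall x, 0 <= f x) -> Q f.
Proof.
move=> Q1 QD QZ Qlim f mf f0.
have mEf : measurable_fun setT (EFin \o f) by exact/measurable_EFinP.
pose f_ := nnsfun_approx measurableT mEf.
have H0 : forall n, Q (f_ n : T -> R); last first.
  apply: (Qlim (fun n => f_ n : T -> R) f _ _ _ _ _ _ H0) => //.
- by move=> x m n mn; exact/lefP/nd_nnsfun_approx.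
- move=> x; have /fine_cvgP[_] : (f_ n x)%:E @[n --> \oo] --> (f x)%:E.
    by apply: (@cvg_nnsfun_approx _ _ _ _ measurableT _ mEf) => // y _; rewrite lee_fin.
  by [].
move=> n.
have -> : (f_ n : T -> R) = (fun x =>
    \sum_(r <- fset_set (range (f_ n))) r * \1_(f_ n @^-1` [set r]) x).
  by apply/funext => x; rewrite fimfunE fsbig_finite//=.
(* Additivity of [Q] is available only for measurable nonnegative summands, so these two facts are
   carried through an induction over an arbitrary list. The empty sum is reached as
   [0 * \1_set0]. *)
suff H : forall s : seq R, (forall r, r \in s -> 0 <= r) ->
    [/\ measurable_fun setT (fun x => \sum_(r <- s) r * \1_(f_ n @^-1` [set r]) x),
    forall x, 0 <= \sum_(r <- s) r * \1_(f_ n @^-1` [set r]) x &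
    Q (fun x => \sum_(r <- s) r * \1_(f_ n @^-1` [set r]) x)].
  have [|_ _ //] := H (fset_set (range (f_ n))).
  by move=> r; rewrite in_fset_set// => /set_mem[y _ <-]; exact: fun_ge0.
elim=> [_|r s IH rs].
  split; last 1 first.
  - have : Q (fun x => 0 * \1_set0 x) by apply: QZ => //; exact: Q1.
    by congr Q; apply/funext => x; rewrite big_nil mul0r.
  - under eq_fun do rewrite big_nil; exact: measurable_cst.
  - by move=> x; rewrite big_nil.
have [|IH1 IH2 IH3] := IH; first by move=> u us; apply: rs; rewrite inE us orbT.
have r0 : 0 <= r by apply: rs; rewrite inE eqxx.
have mr : measurable (f_ n @^-1` [set r]) by [].
have m1 : measurable_fun setT (fun x => r * \1_(f_ n @^-1` [set r]) x).
  by apply: measurable_funM => //; exact: measurable_indic.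
have p1 x : 0 <= r * \1_(f_ n @^-1` [set r]) x by rewrite mulr_ge0.
split.
- by under eq_fun do rewrite big_cons; exact: measurable_funD.
- by move=> x; rewrite big_cons addr_ge0.
- have : Q (fun x => r * \1_(f_ n @^-1` [set r]) x
    + \sum_(u <- s) u * \1_(f_ n @^-1` [set u]) x).
    apply: QD => //; apply: QZ => //; exact: Q1.
  by congr Q; apply/funext => x; rewrite big_cons.
Qed.

Section weighted_law.
Context d d' (S : measurableType d) (U : measurableType d') (R : realType).
Variables (m : {measure set S -> \bar R}) (h : S -> R) (Y : S -> U).

(** The hypotheses are arguments of the set function, so that its measure instance can be inferred
    from the term alone. *)
Definition weighted_law of measurable_fun setT h & (forall w, 0 <= h w) &
  measurable_fun setT Y := fun B : set U => (\int[m]_(w in Y @^-1` B) (h w)%:E)%E.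

Hypotheses (mh : measurable_fun setT h) (h0 : forall w, 0 <= h w).
Hypothesis mY : measurable_fun setT Y.
Local Notation law := (weighted_law mh h0 mY).

Let law0 : law set0 = 0%E.
Proof. by rewrite /weighted_law preimage_set0 integral_set0. Qed.

Let law_ge0 B : (0 <= law B)%E.
Proof. by apply: integral_ge0 => w _; rewrite lee_fin. Qed.

Let law_sigma_additive : semi_sigma_additive law.
Proof.
move=> F mF tF mUF; rewrite /weighted_law preimage_bigcup.
have mYF n : measurable (Y @^-1` F n).
  by rewrite -[X in measurable X]setTI; exact: mY.
rewrite ge0_integral_bigcup//.
- by apply: is_cvg_ereal_nneg_natsum_cond => n _ _; apply: integral_ge0 => w _; rewrite lee_fin.
- by apply/measurable_EFinP; exact: measurable_funTS.
- by move=> w _; rewrite lee_fin.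
- apply/trivIsetP => /= i j _ _ ij; rewrite -preimage_setI.
  by move/trivIsetP : tF => /(_ _ _ _ _ ij) ->//; rewrite preimage_set0.
Qed.

HB.instance Definition _ := isMeasure.Build _ _ _
  law law0 law_ge0 law_sigma_additive.

End weighted_law.

Lemma preimage_measurable d d' (S : measurableType d) (U : measurableType d')
    (Y : S -> U) (B : set U) :
  measurable_fun setT Y -> measurable B -> measurable (Y @^-1` B).
Proof. by move=> mY mB; rewrite -[X in measurable X]setTI; exact: mY. Qed.

Section equal_weighted_laws.
Context d1 d2 d' (S1 : measurableType d1) (S2 : measurableType d2)
  (U : measurableType d') (R : realType).
Variables (m1 : {measure set S1 -> \bar R}) (m2 : {measure set S2 -> \bar R}).
Variables (h1 : S1 -> R) (h2 : S2 -> R) (Y1 : S1 -> U) (Y2 : S2 -> U).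
Hypotheses (mh1 : measurable_fun setT h1) (h10 : forall w, 0 <= h1 w).
Hypotheses (mh2 : measurable_fun setT h2) (h20 : forall w, 0 <= h2 w).
Hypotheses (mY1 : measurable_fun setT Y1) (mY2 : measurable_fun setT Y2).

(** The two sides may live on different spaces: it serves to compare P with Lebesgue measure, and,
    with Y the identity into a coarser sigma-algebra, to pass from events to weights. *)
Lemma eq_law_integral :
  (forall B, measurable B ->
    \int[m1]_(w in Y1 @^-1` B) (h1 w)%:E = \int[m2]_(w in Y2 @^-1` B) (h2 w)%:E)%E ->
  forall f : U -> R, measurable_fun setT f -> (forall u, 0 <= f u) ->
  (\int[m1]_w (h1 w * f (Y1 w))%:E = \int[m2]_w (h2 w * f (Y2 w))%:E)%E.
Proof.
move=> H.
have mM d (S : measurableType d) (h : S -> R) (Y : S -> U) (f : U -> R) :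
    measurable_fun setT h -> measurable_fun setT Y -> measurable_fun setT f ->
    measurable_fun setT (fun w => (h w * f (Y w))%:E).
  move=> mh mY mf; apply/measurable_EFinP; apply: measurable_funM => //.
  exact: measurableT_comp.
apply: (@ge0_measurable_fun_ind _ _ _ (fun f =>
   (\int[m1]_w (h1 w * f (Y1 w))%:E = \int[m2]_w (h2 w * f (Y2 w))%:E)%E)).
- move=> A mA.
  have := H A mA; rewrite integral_mkcond [X in _ = X -> _]integral_mkcond.
  by rewrite !epatch_indic.
- move=> f g mf mg f0 g0 Hf Hg.
  have E d (S : measurableType d) (m : {measure set S -> \bar R}) (h : S -> R)
      (Y : S -> U) : measurable_fun setT h -> (forall w, 0 <= h w) ->
      measurable_fun setT Y ->
      (\int[m]_w (h w * (f (Y w) + g (Y w)))%:E =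
      \int[m]_w (h w * f (Y w))%:E + \int[m]_w (h w * g (Y w))%:E)%E.
    move=> mh h0 mY; rewrite -ge0_integralD//; try exact: mM.
    + by apply: eq_integral => w _; rewrite mulrDr EFinD.
    + by move=> w _; rewrite lee_fin mulr_ge0.
    + by move=> w _; rewrite lee_fin mulr_ge0.
  by rewrite !E// Hf Hg.
- move=> k f k0 mf f0 Hf.
  have E d (S : measurableType d) (m : {measure set S -> \bar R}) (h : S -> R)
      (Y : S -> U) : measurable_fun setT h -> (forall w, 0 <= h w) ->
      measurable_fun setT Y ->
      (\int[m]_w (h w * (k * f (Y w)))%:E = k%:E * \int[m]_w (h w * f (Y w))%:E)%E.
    move=> mh h0 mY; rewrite -ge0_integralZl//; try exact: mM.
    + by apply: eq_integral => w _; rewrite -EFinM mulrCA.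
    + by move=> w _; rewrite lee_fin mulr_ge0.
  by rewrite !E// Hf.
- move=> f_ f mf_ f_0 ndf mf f0 fcvg Hf.
  have E d (S : measurableType d) (m : {measure set S -> \bar R}) (h : S -> R)
      (Y : S -> U) : measurable_fun setT h -> (forall w, 0 <= h w) ->
      measurable_fun setT Y ->
      (\int[m]_w (h w * f_ n (Y w))%:E)%E @[n --> \oo] -->
      (\int[m]_w (h w * f (Y w))%:E)%E.
    move=> mh h0 mY.
    rewrite (_ : (fun w => (h w * f (Y w))%:E) =
       (fun w => limn (fun n => (h w * f_ n (Y w))%:E))); last first.
      apply/funext => w; apply/esym/cvg_lim => //.
      by apply: cvg_EFin; [exact: nearW|exact: cvgMl_tmp].
    apply: cvg_monotone_convergence => //.
    + by move=> n; exact: mM.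
    + by move=> n w _; rewrite lee_fin mulr_ge0.
    + by move=> w _ n k nk; rewrite lee_fin ler_wpM2l//; exact: ndf.
  have <- := cvg_lim (@ereal_hausdorff R) (E _ _ m1 _ _ mh1 h10 mY1).
  have <- := cvg_lim (@ereal_hausdorff R) (E _ _ m2 _ _ mh2 h20 mY2).
  by congr (limn _); apply/funext => n; rewrite Hf.
Qed.

End equal_weighted_laws.

Lemma cvg_natr_mul_expr (R : realType) (r : R) : 0 < r < 1 ->
  k%:R * r ^+ k @[k --> \oo] --> (0 : R).
Proof.
move=> /andP[r0 r1].
set s := Num.sqrt r.
have s0 : 0 < s by rewrite sqrtr_gt0.
have s1 : s < 1 by rewrite -sqrtr1 ltr_sqrt.
have sn : `|s| < 1 by rewrite gtr0_norm.
have E k : r ^+ k = s ^+ k * s ^+ k.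
  by rewrite -exprMn -expr2 sqr_sqrtr// ltW.
(* Each of the first k terms of the geometric series is at least s^k. As r = s^2, a factor s^k is
   left over, and it tends to 0. *)
have B k : k%:R * s ^+ k <= 1 / (1 - s).
  apply: le_trans (geometric_le_lim k ler01 s0 sn).
  rewrite /series/= big_mkord -[X in X%:R]card_ord -sumr_const mulr_suml.
  by apply: ler_sum => i _; rewrite !mul1r ler_wiXn2l// ?ltW// ltnW.
have H : (1 / (1 - s)) * s ^+ k @[k --> \oo] --> (0 : R).
  by rewrite -[X in _ --> X](mulr0 (1 / (1 - s))); apply: cvgMl_tmp; exact: cvg_expr.
apply: (squeeze_cvgr _ (cvg_cst 0) H).
near=> k; apply/andP; split; first by rewrite mulr_ge0// exprn_ge0// ltW.
by rewrite E mulrA ler_wpM2r// exprn_ge0// ltW.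
Unshelve. all: by end_near. Qed.

(* These polynomials in [u] are bounded by [1] and tend to the indicator of
   [0, b[, so moments determine a measure on [0, 1] without Weierstrass' theorem. *)
Lemma cvg_power_indicator (R : realType) (b u : R) : 0 < b <= 1 -> 0 <= u <= 1 ->
  (1 - u ^+ k) ^+ (Num.truncn (k%:R / b ^+ k)).+1 @[k --> \oo]
    --> ((u < b)%R%:R : R).
Proof.
move=> /andP[b0 b1] /andP[u0 u1].
(* Since [N k] is about k / b^k, the power behaves like exp(-k (u / b)^k): Bernoulli's inequality
   sends it to 1 for [u < b], and it is at most exp(-k) for [b <= u]. *)
pose N k := (Num.truncn (k%:R / b ^+ k)).+1.
rewrite -/(N _).
have N1 k : k%:R / b ^+ k <= (N k)%:R by apply/ltW; exact: truncnS_gt.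
have N2 k : (N k)%:R <= k%:R / b ^+ k + 1.
  rewrite /N -natr1 lerD2r truncn_le// divr_ge0// exprn_ge0// ltW//.
have uk k : 0 <= u ^+ k <= 1 by rewrite exprn_ge0//= exprn_ile1.
have [ub|bu] := ltP u b.
(* The maximum with 1/2 keeps the ratio positive when [u = 0], as [cvg_natr_mul_expr] requires. *)
- pose r := Num.max (u / b) (2^-1).
  have r01 : 0 < r < 1.
    by rewrite lt_max invr_gt0 ltr0n orbT /= gt_max ltr_pdivrMr// mul1r ub/= invf_lt1// ltr1n.
  have rn : `|r| < 1 by case/andP: r01 => *; rewrite gtr0_norm.
  have ur k : u ^+ k <= r ^+ k * b ^+ k.
    have r0 : 0 <= r by case/andP: r01 => /ltW.
    rewrite -exprMn lerXn2r ?nnegrE// ?mulr_ge0 ?(ltW b0)//.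
    by rewrite -ler_pdivrMr// le_max lexx.
  have H : 1 - (k%:R * r ^+ k + r ^+ k) @[k --> \oo] --> (1 : R).
    rewrite -[X in _ --> X]subr0 -[X in _ --> _ - X]addr0.
    apply: cvgB; first exact: cvg_cst.
    by apply: cvgD; [exact: cvg_natr_mul_expr|exact: cvg_expr].
  rewrite [X in _ --> X]mulr1n; apply: (squeeze_cvgr _ H); last exact: cvg_cst.
  near=> k; case/andP: (uk k) => uk0 uk1; apply/andP; split; last first.
    by rewrite exprn_ile1 ?subr_ge0// lerBlDr lerDl.
  have Bern n : 1 - n%:R * u ^+ k <= (1 - u ^+ k) ^+ n.
    elim: n => [|n IH]; first by rewrite mul0r subr0 expr0.
    rewrite exprS; apply: le_trans (ler_wpM2l _ IH); last by rewrite subr_ge0.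
    rewrite -natr1 mulrBl mul1r mulrBr mulr1 mulrDl mul1r.
    have : 0 <= n%:R * (u ^+ k * u ^+ k) by rewrite !mulr_ge0.
    lra.
  apply: le_trans (Bern _); rewrite lerD2l lerN2.
  apply: (le_trans (ler_wpM2r uk0 (N2 k))).
  rewrite mulrDl mul1r lerD//.
  - by rewrite mulrAC ler_pdivrMr ?exprn_gt0// -mulrA ler_wpM2l.
  - apply: (le_trans (ur k)); rewrite ler_piMr ?exprn_ge0 ?exprn_ile1 ?(ltW b0)//.
    by case/andP: r01 => /ltW.
- have H : expR (- 1) ^+ k @[k --> \oo] --> (0 : R).
    by apply: cvg_expr; rewrite gtr0_norm ?expR_gt0// expR_lt1 oppr_lt0.
  rewrite [X in _ --> X]mulr0n; apply: (squeeze_cvgr _ (cvg_cst 0) H).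
  near=> k; case/andP: (uk k) => uk0 uk1.
  rewrite exprn_ge0 ?subr_ge0//=.
  apply: (@le_trans _ _ (expR (- u ^+ k) ^+ N k)).
    by rewrite lerXn2r ?nnegrE ?subr_ge0 ?expR_ge0// expR_ge1Dx.
  rewrite -!expRM_natl ler_expR !mulrN lerN2 mulr1.
  apply: (@le_trans _ _ (k%:R / b ^+ k * u ^+ k)).
    by rewrite mulrAC -mulrA ler_peMr// ler_pdivlMr ?exprn_gt0// mul1r lerXn2r ?nnegrE// ltW.
  by rewrite ler_wpM2r.
Unshelve. all: by end_near. Qed.

Lemma cvg_integral_dominated d (S : measurableType d) (R : realType)
    (m : {measure set S -> \bar R}) (f_ : (S -> R)^nat) (f g : S -> R) :
  (forall n, measurable_fun setT (f_ n)) ->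
  (forall w, f_ n w @[n --> \oo] --> f w) ->
  m.-integrable setT (EFin \o g) ->
  (forall n w, `|f_ n w| <= g w) ->
  (\int[m]_w (f_ n w)%:E @[n --> \oo] --> \int[m]_w (f w)%:E)%E.
Proof.
move=> mf_ f_f ig fg.
apply: (@dominated_cvg _ _ _ m setT measurableT _ _ (EFin \o g)) => //.
- by move=> n; exact/measurable_EFinP.
- by move=> w _; apply: cvg_EFin; [exact: nearW|exact: f_f].
- by move=> n w _; rewrite /= lee_fin.
Qed.

Lemma integrable_mul_bounded d (S : measurableType d) (R : realType)
    (m : {measure set S -> \bar R})
    (h g : S -> R) (M : R) :
  measurable_fun setT g -> m.-integrable setT (EFin \o h) ->
  (forall w, `|g w| <= M) -> m.-integrable setT (fun w => (h w * g w)%:E).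
Proof.
move=> mg ih gM.
have mh : measurable_fun setT h by apply/measurable_EFinP; exact: measurable_int ih.
apply: (@le_integrable _ _ _ _ _ _ _ (fun w => M%:E * (h w)%:E)%E) => //.
- by apply/measurable_EFinP; exact: measurable_funM.
- move=> w _; rewrite -EFinM !abse_EFin lee_fin !normrM mulrC.
  by rewrite ler_wpM2r// (le_trans (gM w))// ler_norm.
- exact: integrableZl.
Qed.

Lemma integral_horner d (S : measurableType d) (R : realType)
    (m : {measure set S -> \bar R})
    (h U : S -> R) (p : {poly R}) :
  measurable_fun setT U -> (forall w, 0 <= U w <= 1) ->
  m.-integrable setT (EFin \o h) ->
  (\int[m]_w (h w * p.[U w])%:E =
   \sum_(i < size p) (p`_i)%:E * \int[m]_w (h w * U w ^+ i)%:E)%E.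
Proof.
move=> mU U01 ih.
have ii i : m.-integrable setT (fun w => (h w * U w ^+ i)%:E).
  apply: (@integrable_mul_bounded _ _ _ _ _ _ 1) => //; first exact: measurable_funX.
  move=> w; case/andP: (U01 w) => U0 U1; rewrite ger0_norm ?exprn_ge0//.
  by rewrite exprn_ile1.
transitivity (\int[m]_w (\sum_(i < size p) (p`_i)%:E * (h w * U w ^+ i)%:E))%E.
  apply: eq_integral => w _; rewrite horner_coef mulr_sumr -sumEFin.
  by apply: eq_bigr => i _; rewrite mulrCA EFinM.
rewrite integral_sum//; last by move=> i; exact: integrableZl.
by apply: eq_bigr => i _; rewrite integralZl.
Qed.

(** * Moments on the unit interval determine a measure *)

Section hausdorff_moments.
Context d1 d2 (S1 : measurableType d1) (S2 : measurableType d2) (R : realType).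
Variables (m1 : {measure set S1 -> \bar R}) (m2 : {measure set S2 -> \bar R}).
Variables (h1 : S1 -> R) (h2 : S2 -> R) (U1 : S1 -> R) (U2 : S2 -> R).
Hypotheses (mh1 : measurable_fun setT h1) (h10 : forall w, 0 <= h1 w).
Hypotheses (mh2 : measurable_fun setT h2) (h20 : forall w, 0 <= h2 w).
Hypotheses (mU1 : measurable_fun setT U1) (mU2 : measurable_fun setT U2).
Hypotheses (U101 : forall w, 0 <= U1 w <= 1) (U201 : forall w, 0 <= U2 w <= 1).

(** Moments fix the integrals of all polynomials in U, hence in the limit the mass of each event
    [U < b], and left rays form a pi-system. Finiteness of the second measure is inherited through
    the moment of order 0. *)
Lemma hausdorff_moments :
  (\int[m1]_w (h1 w)%:E < +oo)%E ->
  (forall k, \int[m1]_w (h1 w * U1 w ^+ k)%:E = \int[m2]_w (h2 w * U2 w ^+ k)%:E)%E ->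
  forall B, measurable B ->
  (\int[m1]_(w in U1 @^-1` B) (h1 w)%:E = \int[m2]_(w in U2 @^-1` B) (h2 w)%:E)%E.
Proof.
move=> fin H.
have H0 : (\int[m1]_w (h1 w)%:E = \int[m2]_w (h2 w)%:E)%E.
  have := H 0%N; under eq_integral do rewrite expr0 mulr1.
  by under [X in _ = X -> _]eq_integral do rewrite expr0 mulr1.
have ih1 : m1.-integrable setT (EFin \o h1).
  apply/integrableP; split; first exact/measurable_EFinP.
  by under eq_integral => w _ do rewrite /= ger0_norm//.
have ih2 : m2.-integrable setT (EFin \o h2).
  apply/integrableP; split; first exact/measurable_EFinP.
  by under eq_integral => w _ do rewrite /= ger0_norm//; rewrite -H0.
have L d (S : measurableType d) (m : {measure set S -> \bar R}) (h U : S -> R) (b : R) :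
    measurable_fun setT U -> (forall w, 0 <= U w <= 1) ->
    (forall w, 0 <= h w) -> m.-integrable setT (EFin \o h) -> 0 < b <= 1 ->
    (\int[m]_w (h w * (((1 - 'X^k) ^+ (Num.truncn (k%:R / b ^+ k)).+1) : {poly R}).[U w])%:E
      @[k --> \oo] --> \int[m]_(w in U @^-1` `]-oo, b[) (h w)%:E)%E.
  move=> mU U01 h0 ih b01.
  rewrite integral_mkcond epatch_indic.
  have mh : measurable_fun setT h by apply/measurable_EFinP; exact: measurable_int ih.
  have pE k w : (((1 - 'X^k) ^+ (Num.truncn (k%:R / b ^+ k)).+1) : {poly R}).[U w] =
      (1 - U w ^+ k) ^+ (Num.truncn (k%:R / b ^+ k)).+1.
    by rewrite horner_exp hornerD hornerN hornerXn hornerC.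
  rewrite (_ : (fun w => (h w)%:E * _)%E =
    (fun w => (h w * (U w < b)%R%:R)%:E)); last first.
    by apply/funext => w; rewrite -EFinM /= indicE; congr ((_ * (nat_of_bool _)%:R)%:E);
      apply/idP/idP => [/set_mem|Ub]; [|apply/mem_set]; rewrite /= in_itv.
  apply: (@cvg_integral_dominated _ _ _ _ _ _ h) => //.
  - move=> k; apply: measurable_funM => //; under eq_fun do rewrite pE.
    by apply: measurable_funX; apply: measurable_funB => //; exact: measurable_funX.
  - by move=> w; apply: cvgMl_tmp; under eq_fun do rewrite pE; exact: cvg_power_indicator.
  - move=> k w; rewrite pE normrM [X in X * _]ger0_norm//.
    case/andP: (U01 w) => U0 Ule1; rewrite ger0_norm.
      by rewrite ler_piMr// exprn_ile1// ?subr_ge0 ?exprn_ile1// gerBl exprn_ge0.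
    by rewrite exprn_ge0// subr_ge0 exprn_ile1.
pose M1 : {measure set _ -> \bar R} := weighted_law m1 mh1 h10 mU1.
pose M2 : {measure set _ -> \bar R} := weighted_law m2 mh2 h20 mU2.
move=> B mB.
apply: (@measure_unique _ R _ (@RGenInftyO.G R) (fun k => `]-oo, k%:R[%classic)
  _ _ _ _ M1 M2 _ _ B mB).
- exact: RGenInftyO.measurableE.
- move=> _ _ [x ->] [y ->]; exists (Num.min x y).
  by apply/seteqP; split => z /=; rewrite !in_itv/= lt_min => /andP.
- by move=> k; exists k%:R.
- apply/seteqP; split => // z _; exists (Num.truncn z).+1 => //=.
  by rewrite in_itv/= truncnS_gt.
- move=> _ [b ->]; rewrite /M1 /M2 /= /weighted_law.
  have [b0|b0] := leP b 0.
    have E d (S : measurableType d) (U : S -> R) : (forall w, 0 <= U w <= 1) ->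
        U @^-1` `]-oo, b[ = set0.
      move=> U01; apply/seteqP; split => // w /=; rewrite in_itv/=.
      by case/andP: (U01 w) => U0 _ Ub; move: (lt_le_trans Ub b0); rewrite ltNge U0.
    by rewrite !E// !integral_set0.
  have [b1|b1] := leP b 1.
    have b01 : 0 < b <= 1 by rewrite b0 b1.
    have := L _ _ m1 h1 U1 b mU1 U101 h10 ih1 b01.
    under eq_fun do rewrite integral_horner//.
    under eq_fun do under eq_bigr do rewrite H.
    under eq_fun do rewrite -integral_horner//.
    by move=> L1; apply: cvg_unique L1 (L _ _ m2 h2 U2 b mU2 U201 h20 ih2 b01).
  have E d (S : measurableType d) (U : S -> R) : (forall w, 0 <= U w <= 1) ->
      U @^-1` `]-oo, b[ = setT.
    move=> U01; apply/seteqP; split => // w _ /=; rewrite in_itv/=.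
    by case/andP: (U01 w) => _ Ule1; exact: le_lt_trans b1.
  by rewrite !E.
- move=> k; rewrite /M1/= /weighted_law; apply: le_lt_trans fin.
  apply: ge0_subset_integral => //; first exact: preimage_measurable.
  exact/measurable_EFinP.
  by move=> w _; rewrite lee_fin.
Qed.

End hausdorff_moments.

(** The change of variable U = exp(-Y) maps [0, +oo[ into [0, 1] and turns the transform at the
    integer [k] into the k-th moment of U; this is why integer arguments suffice. *)
Lemma laplace_transform_unique d1 d2 (S1 : measurableType d1)
    (S2 : measurableType d2) (R : realType)
    (m1 : {measure set S1 -> \bar R}) (m2 : {measure set S2 -> \bar R})
    (h1 : S1 -> R) (h2 : S2 -> R) (Y1 : S1 -> R) (Y2 : S2 -> R) :
  measurable_fun setT h1 -> (forall w, 0 <= h1 w) ->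
  measurable_fun setT h2 -> (forall w, 0 <= h2 w) ->
  measurable_fun setT Y1 -> (forall w, 0 <= Y1 w) ->
  measurable_fun setT Y2 -> (forall w, 0 <= Y2 w) ->
  (\int[m1]_w (h1 w)%:E < +oo)%E ->
  (forall k : nat, \int[m1]_w (h1 w * expR (- k%:R * Y1 w))%:E =
                   \int[m2]_w (h2 w * expR (- k%:R * Y2 w))%:E)%E ->
  forall B, measurable B ->
  (\int[m1]_(w in Y1 @^-1` B) (h1 w)%:E = \int[m2]_(w in Y2 @^-1` B) (h2 w)%:E)%E.
Proof.
move=> mh1 h10 mh2 h20 mY1 Y10 mY2 Y20 fin H B mB.
have E d (S : measurableType d) (Y : S -> R) :
    Y @^-1` B = (fun w => expR (- Y w)) @^-1` ((fun u => - ln u) @^-1` B).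
  by apply/seteqP; split => w /=; rewrite expRK opprK.
rewrite [in LHS]E [in RHS]E; apply: hausdorff_moments => //.
- by apply: measurableT_comp => //; exact: measurable_funN.
- by apply: measurableT_comp => //; exact: measurable_funN.
- by move=> w; rewrite expR_ge0 expR_le1 oppr_le0 ?Y10 ?Y20.
- by move=> w; rewrite expR_ge0 expR_le1 oppr_le0 ?Y10 ?Y20.
- move=> k; under eq_integral do rewrite -expRM_natl mulrN -mulNr.
  by under [RHS]eq_integral do rewrite -expRM_natl mulrN -mulNr.
- apply: preimage_measurable => //; apply: measurable_funN; exact: measurable_ln.
Qed.

(** * Derivatives of [expR (- z * l `^ a)] *)

Lemma integrable_bounded d (T : measurableType d) (R : realType)
    (P : probability T R) (f : T -> R) (M : R) :
  measurable_fun setT f -> (forall w, `|f w| <= M) ->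
  P.-integrable setT (fun w => (f w)%:E).
Proof.
move=> mf fM.
have cM : P.-integrable setT (EFin \o cst `|M|) by exact: finite_measure_integrable_cst.
apply: le_integrable cM => //; first exact/measurable_EFinP.
by move=> w _; rewrite /= lee_fin normr_id (le_trans (fM w))// ler_norm.
Qed.

Lemma is_derive_integral_bounded d (T : measurableType d) (R : realType)
    (P : probability T R) (f f' : R -> T -> R) (a u v M : R) :
  u < a < v ->
  (forall x, u < x < v -> measurable_fun setT (f x)) ->
  (forall x w, u < x < v -> is_derive x 1 (f ^~ w) (f' x w)) ->
  (forall x w, u < x < v -> `|f x w| <= M) ->
  (forall x w, u < x < v -> `|f' x w| <= M) ->
  is_derive a 1 (fun x => \int[P]_w f x w) (\int[P]_w f' a w).
Proof.
move=> uav mf df fM f'M.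
have Ia : `]u, v[%classic a by rewrite /= in_itv.
have cM : P.-integrable setT (EFin \o cst `|M|) by exact: finite_measure_integrable_cst.
have MM x : `|x| <= M -> `|x| <= `|M| by move=> /le_trans; apply; exact: ler_norm.
have H1 x : `]u, v[%classic x -> P.-integrable setT (EFin \o f x).
  rewrite /= in_itv/= => xuv.
  by apply: (@integrable_bounded _ _ _ _ _ M) => [|w]; [exact: mf|exact: fM].
have H2 x y : `]u, v[%classic x -> setT y -> derivable (f ^~ y) x 1.
  by rewrite /= in_itv/= => xuv _; apply: ex_derive; exact: df.
have H3 x y : `]u, v[%classic x -> setT y -> `|partial1of2 f x y| <= `|M|.
  rewrite /= in_itv/= => xuv _; rewrite partial1of2E.
  by rewrite (@derive_val _ _ _ _ _ _ _ (df x y xuv)) MM// f'M.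
apply: DeriveDef.
  exact: (derivable_under_integral measurableT Ia H1 H2 (fun=> normr_ge0 _) cM H3).
rewrite -derive1E.
rewrite (differentiation_under_integral measurableT Ia H1 H2 (fun=> normr_ge0 _) cM H3).
apply: eq_Rintegral => w _.
by rewrite partial1of2E (@derive_val _ _ _ _ _ _ _ (df a w uav)).
Qed.

Section stable_derivatives.
Context {R : realType}.
Variable a : R.

(* [(-1)^k] times the [k]-th derivative in [l] of [expR (- z * l `^ a)] is
   [\sum_(j <= k) stable_coef k j * z ^+ j * l `^ (j * a - k) * expR (- z * l `^ a)]. *)
Fixpoint stable_coef (k j : nat) : R :=
  match k with
  | 0%N => (j == 0%N)%:R
  | k'.+1 => (k'%:R - j%:R * a) * stable_coef k' j +
      (if j is j'.+1 then a * stable_coef k' j' else 0)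
  end.

Definition stable_derivative (k : nat) (l z : R) : R :=
  \sum_(j < k.+1) stable_coef k j * z ^+ j * l `^ (j%:R * a - k%:R) *
    expR (- z * l `^ a).

Lemma stable_coef_gt k j : (k < j)%N -> stable_coef k j = 0.
Proof.
elim: k j => [|k IH] [|j]//= kj.
by rewrite !IH ?mulr0 ?addr0// ltnW.
Qed.

Lemma stable_derivativeE l z : stable_derivative 0 l z = expR (- z * l `^ a).
Proof.
by rewrite /stable_derivative big_ord1/= mul0r subr0 powRr0 expr0 !mul1r.
Qed.

Lemma is_derive_stable_derivative k (l z : R) : 0 < l ->
  is_derive l 1 (fun x => stable_derivative k x z) (- stable_derivative k.+1 l z).
Proof.
move=> l0.
have HE : is_derive l 1 (fun x => expR (- z * x `^ a))
    (expR (- z * l `^ a) * (- z * (a * l `^ (a - 1)))).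
  have h : is_derive l 1 (fun x => - z * x `^ a) (- z * (a * l `^ (a - 1))).
    by apply: is_deriveZ; exact: is_derive1_powR.
  exact: is_derive1_comp.
set E := expR (- z * l `^ a) in HE *.
pose dT (j : nat) := stable_coef k j * z ^+ j *
  ((j%:R * a - k%:R) * l `^ (j%:R * a - k%:R - 1) * E +
   l `^ (j%:R * a - k%:R) * (E * (- z * (a * l `^ (a - 1))))).
have HT (j : 'I_k.+1) : is_derive l 1 (fun x => stable_coef k j * z ^+ j *
    x `^ (j%:R * a - k%:R) * expR (- z * x `^ a)) (dT j).
  under eq_fun do rewrite -mulrA.
  apply: is_deriveZ.
  have h2 : is_derive l 1 (fun x => x `^ (j%:R * a - k%:R))
      ((j%:R * a - k%:R) * l `^ (j%:R * a - k%:R - 1)) by exact: is_derive1_powR.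
  apply: is_derive_eq (is_deriveM h2 HE) _.
  by rewrite addrC -/E; congr (_ + _); exact: mulrC.
have := @is_derive_sum _ _ _ _ _ _ _ _ HT.
rewrite (_ : \sum_(i < k.+1) _ = (fun x => stable_derivative k x z)); last first.
  by apply/funext => x; rewrite fct_sumE.
move=> /is_derive_eq; apply.
(* [g1] comes from differentiating the power of [l], and [g2] from the exponential, which brings
   down one more factor [z]. *)
pose g1 (j : nat) := (j%:R * a - k%:R) * stable_coef k j * z ^+ j *
  l `^ (j%:R * a - k.+1%:R) * E.
pose g2 (j : nat) := a * stable_coef k j * z ^+ j.+1 *
  l `^ (j.+1%:R * a - k.+1%:R) * E.
transitivity (\sum_(j < k.+1) (g1 j - g2 j)).
  apply: eq_bigr => j _; rewrite /dT /g1 /g2.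
  have -> : j%:R * a - k%:R - 1 = j%:R * a - k.+1%:R by rewrite -natr1 opprD addrA.
  have -> : l `^ (j.+1%:R * a - k.+1%:R) = l `^ (j%:R * a - k%:R) * l `^ (a - 1).
    rewrite -powRD; last by apply/implyP => _; rewrite gt_eqF.
    by congr (_ `^ _); rewrite -!natr1; ring.
  by rewrite exprS; ring.
rewrite sumrB /stable_derivative -/E.
(* Both sums are padded to k + 2 terms: the new last term of [g1] has coefficient
   [stable_coef k k.+1 = 0], and [g2] is shifted by one index, as in the recursion defining
   [stable_coef]. *)
transitivity (\sum_(j < k.+2) g1 j - \sum_(j < k.+2) (if j : nat is j'.+1 then g2 j' else 0)).
  congr (_ - _); last by rewrite [in RHS]big_ord_recl /= add0r.
  by rewrite [RHS]big_ord_recr/= [X in _ + X](_ : _ = 0) ?addr0// /g1 stable_coef_gt// mulr0 !mul0r.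
rewrite -sumrB -sumrN; apply: eq_bigr => -[[|j] /= jk] _; rewrite /g1 /g2.
  by rewrite subr0 addr0; ring.
ring.
Qed.

Hypothesis a01 : 0 < a < 1.

(** For [j <= k] the factor [k - j a] is nonnegative because [a < 1]; this is the complete
    monotonicity of exp(-z l^a). It makes all terms of the density nonnegative, so that terms may be
    dropped in lower bounds. *)
Lemma stable_coef_ge0 k j : 0 <= stable_coef k j.
Proof.
have [jk|kj] := leqP j k; last by rewrite stable_coef_gt.
elim: k j jk => [|k IH] j jk /=; first by rewrite ler0n.
have a0 : 0 <= a by case/andP: a01 => /ltW.
apply: addr_ge0.
  have [jk'|kj'] := leqP j k; last by rewrite stable_coef_gt// mulr0.
  rewrite mulr_ge0 ?IH// subr_ge0 (le_trans _ (_ : j%:R <= _))// ?ler_nat//.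
  by rewrite ler_piMr//; case/andP: a01 => _ /ltW.
by case: j jk => // j jk; rewrite mulr_ge0// IH.
Qed.

(** The first derivative already brings down a factor [z]. Without a term [j = 0], the leading order
    of the density is that of [j = 1]. *)
Lemma stable_coef0 k : stable_coef k.+1 0 = 0.
Proof. by elim: k => /= [|k ->]; rewrite ?mul0r ?subr0 ?mul0r ?mulr0 addr0. Qed.

(** In closed form the coefficient is a (1 - a) (2 - a) ... (k - a). *)
Lemma stable_coef1_gt0 k : 0 < stable_coef k.+1 1.
Proof.
have [a0 a1] := andP a01.
elim: k => [|k IH]; first by rewrite /= mulr0 add0r mulr1.
rewrite -[stable_coef _ _]/((k.+1%:R - 1%:R * a) * stable_coef k.+1 1 +
  a * stable_coef k.+1 0) stable_coef0 mulr0 addr0 pmulr_lgt0//.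
by rewrite mul1r subr_gt0 (lt_le_trans a1)// ler1n.
Qed.

End stable_derivatives.

Section differentiated_laplace_transform.
Context d (T : measurableType d) (R : realType) (P : probability T R).
Variables (a : R) (B Z W : T -> R).
Hypothesis a01 : 0 < a < 1.
Hypotheses (mB : measurable_fun setT B) (B0 : forall w, 0 <= B w).
Hypotheses (mZ : measurable_fun setT Z) (Z0 : forall w, 0 <= Z w).
Hypotheses (mW : measurable_fun setT W) (W0 : forall w, 0 <= W w).
Hypothesis bWZ : forall j, exists M, forall w, W w * Z w ^+ j <= M.
Hypothesis H : forall l : R, 0 < l ->
  \int[P]_w (W w * expR (- l * B w)) = \int[P]_w (W w * expR (- Z w * l `^ a)).

(** Raise y <= exp(y), at y = l x / (k + 1), to the power [k]. Dividing by k + 1 rather than by k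
    covers the case [k = 0]. *)
Lemma expr_expR_le (k : nat) (l x : R) : 0 < l -> 0 <= x ->
  x ^+ k * expR (- l * x) <= (k.+1%:R / l) ^+ k.
Proof.
move=> l0 x0.
have kl : 0 < k.+1%:R / l by rewrite divr_gt0.
rewrite mulNr expRN ler_pdivrMr ?expR_gt0//.
apply: (@le_trans _ _ ((k.+1%:R / l * expR (l * x / k.+1%:R)) ^+ k)).
  rewrite lerXn2r ?nnegrE ?(mulr_ge0 (ltW kl) (expR_ge0 _))//.
  have E : l * x / k.+1%:R <= expR (l * x / k.+1%:R).
    by apply: le_trans (expR_ge1Dx _); rewrite lerDr.
  apply: le_trans (ler_wpM2l (ltW kl) E).
  rewrite le_eqVlt; apply/orP; left; apply/eqP; field.
  by rewrite addrC natr1 pnatr_eq0 (gt_eqF l0).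
rewrite exprMn ler_wpM2l ?exprn_ge0 ?(ltW kl)//.
rewrite -expRM_natl ler_expR mulrA ler_pdivrMr// mulrC ler_wpM2l ?mulr_ge0 ?(ltW l0)//.
by rewrite ler_nat.
Qed.

Lemma measurable_stable_derivative k (l : R) :
  measurable_fun setT (fun w => stable_derivative a k l (Z w)).
Proof.
apply: measurable_sum => j; apply: measurable_funM.
  apply: measurable_funM => //; apply: measurable_funM => //; exact: measurable_funX.
apply: measurableT_comp => //; apply: measurable_funM => //; exact: measurable_funN.
Qed.

(** The exponents [j a - k] with [j <= k] are nonpositive, so the powers of [x] are bounded by their
    values at [u], while the powers of Z are absorbed by W. *)
Lemma mul_stable_derivative_bounded k (u : R) : 0 < u ->
  exists M : R, forall x w, u < x -> `|W w * stable_derivative a k x (Z w)| <= M.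
Proof.
move=> u0.
have /choice[M HM] := bWZ.
exists (\sum_(j < k.+1) stable_coef a k j * M j * u `^ (j%:R * a - k%:R)) => x w ux.
have x0 := lt_trans u0 ux.
have t0 (j : 'I_k.+1) : 0 <= stable_coef a k j * Z w ^+ j * x `^ (j%:R * a - k%:R) *
    expR (- Z w * x `^ a).
  by rewrite !mulr_ge0 ?expR_ge0 ?powR_ge0 ?exprn_ge0 ?stable_coef_ge0.
rewrite ger0_norm; last by rewrite mulr_ge0// sumr_ge0.
rewrite mulr_sumr; apply: ler_sum => j _.
have ax : x `^ (j%:R * a - k%:R) <= u `^ (j%:R * a - k%:R).
  have e0 : 0 <= k%:R - j%:R * a.
    have [a0 a1] := andP a01.
    rewrite subr_ge0 (@le_trans _ _ j%:R)//; first by rewrite ler_piMr// ltW.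
    by rewrite ler_nat -ltnS.
  rewrite -opprB !powRN lef_pV2 ?posrE ?powR_gt0//.
  by rewrite ge0_ler_powR// ?nnegrE ltW.
rewrite [leLHS](_ : _ = stable_coef a k j * (W w * Z w ^+ j) *
  (x `^ (j%:R * a - k%:R) * expR (- Z w * x `^ a))); last by ring.
apply: ler_pM.
- by rewrite !mulr_ge0 ?exprn_ge0 ?stable_coef_ge0.
- by rewrite mulr_ge0 ?powR_ge0 ?expR_ge0.
- by rewrite ler_wpM2l ?stable_coef_ge0.
- apply: le_trans ax; rewrite ler_piMr ?powR_ge0// expR_le1 mulNr oppr_le0.
  by rewrite mulr_ge0 ?powR_ge0.
Qed.

(** Induction, differentiating both sides under the integral sign. The interval ]l / 2, l + 1[ stays
    away from 0, near which neither B^k exp(-x B) nor the powers of [x] are uniformly bounded. *)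
Lemma laplace_transform_derivative k (l : R) : 0 < l ->
  \int[P]_w (W w * (B w ^+ k * expR (- l * B w))) =
  \int[P]_w (W w * stable_derivative a k l (Z w)).
Proof.
elim: k l => [|k IH] l l0.
  under eq_Rintegral do rewrite expr0 mul1r.
  under [RHS]eq_Rintegral do rewrite stable_derivativeE.
  exact: H.
have l2 : 0 < l / 2 by rewrite divr_gt0.
have lI : l / 2 < l < l + 1 by apply/andP; split; lra.
have [MW HMW] := bWZ 0%N.
have MW1 w : W w <= MW by have := HMW w; rewrite expr0 mulr1.
have bd n x w : l / 2 < x ->
    `|W w * (B w ^+ n * expR (- x * B w))| <= MW * (n.+1%:R / (l / 2)) ^+ n.
  move=> lx; rewrite ger0_norm; last by rewrite !mulr_ge0 ?exprn_ge0 ?expR_ge0.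
  apply: ler_pM => //; first by rewrite mulr_ge0 ?exprn_ge0 ?expR_ge0.
  apply: le_trans (expr_expR_le n l2 (B0 w)).
  by rewrite ler_wpM2l ?exprn_ge0// ler_expR ler_wpM2r// lerN2 ltW.
have mLB n x : measurable_fun setT (fun w => W w * (B w ^+ n * expR (- x * B w))).
  apply: measurable_funM => //; apply: measurable_funM; first exact: measurable_funX.
  by apply: measurableT_comp => //; exact: measurable_funM.
have mLS n x : measurable_fun setT (fun w => W w * stable_derivative a n x (Z w)).
  by apply: measurable_funM => //; exact: measurable_stable_derivative.
have MW0 : 0 <= MW by apply: le_trans (MW1 point); exact: W0.
have C0 n : 0 <= MW * (n.+1%:R / (l / 2)) ^+ n.
  by rewrite mulr_ge0// exprn_ge0// ltW// divr_gt0.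
have D1 : is_derive l 1 (fun x => \int[P]_w (W w * (B w ^+ k * expR (- x * B w))))
    (\int[P]_w (-1 * (W w * (B w ^+ k.+1 * expR (- l * B w))))).
  apply: (@is_derive_integral_bounded _ _ _ P (fun x w => W w * (B w ^+ k * expR (- x * B w)))
    (fun x w => -1 * (W w * (B w ^+ k.+1 * expR (- x * B w)))) l (l / 2) (l + 1)
    (MW * (k.+1%:R / (l / 2)) ^+ k + MW * (k.+2%:R / (l / 2)) ^+ k.+1)) => //.
  - move=> x w _.
    have h : is_derive x 1 (fun y => expR (- y * B w)) (expR (- x * B w) * - B w).
      have h2 : is_derive x 1 (fun y => - y * B w) (- B w).
        rewrite (_ : (fun y => - y * B w) = (fun y => - B w * y)); last first.
          by apply/funext => y; rewrite mulNr mulrC -mulNr.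
        apply: is_derive_eq (is_deriveZ _ _) _.
        by rewrite /GRing.scale/= mulr1.
      exact: is_derive1_comp.
    under eq_fun do rewrite mulrA.
    apply: is_derive_eq (is_deriveZ _ h) _.
    by rewrite exprS /GRing.scale/=; ring.
  - by move=> x w /andP[lx _]; rewrite (le_trans (bd _ _ _ lx))// lerDl C0.
  - by move=> x w /andP[lx _]; rewrite mulN1r normrN (le_trans (bd _ _ _ lx))// lerDr C0.
have [M1 HM1] := mul_stable_derivative_bounded k l2.
have [M2 HM2] := mul_stable_derivative_bounded k.+1 l2.
have [lx _] := andP lI.
have M10 : 0 <= M1 := le_trans (normr_ge0 _) (HM1 l point lx).
have M20 : 0 <= M2 := le_trans (normr_ge0 _) (HM2 l point lx).
have D2 : is_derive l 1 (fun x => \int[P]_w (W w * stable_derivative a k x (Z w)))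
    (\int[P]_w (-1 * (W w * stable_derivative a k.+1 l (Z w)))).
  apply: (@is_derive_integral_bounded _ _ _ P (fun x w => W w * stable_derivative a k x (Z w))
    (fun x w => -1 * (W w * stable_derivative a k.+1 x (Z w))) l (l / 2) (l + 1) (M1 + M2)) => //.
  - move=> x w /andP[lx' _].
    apply: is_derive_eq (is_deriveZ _ (is_derive_stable_derivative _ _ _ _)) _.
      exact: lt_trans lx'.
    by rewrite /GRing.scale/=; ring.
  - by move=> x w /andP[lx' _]; rewrite (le_trans (HM1 _ _ lx'))// lerDl.
  - by move=> x w /andP[lx' _]; rewrite mulN1r normrN (le_trans (HM2 _ _ lx'))// lerDr.
have E : \forall x \near l, \int[P]_w (W w * (B w ^+ k * expR (- x * B w))) =
    \int[P]_w (W w * stable_derivative a k x (Z w)).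
  near=> x; apply: IH; near: x; exact: lt_nbhsr.
have := near_eq_derive (1 : R) E.
rewrite (@derive_val _ _ _ _ _ _ _ D1) (@derive_val _ _ _ _ _ _ _ D2).
rewrite RintegralZl//; last first.
  by apply: (@integrable_bounded _ _ _ _ _ _ _ _) => [|w]; [exact: mLB|exact: bd].
rewrite RintegralZl//; last first.
  by apply: (@integrable_bounded _ _ _ _ _ _ _ _) => [|w]; [exact: mLS|exact: HM2].
by rewrite !mulN1r => /oppr_inj.
Unshelve. all: by end_near. Qed.

End differentiated_laplace_transform.

(** * The density of the total mass *)

(** The image of Lebesgue measure under x -> a x + b, multiplied by [a], gives half-open intervals
    their length, so it is Lebesgue measure. *)
Lemma ge0_integral_affine (R : realType) (f : R -> \bar R) (a b : R) :
  0 < a -> measurable_fun setT f -> (forall x, 0 <= f x)%E ->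
  (\int[@lebesgue_measure R]_x f x =
   a%:E * \int[@lebesgue_measure R]_x f (a * x + b)%R)%E.
Proof.
move=> a0 mf f0.
pose phi : R -> measurableTypeR R := fun x => a * x + b.
have mphi : measurable_fun setT phi by apply: measurable_funD => //; exact: measurable_funM.
pose k : {nonneg R} := NngNum (ltW a0).
pose mu_phi : {measure set (measurableTypeR R) -> \bar R} :=
  measure_function_pushforward__canonical__measure_function_Measure
    (@lebesgue_measure R) mphi.
transitivity (\int[mscale k mu_phi]_x f x)%E.
  apply: eq_measure_integral => //= A mA _.
  apply: (@lebesgue_measure_unique _ (mscale k mu_phi)) => //.
  move=> _ [[u v]] _ <-; rewrite /= /mscale/= /mu_phi /= /pushforward.
  have -> : phi @^-1` `]u, v] = `](u - b) / a, (v - b) / a]%classic.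
    apply/seteqP; split => z /=;
      by rewrite !in_itv/= ltr_pdivrMr// ler_pdivlMr// ltrBlDr lerBrDr mulrC.
  rewrite !lebesgue_measure_itv/= !lte_fin ltr_pM2r ?invr_gt0// ltrD2r.
  case: ifPn => _; last by rewrite mule0.
  rewrite -!EFinB -EFinM; congr EFin; field; by rewrite gt_eqF.
rewrite ge0_integral_mscale//= ge0_integral_pushforward//.
Qed.

(** * Powers of the positive part and their Laplace transforms *)

Section positive_part_power.
Context {R : realType}.

Definition pospow (p u : R) : R := Num.max u 0 `^ p.

(** For [p > 0] this is Gamma(p + 1), since [pospow p] then vanishes on the negative half-line. *)
Definition gamma_integral (p : R) : \bar R :=
  (\int[@lebesgue_measure R]_u (pospow p u * expR (- u))%:E)%E.

Lemma pospow_ge0 p u : 0 <= pospow p u. Proof. exact: powR_ge0. Qed.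

Lemma measurable_pospow p : measurable_fun setT (pospow p).
Proof.
apply: (measurableT_comp (measurable_powR p)).
by apply: measurable_maxr => //; exact: measurable_id.
Qed.

Lemma pospow_le0 p u : 0 < p -> u <= 0 -> pospow p u = 0.
Proof. by move=> p0 u0; rewrite /pospow max_r// powR0// gt_eqF. Qed.

Lemma pospow_gt0 p u : 0 <= u -> pospow p u = u `^ p.
Proof. by move=> u0; rewrite /pospow max_l. Qed.

Lemma pospowM p l u : 0 <= l -> pospow p (l * u) = l `^ p * pospow p u.
Proof.
move=> l0; rewrite /pospow -[X in Num.max _ X](mulr0 l) -maxr_pMr//.
by rewrite powRM// le_max lexx orbT.
Qed.

Lemma le_pospow p : 0 <= p -> {homo pospow p : x y / x <= y}.
Proof.
move=> p0 x y xy.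
have m (u : R) : 0 <= Num.max u 0 by rewrite le_max lexx orbT.
rewrite ge0_ler_powR ?nnegrE ?m//; rewrite ge_max; apply/andP; split => //.
by rewrite le_max xy.
Qed.

Let oneR (p : R) : 1 `^ p = 1 :> R. Proof. by rewrite powR1. Qed.

Lemma gamma_integral_lty p : 0 < p -> (gamma_integral p < +oo)%E.
Proof.
move=> p0.
pose n := (Num.truncn p).+1.
have pn : p <= n%:R by apply/ltW; exact: truncnS_gt.
(* The dominating function is a multiple of the exponential density of rate 1/2. The summand 1
   covers [u <= 1]; the other is the bound of [expr_expR_le] for u^n exp(-u / 2), used beyond 1,
   where u^p <= u^n. *)
pose C : R := 1 + (n.+1%:R / 2^-1) ^+ n.
have C0 : 0 <= C by rewrite addr_ge0// exprn_ge0// divr_ge0.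
have B u : pospow p u * expR (- u) <= 2 * C * exponential_pdf 2^-1 u.
  have [u0|u0] := leP 0 u.
    rewrite /exponential_pdf patchE mem_set/=; last by rewrite in_itv/= u0.
    have -> : expR (- u) = expR (- 2^-1 * u) * expR (- 2^-1 * u).
      by rewrite -expRD; congr expR; field.
    rewrite mulrA [leRHS]mulrCA [leRHS](_ : _ = C * expR (- 2^-1 * u)); last by field.
    rewrite ler_wpM2r ?expR_ge0// pospow_gt0//.
    have [u1|u1] := leP u 1.
      rewrite -[leLHS]mul1r -[C]mulr1; apply: ler_pM => //; rewrite ?mulr_ge0 ?powR_ge0 ?expR_ge0//.
        by rewrite lerDl exprn_ge0// divr_ge0.
      apply: mulr_ile1; rewrite ?powR_ge0 ?expR_ge0//.
        by rewrite -[leRHS](oneR p) ge0_ler_powR// ?nnegrE// ltW.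
      by rewrite expR_le1 mulNr oppr_le0 mulr_ge0.
    apply: (@le_trans _ _ (u ^+ n * expR (- 2^-1 * u))).
      rewrite ler_wpM2r ?expR_ge0// -powR_mulrn// ler_powR// ltW//.
    by apply: (le_trans (expr_expR_le n _ u0)); rewrite ?invr_gt0// lerDr.
  by rewrite pospow_le0 ?(ltW u0)// mul0r !mulr_ge0 ?exponential_pdf_ge0.
apply: (@le_lt_trans _ _ (\int[@lebesgue_measure R]_u ((2 * C)%:E * (exponential_pdf 2^-1 u)%:E))%E).
  apply: ge0_le_integral => //.
  - by move=> u _; rewrite lee_fin mulr_ge0 ?pospow_ge0 ?expR_ge0.
  - apply/measurable_EFinP/measurable_funM; first exact: measurable_pospow.
    by apply: measurableT_comp => //; exact: measurable_funN.
  - by apply: measurable_funeM; apply/measurable_EFinP; exact: measurable_exponential_pdf.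
  - by move=> u _; rewrite -EFinM lee_fin.
rewrite ge0_integralZl_EFin//.
- by rewrite integral_exponential_pdf ?invr_gt0// mule1 ltry.
- by move=> u _; rewrite lee_fin exponential_pdf_ge0.
- by apply/measurable_EFinP; exact: measurable_exponential_pdf.
- by rewrite mulr_ge0.
Qed.

Lemma gamma_integral_gt0 p : 0 < p -> (0 < gamma_integral p)%E.
Proof.
move=> p0.
have mf : measurable_fun setT (fun u : R => (pospow p u * expR (- u))%:E).
  apply/measurable_EFinP/measurable_funM; first exact: measurable_pospow.
  by apply: measurableT_comp => //; exact: measurable_funN.
apply: (@lt_le_trans _ _ (\int[@lebesgue_measure R]_(u in `[1%R, 2%R]) (expR (- 2))%:E)%E).
  rewrite integral_cst//= lebesgue_measure_itv/= lte_fin ltr1n -EFinB -EFinM lte_fin.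
  by rewrite mulr_gt0 ?expR_gt0// subr_gt0 ltr1n.
apply: (@le_trans _ _ (\int[@lebesgue_measure R]_(u in `[1%R, 2%R]) (pospow p u * expR (- u))%:E)%E).
  apply: ge0_le_integral => //.
  - exact: measurable_funTS.
  - move=> u; rewrite /= in_itv/= => /andP[u1 u2]; rewrite lee_fin.
    rewrite -[leLHS]mul1r; apply: ler_pM; rewrite ?expR_ge0 ?ler_expR ?lerN2//.
    have u0 : 0 <= u by exact: le_trans u1.
    by rewrite pospow_gt0// -[leLHS](oneR p) ge0_ler_powR// ?nnegrE// ltW.
apply: ge0_subset_integral => //.
by move=> u _; rewrite lee_fin mulr_ge0 ?pospow_ge0 ?expR_ge0.
Qed.

Lemma gamma_integral_fin p : 0 < p -> gamma_integral p \is a fin_num.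
Proof. by move=> p0; rewrite ge0_fin_numE ?gamma_integral_lty// ltW// gamma_integral_gt0. Qed.

(** Dilation by [l] produces the power of [l], and translation by [s] the factor exp(-l s). The
    shift will be the random total mass. *)
Lemma laplace_pospow (p l s : R) : 0 < p -> 0 < l ->
  (\int[@lebesgue_measure R]_r (pospow p (r - s) * expR (- l * r))%:E =
   (fine (gamma_integral p) * l `^ (- (p + 1)) * expR (- l * s))%:E)%E.
Proof.
move=> p0 l0.
have mf (g : R -> R) : measurable_fun setT g ->
    measurable_fun setT (fun u : R => (pospow p u * expR (g u))%:E).
  move=> mg; apply/measurable_EFinP/measurable_funM; first exact: measurable_pospow.
  exact: measurableT_comp.
have f0 (g : R -> R) u : (0 <= (pospow p u * expR (g u))%:E)%E.
  by rewrite lee_fin mulr_ge0 ?pospow_ge0 ?expR_ge0.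
have g1 : gamma_integral p = (l%:E * (l `^ p)%:E *
    \int[@lebesgue_measure R]_u (pospow p u * expR (- l * u))%:E)%E.
  rewrite /gamma_integral.
  have mN : measurable_fun setT (fun u : R => - u) by exact: measurable_funN.
  apply: (etrans (ge0_integral_affine 0 l0 (mf _ mN) (f0 (fun u => - u)))).
  rewrite -muleA; congr (_ * _)%E; rewrite -ge0_integralZl_EFin//.
  - by apply: eq_integral => u _; rewrite addr0 pospowM ?(ltW l0)// -mulrA mulNr EFinM.
  - by apply: mf; exact: measurable_funM.
  - exact: powR_ge0.
have := gamma_integral_fin p0; rewrite g1 => /fineK; rewrite -g1 => g2.
rewrite (@ge0_integral_affine _ (fun r => (pospow p (r - s) * expR (- l * r))%:E) 1 s ltr01); last 2 first.
- apply/measurable_EFinP/measurable_funM.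
    by apply: (measurableT_comp (measurable_pospow p)); exact: measurable_funB.
  by apply: measurableT_comp => //; exact: measurable_funM.
- by move=> x; rewrite lee_fin mulr_ge0 ?pospow_ge0 ?expR_ge0.
rewrite mul1e.
transitivity ((expR (- l * s))%:E *
    \int[@lebesgue_measure R]_u (pospow p u * expR (- l * u))%:E)%E.
  rewrite -ge0_integralZl_EFin ?expR_ge0//.
    apply: eq_integral => u _; rewrite mul1r addrK mulrDr expRD -EFinM; congr EFin; ring.
  by apply: mf; exact: measurable_funM.
rewrite [in RHS]mulrC [in RHS]EFinM; congr (_ * _)%E.
rewrite mulrC EFinM g2 g1 muleA -!EFinM powRN powRD; last by apply/implyP => _; rewrite gt_eqF.
rewrite (powRr1 (ltW l0)) (mulrC (l `^ p)) mulVf ?mul1e//.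
by rewrite mulf_neq0// gt_eqF// powR_gt0.
Qed.

End positive_part_power.

Lemma Rintegral_sum d (T : measurableType d) (R : realType)
    (m : {measure set T -> \bar R}) (n : nat) (f : 'I_n -> T -> R) :
  (forall i, m.-integrable setT (fun w => (f i w)%:E)) ->
  \int[m]_w (\sum_(i < n) f i w) = \sum_(i < n) \int[m]_w f i w.
Proof.
move=> fi; rewrite /Rintegral; under eq_integral do rewrite -sumEFin.
rewrite integral_sum// (eq_bigr (fun i => (fine (\int[m]_w (f i w)%:E))%:E)); last first.
  by move=> i _; rewrite fineK//; exact: integrable_fin_num.
by rewrite sumEFin.
Qed.

Section density_of_total_mass.
Context d (T : measurableType d) (R : realType) (P : probability T R).
Variables (a : R) (A B Z W : T -> R).
Hypothesis a01 : 0 < a < 1.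
Hypotheses (mA : measurable_fun setT A) (A0 : forall w, 0 <= A w).
Hypotheses (mB : measurable_fun setT B) (B0 : forall w, 0 <= B w).
Hypotheses (mZ : measurable_fun setT Z) (Z0 : forall w, 0 <= Z w).
Hypotheses (mW : measurable_fun setT W) (W0 : forall w, 0 <= W w).
Hypothesis bWZ : forall j, exists M, forall w, W w * Z w ^+ j <= M.
Hypothesis H : forall (j : nat) (s l : R), 0 <= s -> 0 < l ->
  \int[P]_w (W w * Z w ^+ j * expR (- s * A w) * expR (- l * B w)) =
  \int[P]_w (W w * Z w ^+ j * expR (- s * A w) * expR (- Z w * l `^ a)).

Let sigma w := A w + B w.

Let msigma : measurable_fun setT sigma.
Proof. exact: measurable_funD. Qed.

Let sigma0 w : 0 <= sigma w. Proof. exact: addr_ge0. Qed.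

Let expR_le1N (u v : R) : 0 <= u -> 0 <= v -> expR (- u * v) <= 1.
Proof. by move=> u0 v0; rewrite expR_le1 mulNr oppr_le0 mulr_ge0. Qed.

Let mexpN (u : R) (g : T -> R) : measurable_fun setT g ->
  measurable_fun setT (fun w => expR (- u * g w)).
Proof. by move=> mg; apply: measurableT_comp => //; exact: measurable_funM. Qed.

Let mWZ j : measurable_fun setT (fun w => W w * Z w ^+ j).
Proof. by apply: measurable_funM => //; exact: measurable_funX. Qed.

Let WZ0 j w : 0 <= W w * Z w ^+ j.
Proof. by rewrite mulr_ge0// exprn_ge0. Qed.

(** [H] is used in both directions: with weight W exp(-l A) to differentiate in the parameter of B,
    then with weights W Z^j exp(-l A) to replace exp(-Z l^a) by exp(-l B), which rebuilds exp(-l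
    sigma). *)
Lemma laplace_transform_total_mass n (l : R) : 0 < l ->
  \int[P]_w (W w * B w ^+ n * expR (- l * sigma w)) =
  \sum_(j < n.+1) stable_coef a n j * l `^ (j%:R * a - n%:R) *
    \int[P]_w (W w * Z w ^+ j * expR (- l * sigma w)).
Proof.
move=> l0.
(* The parameter of A is frozen at [l]: only the one attached to B is differentiated, which produces
   B^n and not sigma^n. *)
pose V w := W w * expR (- l * A w).
have V0 w : 0 <= V w by rewrite mulr_ge0 ?expR_ge0.
have mV : measurable_fun setT V by apply: measurable_funM => //; exact: mexpN.
have bVZ j : exists M : R, forall w, V w * Z w ^+ j <= M.
  have [M HM] := bWZ j; exists M => w; apply: le_trans (HM w).
  by rewrite /V mulrAC ler_piMr// expR_le1N// ltW.
have HV (u : R) : 0 < u -> \int[P]_w (V w * expR (- u * B w)) =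
    \int[P]_w (V w * expR (- Z w * u `^ a)).
  move=> u0; have := H 0 (ltW l0) u0.
  under eq_Rintegral do rewrite expr0 mulr1.
  by under [X in _ = X -> _]eq_Rintegral do rewrite expr0 mulr1.
have := laplace_transform_derivative a01 mB B0 mZ Z0 mV V0 bVZ HV n l0.
rewrite [in LHS](_ : (fun w => _) = (fun w => W w * B w ^+ n * expR (- l * sigma w))); last first.
  by apply/funext => w; rewrite /V /sigma mulrDr expRD; ring.
move=> ->.
have iV j : P.-integrable setT
    (fun w => (W w * Z w ^+ j * expR (- l * A w) * expR (- Z w * l `^ a))%:E).
  have [M HM] := bWZ j; apply: (@integrable_bounded _ _ _ _ _ M).
    apply: measurable_funM.
      by apply: measurable_funM => //; exact: mexpN.
    by apply: measurableT_comp => //; apply: measurable_funM => //; exact: measurable_funN.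
  move=> w; rewrite ger0_norm; last by rewrite mulr_ge0 ?expR_ge0// mulr_ge0 ?expR_ge0.
  apply: le_trans (HM w); rewrite -mulrA ler_piMr// mulr_ile1 ?expR_ge0 ?expR_le1N ?powR_ge0//.
  exact: ltW.
transitivity (\int[P]_w (\sum_(j < n.+1) stable_coef a n j * l `^ (j%:R * a - n%:R) *
    (W w * Z w ^+ j * expR (- l * A w) * expR (- Z w * l `^ a)))).
  apply: eq_Rintegral => w _; rewrite /stable_derivative mulr_sumr.
  by apply: eq_bigr => j _; rewrite /V; ring.
rewrite Rintegral_sum; last first.
  by move=> j; under eq_fun do rewrite EFinM; exact: integrableZl.
apply: eq_bigr => j _; rewrite (RintegralZl _ measurableT (iV j)).
congr (_ * _); rewrite -(H j (ltW l0) l0); apply: eq_Rintegral => w _.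
by rewrite -mulrA -expRD /sigma mulrDr.
Qed.

Variable n : nat.
Hypothesis na : 1 < n%:R * (1 - a).

(* [l `^ (j a - n)] is the Laplace transform of [r `^ (n - j a - 1) / Gamma (n - j a)];
   [n (1 - a) > 1] makes every such exponent positive.  [mass_density] is the density
   of [E[W B^n; A + B \in dr]]. *)
Definition kernel_exponent (j : nat) : R := n%:R - j%:R * a - 1.

Definition kernel_coef (j : nat) : R :=
  stable_coef a n j / fine (gamma_integral (kernel_exponent j)).

Definition mass_moment (j : nat) (r : R) : R :=
  \int[P]_w (W w * Z w ^+ j * pospow (kernel_exponent j) (r - sigma w)).

Definition mass_density (r : R) : R :=
  \sum_(j < n.+1) kernel_coef j * mass_moment j r.

Lemma kernel_exponent_gt0 (j : 'I_n.+1) : 0 < kernel_exponent j.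
Proof.
have [a0 a1] := andP a01.
rewrite /kernel_exponent subr_gt0 (lt_le_trans na)// mulrBr mulr1 lerD2l lerN2.
by rewrite ler_wpM2r ?(ltW a0)// ler_nat -ltnS.
Qed.

Lemma kernel_coef_ge0 (j : 'I_n.+1) : 0 <= kernel_coef j.
Proof.
rewrite divr_ge0 ?stable_coef_ge0// fine_ge0// ltW// gamma_integral_gt0//.
exact: kernel_exponent_gt0.
Qed.

Lemma pospow_mass_le (j : 'I_n.+1) r w :
  pospow (kernel_exponent j) (r - sigma w) <= pospow (kernel_exponent j) r.
Proof.
by apply: le_pospow; [exact/ltW/kernel_exponent_gt0|rewrite gerBl].
Qed.

Lemma measurable_mass_integrand j :
  measurable_fun setT (fun wr : T * R =>
    W wr.1 * Z wr.1 ^+ j * pospow (kernel_exponent j) (wr.2 - sigma wr.1)).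
Proof.
apply: measurable_funM.
  exact: (measurableT_comp (mWZ j) measurable_fst).
apply: (measurableT_comp (measurable_pospow _)).
by apply: measurable_funB => //; exact: (measurableT_comp msigma measurable_fst).
Qed.

Lemma measurable_mass_integrandr j r : measurable_fun setT (fun w =>
  W w * Z w ^+ j * pospow (kernel_exponent j) (r - sigma w)).
Proof.
apply: measurable_funM => //; apply: (measurableT_comp (measurable_pospow _)).
exact: measurable_funB.
Qed.

Lemma mass_integrand_integrable (j : 'I_n.+1) r : P.-integrable setT (fun w =>
  (W w * Z w ^+ j * pospow (kernel_exponent j) (r - sigma w))%:E).
Proof.
have [M HM] := bWZ j.
apply: (@integrable_bounded _ _ _ _ _ (M * pospow (kernel_exponent j) r)).
  exact: measurable_mass_integrandr.
move=> w; rewrite ger0_norm ?mulr_ge0 ?pospow_ge0 ?exprn_ge0//.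
by apply: ler_pM; rewrite ?pospow_ge0 ?pospow_mass_le.
Qed.

Lemma mass_moment_ge0 j r : 0 <= mass_moment j r.
Proof. by apply: Rintegral_ge0 => w _; rewrite mulr_ge0 ?pospow_ge0. Qed.

Lemma EFin_mass_moment (j : 'I_n.+1) r : (mass_moment j r)%:E =
  (\int[P]_w (W w * Z w ^+ j * pospow (kernel_exponent j) (r - sigma w))%:E)%E.
Proof.
rewrite /mass_moment /Rintegral fineK//; apply: integrable_fin_num => //.
exact: mass_integrand_integrable.
Qed.

Lemma measurable_mass_moment (j : 'I_n.+1) : measurable_fun setT (mass_moment j).
Proof.
apply/measurable_EFinP; rewrite (_ : _ \o _ = fun r => \int[P]_w
  (W w * Z w ^+ j * pospow (kernel_exponent j) (r - sigma w))%:E)%E; last first.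
  by apply/funext => r /=; rewrite EFin_mass_moment.
pose f (wr : T * R) :=
  (W wr.1 * Z wr.1 ^+ j * pospow (kernel_exponent j) (wr.2 - sigma wr.1))%:E.
have mf : measurable_fun setT f by apply/measurable_EFinP; exact: measurable_mass_integrand.
have f0 wr : (0 <= f wr)%E by rewrite lee_fin mulr_ge0 ?pospow_ge0.
exact: (@measurable_fun_fubini_tonelli_G _ _ _ _ _ P f mf f0).
Qed.

Lemma measurable_mass_density : measurable_fun setT mass_density.
Proof.
apply: measurable_sum => j; apply: measurable_funM => //.
exact: measurable_mass_moment.
Qed.

Lemma mass_density_ge0 r : 0 <= mass_density r.
Proof.
by apply: sumr_ge0 => j _; rewrite mulr_ge0 ?kernel_coef_ge0 ?mass_moment_ge0.
Qed.

Lemma mass_density_le0 r : r <= 0 -> mass_density r = 0.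
Proof.
move=> r0; apply: big1 => j _; rewrite /mass_moment.
rewrite [X in _ * X](_ : _ = 0) ?mulr0//; rewrite /Rintegral integral0_eq// => w _.
rewrite pospow_le0 ?mulr0 ?kernel_exponent_gt0//.
by rewrite subr_le0 (le_trans r0).
Qed.

(** Tonelli's theorem reduces this to [laplace_pospow] with shift [sigma w]; for p =
    [kernel_exponent j] the exponent -(p + 1) is j a - n. *)
Lemma laplace_mass_moment (j : 'I_n.+1) (l : R) : 0 < l ->
  (\int[@lebesgue_measure R]_r (mass_moment j r * expR (- l * r))%:E =
   (fine (gamma_integral (kernel_exponent j)) * l `^ (j%:R * a - n%:R) *
    \int[P]_w (W w * Z w ^+ j * expR (- l * sigma w)))%:E)%E.
Proof.
move=> l0; have p0 := kernel_exponent_gt0 j.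
pose f (wr : T * R) := (W wr.1 * Z wr.1 ^+ j *
  pospow (kernel_exponent j) (wr.2 - sigma wr.1) * expR (- l * wr.2))%:E.
transitivity (\int[@lebesgue_measure R]_r \int[P]_w f (w, r))%E.
  apply: eq_integral => r _; rewrite EFinM EFin_mass_moment muleC.
  rewrite -ge0_integralZl_EFin ?expR_ge0//.
  - by apply: eq_integral => w _; rewrite /f/= -EFinM mulrC.
  - by move=> w _; rewrite lee_fin mulr_ge0 ?pospow_ge0.
  - by apply/measurable_EFinP; exact: measurable_mass_integrandr.
rewrite -(@fubini_tonelli _ _ _ _ _ P (@lebesgue_measure R) f); last 2 first.
- apply/measurable_EFinP; apply: measurable_funM; first exact: measurable_mass_integrand.
  by apply: measurableT_comp => //; apply: measurable_funM => //; exact: measurable_snd.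
- by move=> wr; rewrite lee_fin mulr_ge0 ?expR_ge0// mulr_ge0 ?pospow_ge0.
transitivity (\int[P]_w ((fine (gamma_integral (kernel_exponent j)) * l `^ (j%:R * a - n%:R))%:E *
    (W w * Z w ^+ j * expR (- l * sigma w))%:E))%E.
  apply: eq_integral => w _; rewrite /f/=.
  transitivity (\int[@lebesgue_measure R]_r ((W w * Z w ^+ j)%:E *
      (pospow (kernel_exponent j) (r - sigma w) * expR (- l * r))%:E))%E.
    by apply: eq_integral => r _; rewrite -EFinM mulrA.
  rewrite ge0_integralZl_EFin//.
  - rewrite laplace_pospow// -!EFinM; congr EFin.
    rewrite (_ : - (kernel_exponent j + 1) = j%:R * a - n%:R); last by rewrite /kernel_exponent; ring.
    by rewrite mulrC -!mulrA; congr (_ * _); congr (_ * _); rewrite mulrC -mulrA.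
  - by move=> r _; rewrite lee_fin mulr_ge0 ?expR_ge0 ?pospow_ge0.
  - apply/measurable_EFinP; apply: measurable_funM.
      by apply: (measurableT_comp (measurable_pospow _)); exact: measurable_funB.
    by apply: measurableT_comp => //; exact: measurable_funM.
rewrite integralZl//; last first.
  have [M HM] := bWZ j; apply: (@integrable_bounded _ _ _ _ _ M).
    by apply: measurable_funM => //; exact: mexpN.
  move=> w; rewrite ger0_norm ?mulr_ge0 ?exprn_ge0 ?expR_ge0//.
  by apply: le_trans (HM w); rewrite ler_piMr// expR_le1N// ltW.
rewrite [RHS]EFinM; congr (_ * _)%E; rewrite /Rintegral fineK//.
apply: integrable_fin_num => //.
have [M HM] := bWZ j; apply: (@integrable_bounded _ _ _ _ _ M).
  by apply: measurable_funM => //; exact: mexpN.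
move=> w; rewrite ger0_norm ?mulr_ge0 ?exprn_ge0 ?expR_ge0//.
by apply: le_trans (HM w); rewrite ler_piMr// expR_le1N// ltW.
Qed.

Lemma laplace_mass_density (l : R) : 0 < l ->
  (\int[@lebesgue_measure R]_r (mass_density r * expR (- l * r))%:E =
   (\int[P]_w (W w * B w ^+ n * expR (- l * sigma w)))%:E)%E.
Proof.
move=> l0; rewrite laplace_transform_total_mass// -sumEFin.
transitivity (\sum_(j < n.+1) \int[@lebesgue_measure R]_r ((kernel_coef j)%:E *
   (mass_moment j r * expR (- l * r))%:E))%E.
  rewrite -ge0_integral_sum//.
  - apply: eq_integral => r _; rewrite /mass_density mulr_suml -sumEFin.
    by apply: eq_bigr => j _; rewrite -EFinM mulrA.
  - move=> j; apply: measurable_funeM; apply/measurable_EFinP; apply: measurable_funM.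
      exact: measurable_mass_moment.
    by apply: measurableT_comp => //; exact: measurable_funM.
  - move=> j r _; rewrite -EFinM lee_fin; apply: mulr_ge0; first exact: kernel_coef_ge0.
    by rewrite mulr_ge0 ?mass_moment_ge0 ?expR_ge0.
apply: eq_bigr => j _; rewrite ge0_integralZl_EFin ?kernel_coef_ge0//.
- rewrite laplace_mass_moment// -EFinM; congr EFin; rewrite /kernel_coef.
  have g0 : fine (gamma_integral (kernel_exponent j)) != 0.
    rewrite gt_eqF// fine_gt0// gamma_integral_lty ?gamma_integral_gt0 ?kernel_exponent_gt0//.
  by field.
- by move=> r _; rewrite lee_fin mulr_ge0 ?mass_moment_ge0 ?expR_ge0.
- apply/measurable_EFinP; apply: measurable_funM; first exact: measurable_mass_moment.
  by apply: measurableT_comp => //; exact: measurable_funM.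
Qed.

(** W B^n need not be integrable: the factor exp(-sigma) makes the measure finite and moves the
    Laplace arguments from k to k + 1 > 0. [Num.max r 0] supplies the nonnegative variable that
    uniqueness asks for, and the density vanishes for [r <= 0]. *)
Lemma mass_density_law D : measurable D ->
  (\int[P]_(w in sigma @^-1` D) (W w * B w ^+ n * expR (- sigma w))%:E =
   \int[@lebesgue_measure R]_(r in (fun r : R => Num.max r 0%R) @^-1` D)
     (mass_density r * expR (- r))%:E)%E.
Proof.
have [M HM] := bWZ 0%N.
have WM w : W w <= M by have := HM w; rewrite expr0 mulr1.
have mh : measurable_fun setT (fun w => W w * B w ^+ n * expR (- sigma w)).
  apply: measurable_funM; first by apply: measurable_funM => //; exact: measurable_funX.
  by apply: measurableT_comp => //; exact: measurable_funN.
have h0 w : 0 <= W w * B w ^+ n * expR (- sigma w).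
  by rewrite !mulr_ge0 ?exprn_ge0 ?expR_ge0.
have bd (l : R) w : 1 <= l -> W w * B w ^+ n * expR (- l * sigma w) <= M * (n.+1%:R / 1) ^+ n.
  move=> l1; rewrite -mulrA; apply: ler_pM => //; first by rewrite mulr_ge0 ?exprn_ge0 ?expR_ge0.
  apply: le_trans (expr_expR_le n ltr01 (B0 w)); rewrite ler_wpM2l ?exprn_ge0//.
  rewrite ler_expR mulN1r mulNr lerN2 (@le_trans _ _ (sigma w))//.
    by rewrite /sigma lerDr.
  by rewrite ler_peMl.
have ib (l : R) : 1 <= l -> P.-integrable setT (fun w => (W w * B w ^+ n * expR (- l * sigma w))%:E).
  move=> l1; apply: (@integrable_bounded _ _ _ _ _ (M * (n.+1%:R / 1) ^+ n)).
    by apply: measurable_funM; [apply: measurable_funM => //; exact: measurable_funX|exact: mexpN].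
  move=> w; rewrite ger0_norm; last by rewrite !mulr_ge0 ?exprn_ge0 ?expR_ge0.
  exact: bd.
apply: laplace_transform_unique => //.
- apply: measurable_funM; first exact: measurable_mass_density.
  by apply: measurableT_comp => //; exact: measurable_funN.
- by move=> r; rewrite mulr_ge0 ?mass_density_ge0 ?expR_ge0.
- exact: measurable_maxr.
- by move=> r; rewrite le_max lexx orbT.
- by have := integrable_lty measurableT (ib 1 (lexx _)); under eq_integral do rewrite mulN1r.
- move=> k.
  transitivity (\int[P]_w (W w * B w ^+ n * expR (- k.+1%:R * sigma w)))%:E.
    rewrite /Rintegral fineK; last by apply: integrable_fin_num => //; apply: ib; rewrite ler1n.
    apply: eq_integral => w _; rewrite -mulrA -expRD; congr (_ * expR _)%:E.
    by rewrite -natr1; ring.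
  rewrite -(laplace_mass_density (ltr0Sn R k)); apply: eq_integral => r _.
  have [r0|r0] := leP r 0; first by rewrite mass_density_le0// !mul0r.
  rewrite -mulrA -expRD; congr (_ * expR _)%:E.
  by rewrite -natr1; ring.
Qed.

Lemma integral_total_mass (phi : R -> R) : measurable_fun setT phi ->
  (forall r, 0 <= phi r) ->
  (\int[P]_w (W w * B w ^+ n * expR (- sigma w) * phi (sigma w))%:E =
   \int[@lebesgue_measure R]_r (mass_density r * expR (- r) * phi (Num.max r 0%R))%:E)%E.
Proof.
apply: eq_law_integral.
- apply: measurable_funM; first by apply: measurable_funM => //; exact: measurable_funX.
  by apply: measurableT_comp => //; exact: measurable_funN.
- by move=> w; rewrite !mulr_ge0 ?exprn_ge0 ?expR_ge0.
- apply: measurable_funM; first exact: measurable_mass_density.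
  by apply: measurableT_comp => //; exact: measurable_funN.
- by move=> r; rewrite mulr_ge0 ?mass_density_ge0 ?expR_ge0.
- exact: msigma.
- exact: measurable_maxr.
- exact: mass_density_law.
Qed.

Lemma integral_total_mass_ratio (D : set R) : measurable D ->
  (forall r : R, D r -> 0 < r) ->
  (\int[P]_(w in sigma @^-1` D) (W w * (B w / sigma w) ^+ n)%:E =
   \int[@lebesgue_measure R]_(r in D) (mass_density r / r ^+ n)%:E)%E.
Proof.
move=> mD D0.
(* This test function undoes the factor exp(-sigma) and divides B^n by sigma^n. *)
pose phi (r : R) := \1_D r * (expR r * r `^ (- n%:R)).
have mphi : measurable_fun setT phi.
  apply: measurable_funM; first exact: measurable_indic.
  by apply: measurable_funM => //; exact: measurable_powR.
have phi0 r : 0 <= phi r by rewrite !mulr_ge0 ?expR_ge0 ?powR_ge0.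
have phiE (r : R) : 0 < r -> expR (- r) * phi r = \1_D r * (r ^+ n)^-1.
  move=> r0; rewrite /phi powR_invn ?(ltW r0)// expRN.
  by rewrite mulrCA; congr (_ * _); rewrite mulrA mulVf ?mul1r// gt_eqF// expR_gt0.
have D0' (r : R) : r <= 0 -> \1_D r = 0 :> R.
  by move=> r0; rewrite indicE memNset// => /D0 /=; rewrite ltNge r0.
rewrite integral_mkcond [RHS]integral_mkcond !epatch_indic.
transitivity (\int[P]_w (W w * B w ^+ n * expR (- sigma w) * phi (sigma w))%:E)%E.
  apply: eq_integral => w _; rewrite -EFinM -[\1_(_ @^-1` _) w]/(\1_D (sigma w)).
  congr EFin; have [s0|s0] := leP (sigma w) 0; first by rewrite /phi D0'// mul0r !mulr0.
  by rewrite -[in RHS]mulrA phiE// exprMn exprVn; ring.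
rewrite integral_total_mass//; apply: eq_integral => r _; rewrite -EFinM; congr EFin.
have [r0|r0] := leP r 0; first by rewrite D0'// mass_density_le0// !mul0r.
by rewrite -mulrA phiE//=; ring.
Qed.

End density_of_total_mass.

(** * Asymptotics of the density *)

Lemma cvg_pospow1 (R : realType) (p s : R) :
  pospow p (1 - s / k.+1%:R) @[k --> \oo] --> (1 : R).
Proof.
have c1 : {for 1, continuous (fun u : R => u `^ p)}.
  apply/differentiable_continuous/derivable1_diffP.
  exact: (@ex_derive _ _ _ _ _ _ _ (is_derive1_powR p ltr01)).
have cu : 1 - s / k.+1%:R @[k --> \oo] --> (1 : R).
  rewrite -[X in _ --> X]subr0 -[X in _ --> _ - X](mulr0 s).
  by apply: cvgB; [exact: cvg_cst|apply: cvgMl_tmp; exact: cvg_harmonic].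
have cc := continuous_cvg _ c1 cu; rewrite powR1 in cc.
apply: cvg_trans (cc _); apply: near_eq_cvg; near=> k; rewrite /= pospow_gt0// subr_ge0.
rewrite ler_pdivrMr// mul1r (@le_trans _ _ k%:R)// ?ler_nat//.
by near: k; exact: nbhs_infty_ger.
Unshelve. all: by end_near. Qed.

Section mass_density_asymptotics.
Context d (T : measurableType d) (R : realType) (P : probability T R).
Variables (a : R) (A B Z W : T -> R) (n : nat).
Hypothesis a01 : 0 < a < 1.
Hypotheses (mA : measurable_fun setT A) (A0 : forall w, 0 <= A w).
Hypotheses (mB : measurable_fun setT B) (B0 : forall w, 0 <= B w).
Hypotheses (mZ : measurable_fun setT Z) (Z0 : forall w, 0 <= Z w).
Hypotheses (mW : measurable_fun setT W) (W0 : forall w, 0 <= W w).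
Hypothesis bWZ : forall j, exists M, forall w, W w * Z w ^+ j <= M.
Hypothesis na : 1 < n%:R * (1 - a).

Let n0 : (1 < n.+1)%N.
Proof. by case: n na => //; rewrite mul0r ltr10. Qed.

Let p1 : 0 < kernel_exponent a n 1.
Proof. exact: (kernel_exponent_gt0 a01 na (Ordinal n0)). Qed.

Lemma kernel_coef1_gt0 : 0 < kernel_coef a n 1.
Proof.
rewrite divr_gt0//; last first.
  by rewrite fine_gt0// gamma_integral_lty ?gamma_integral_gt0.
by case: n n0 => // m _; exact: stable_coef1_gt0.
Qed.

(** All terms of the density are nonnegative, so only [j = 1] is kept. Once r^p is factored out, its
    integrand W Z (1 - sigma / r)_+^p increases to W Z. *)
Lemma mass_density_lower (e : R) : 0 < e ->
  exists2 r0 : R, 0 < r0 & forall r, r0 <= r ->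
    kernel_coef a n 1 * r `^ kernel_exponent a n 1 * (\int[P]_w (W w * Z w) - e) <=
    mass_density P a A B Z W n r.
Proof.
move=> e0.
have [M HM] := bWZ 1.
have WZM w : W w * Z w <= M by have := HM w; rewrite expr1.
have WZ0 w : 0 <= W w * Z w by rewrite mulr_ge0.
have mWZ : measurable_fun setT (fun w => W w * Z w) by exact: measurable_funM.
set p := kernel_exponent a n 1.
pose f (r : R) w := W w * Z w * pospow p (1 - (A w + B w) / r).
have mf r : measurable_fun setT (f r).
  apply: measurable_funM => //; apply: (measurableT_comp (measurable_pospow p)).
  by apply: measurable_funB => //; apply: measurable_funM => //; exact: measurable_funD.
have f0 r w : 0 <= f r w by rewrite mulr_ge0 ?pospow_ge0.
have pos1 u : 0 <= u -> pospow p (1 - u) <= 1.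
  move=> u0; rewrite -[leRHS](_ : pospow p 1 = 1); last by rewrite pospow_gt0// powR1.
  by apply: le_pospow; [exact: ltW|rewrite gerBl].
have fM r w : 0 < r -> `|f r w| <= M.
  move=> r0; rewrite ger0_norm// (le_trans _ (WZM w))// ler_piMr// pos1//.
  by rewrite divr_ge0 ?addr_ge0// ltW.
have if_ r : 0 < r -> P.-integrable setT (fun w => (f r w)%:E).
  by move=> r0; apply: (@integrable_bounded _ _ _ _ _ M) => // w; exact: fM.
have iWZ : P.-integrable setT (fun w => (W w * Z w)%:E).
  by apply: (@integrable_bounded _ _ _ _ _ M) => // w; rewrite ger0_norm.
have cf : \int[P]_w f k.+1%:R w @[k --> \oo] --> \int[P]_w (W w * Z w).
  apply: fine_cvg; rewrite fineK; last exact: integrable_fin_num.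
  apply: (@cvg_integral_dominated _ _ _ _ _ _ (cst M)) => //.
  - move=> w; rewrite /f -[X in _ --> X]mulr1; apply: cvgMl_tmp.
    exact: cvg_pospow1.
  - exact: finite_measure_integrable_cst.
  - by move=> k w; apply: fM.
(* Convergence is known along the integers; as the integral is nondecreasing in [r], one good
   integer settles all larger real [r]. *)
have /cvgrPdist_lt/(_ e e0)[N _ HN] := cf.
have {HN} := HN N (leqnn N); set r0 : R := N.+1%:R => HN.
exists r0 => [|r r0r]; first by rewrite ltr0n.
have r00 : 0 < r0 by rewrite ltr0n.
have rgt0 : 0 < r by exact: lt_le_trans r0r.
have E1 : mass_moment P a A B Z W n 1 r = r `^ p * \int[P]_w f r w.
  rewrite -RintegralZl//; last exact: if_.
  apply: eq_Rintegral => w _; rewrite /f expr1 mulrCA; congr (_ * _).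
  rewrite -pospowM ?(ltW rgt0)//; congr pospow.
  by rewrite mulrBr mulr1 mulrCA divff ?mulr1// gt_eqF.
have E2 : \int[P]_w f r0 w <= \int[P]_w f r w.
  apply: le_Rintegral => //; [exact: if_|exact: if_|].
  move=> w _; rewrite ler_wpM2l//; apply: le_pospow; first exact: ltW.
  by rewrite lerD2l lerN2 ler_wpM2l ?addr_ge0// lef_pV2 ?posrE.
have E3 : \int[P]_w (W w * Z w) - e <= \int[P]_w f r w.
  apply: le_trans E2; rewrite lerBlDr -lerBlDl; apply: le_trans (ltW HN).
  exact: ler_norm.
apply: (@le_trans _ _ (kernel_coef a n 1 * mass_moment P a A B Z W n 1 r)).
  rewrite E1 mulrA ler_wpM2l// mulr_ge0 ?powR_ge0//.
  exact: ltW kernel_coef1_gt0.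
rewrite /mass_density (bigD1 (Ordinal n0))//= lerDl; apply: sumr_ge0 => j _.
apply: mulr_ge0; first exact: kernel_coef_ge0.
exact: mass_moment_ge0.
Qed.

(** The j-th moment is at most z^j r^(n - j a - 1). The term [j = 0] vanishes, and for [j >= 2] the
    exponent is below that of [j = 1] by at least [a], so all these terms together are at most C
    r^(p - a), where p belongs to [j = 1]. *)
Lemma mass_density_upper (z e : R) : 0 < z -> 0 < e ->
  (forall j w, W w * Z w ^+ j <= z ^+ j) ->
  exists2 r0 : R, 0 < r0 & forall r, r0 <= r ->
    mass_density P a A B Z W n r <=
    r `^ kernel_exponent a n 1 * (kernel_coef a n 1 * z + e).
Proof.
move=> z0 e0 WZz; have [a0 a1] := andP a01.
pose C := \sum_(j < n.+1) kernel_coef a n j * z ^+ j.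
have C0 : 0 <= C.
  by apply: sumr_ge0 => j _; apply: mulr_ge0; [exact: kernel_coef_ge0|rewrite exprn_ge0 ?ltW].
(* Beyond the second entry C r^(-a) <= e, and [1 <= r] makes the powers of [r] monotone in the
   exponent. *)
pose r0 := Num.max 1 ((C / e) `^ (a^-1)).
have r01 : 1 <= r0 by rewrite le_max lexx.
exists r0 => [|r rr0]; first exact: lt_le_trans r01.
have r1 : 1 <= r by exact: le_trans rr0.
have rgt0 : 0 < r by exact: lt_le_trans r1.
have Ce : C * r `^ (- a) <= e.
  rewrite powRN ler_pdivrMr ?powR_gt0// mulrC -ler_pdivrMr//.
  have -> : C / e = ((C / e) `^ a^-1) `^ a.
    by rewrite -powRrM mulVf ?gt_eqF// powRr1// divr_ge0// ltW.
  rewrite ge0_ler_powR ?nnegrE ?powR_ge0 ?(ltW a0) ?(ltW rgt0)//.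
  by apply: le_trans rr0; rewrite le_max lexx orbT.
have mm (j : 'I_n.+1) : mass_moment P a A B Z W n j r <= z ^+ j * r `^ kernel_exponent a n j.
  rewrite -pospow_gt0 ?(ltW rgt0)//.
  apply: (@le_trans _ _ (\int[P]_(w in setT) (z ^+ j * pospow (kernel_exponent a n j) r))).
    apply: le_Rintegral => //.
    - exact: mass_integrand_integrable.
    - exact: finite_measure_integrable_cst.
    - move=> w _; apply: ler_pM; rewrite ?pospow_ge0 ?mulr_ge0 ?exprn_ge0//.
      exact: pospow_mass_le.
  rewrite Rintegral_cst//; have := probability_setT P => /= ->.
  by rewrite mulr1.
have kj (j : 'I_n.+1) : 0 <= kernel_coef a n j by exact: kernel_coef_ge0.
pose p := kernel_exponent a n 1.
rewrite mulrDr /mass_density (bigD1 (Ordinal n0))//=; apply: lerD.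
  rewrite mulrCA ler_wpM2l ?(ltW kernel_coef1_gt0)// mulrC.
  by have := mm (Ordinal n0); rewrite /= expr1.
apply: (@le_trans _ _ (r `^ p * (C * r `^ (- a)))); last by rewrite ler_wpM2l ?powR_ge0.
rewrite /C mulr_suml mulr_sumr [leRHS](bigD1 (Ordinal n0))//=.
apply: ler_wpDl.
  rewrite mulr_ge0 ?powR_ge0// mulr_ge0 ?powR_ge0// mulr_ge0 ?expr1 ?(ltW z0)//.
  exact: ltW kernel_coef1_gt0.
apply: ler_sum => -[[|j] /= jn] j1.
  rewrite [kernel_coef a n 0](_ : _ = 0) ?mul0r ?mulr0//.
  by rewrite /kernel_coef; case: n n0 => // m _; rewrite stable_coef0 mul0r.
pose J := Ordinal jn.
rewrite [leRHS](_ : _ = kernel_coef a n j.+1 * (z ^+ j.+1 * (r `^ p * r `^ (- a)))); last by ring.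
apply: ler_wpM2l; first exact: (kj J).
apply: (le_trans (mm J)) => /=; rewrite ler_wpM2l ?exprn_ge0 ?(ltW z0)//.
rewrite -powRD; last by apply/implyP => _; rewrite gt_eqF.
rewrite ler_powR// /p /kernel_exponent.
have j2 : 2%:R <= j.+1%:R :> R by rewrite ler_nat; case: j jn j1 J.
have := ler_wpM2r (ltW a0) j2.
lra.
Qed.

End mass_density_asymptotics.

Lemma measurable_ge0_invr d (T : measurableType d) (R : realType) (f : T -> R) :
  measurable_fun setT f -> (forall w, 0 <= f w) ->
  measurable_fun setT (fun w => (f w)^-1).
Proof.
move=> mf f0; rewrite (_ : (fun w => (f w)^-1) = (fun w => f w `^ (-1))).
  exact: (measurableT_comp (measurable_powR (-1))).
by apply/funext => w; rewrite powR_inv1.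
Qed.

(** * Comparison of the laws of the total mass under two weights *)

Section mass_comparison.
Context d (T : measurableType d) (R : realType) (P : probability T R).
Variables (a : R) (n : nat).
Hypotheses (a01 : 0 < a < 1) (na : 1 < n%:R * (1 - a)).
Variables (A B Z W : T -> R).
Hypotheses (mA : measurable_fun setT A) (A0 : forall w, 0 <= A w).
Hypotheses (mB : measurable_fun setT B) (B0 : forall w, 0 <= B w).
Hypotheses (mZ : measurable_fun setT Z) (Z0 : forall w, 0 <= Z w).
Hypotheses (mW : measurable_fun setT W) (W0 : forall w, 0 <= W w).
Hypothesis bWZ : forall j, exists M, forall w, W w * Z w ^+ j <= M.
Hypothesis H : forall (j : nat) (s l : R), 0 <= s -> 0 < l ->
  \int[P]_w (W w * Z w ^+ j * expR (- s * A w) * expR (- l * B w)) =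
  \int[P]_w (W w * Z w ^+ j * expR (- s * A w) * expR (- Z w * l `^ a)).

(** The ratio B / (A + B) lies in [0, 1], with value 0 when the denominator vanishes; removing its
    n-th power can only increase the integral. *)
Lemma mass_density_law_le (D : set R) : measurable D ->
  (forall r : R, D r -> 0 < r) ->
  (\int[@lebesgue_measure R]_(r in D) (mass_density P a A B Z W n r / r ^+ n)%:E <=
   \int[P]_(w in (A \+ B)%R @^-1` D) (W w)%:E)%E.
Proof.
move=> mD D0; rewrite -(integral_total_mass_ratio a01 mA A0 mB B0 mZ Z0 mW W0 bWZ H na mD D0).
have mS : measurable_fun setT (fun w => A w + B w) by exact: measurable_funD.
have mSD : measurable ((A \+ B)%R @^-1` D) by exact: preimage_measurable.
have BS w : 0 <= B w / (A w + B w) <= 1.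
  rewrite divr_ge0 ?addr_ge0//=; have [->|AB] := eqVneq (A w + B w) 0.
    by rewrite invr0 mulr0.
  by rewrite ler_pdivrMr ?mul1r ?lerDr// lt_neqAle eq_sym AB addr_ge0.
apply: ge0_le_integral => //.
- move=> w _; rewrite lee_fin mulr_ge0// exprn_ge0//.
  by case/andP: (BS w).
- apply/measurable_EFinP; apply: measurable_funTS; apply: measurable_funM => //.
  apply: measurable_funX; apply: measurable_funM => //.
  by apply: measurable_ge0_invr => // w; exact: addr_ge0.
- by apply/measurable_EFinP; exact: measurable_funTS.
- move=> w _; rewrite lee_fin ler_piMr//.
  by case/andP: (BS w) => *; exact: exprn_ile1.
Qed.

Variables (B' Z' W' : T -> R) (z : R).
Hypotheses (mB' : measurable_fun setT B') (B0' : forall w, 0 <= B' w).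
Hypotheses (mZ' : measurable_fun setT Z') (Z0' : forall w, 0 <= Z' w).
Hypotheses (mW' : measurable_fun setT W') (W0' : forall w, 0 <= W' w).
Hypotheses (z0 : 0 < z) (WZz : forall j w, W' w * Z' w ^+ j <= z ^+ j).

Let bWZ' j : exists M, forall w, W' w * Z' w ^+ j <= M.
Proof. by exists (z ^+ j) => w. Qed.

Hypothesis H' : forall (j : nat) (s l : R), 0 <= s -> 0 < l ->
  \int[P]_w (W' w * Z' w ^+ j * expR (- s * 0) * expR (- l * B' w)) =
  \int[P]_w (W' w * Z' w ^+ j * expR (- s * 0) * expR (- Z' w * l `^ a)).

Local Notation density := (mass_density P a A B Z W n).
Local Notation density' := (mass_density P a (fun=> 0) B' Z' W' n).

(** Dividing the lower bound for one weight by the upper bound for the other cancels the common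
    factor k_1 r^p and leaves E[W Z] / z. *)
Lemma mass_density_ratio (e : R) : 0 < e ->
  exists2 r0 : R, 0 < r0 & forall r, r0 <= r ->
    (\int[P]_w (W w * Z w) / z - e) * density' r <= density r.
Proof.
move=> e0; set EZ := \int[P]_w (W w * Z w).
have EZ0 : 0 <= EZ by apply: Rintegral_ge0 => w _; rewrite mulr_ge0.
have dens0 r : 0 <= density r by exact: mass_density_ge0.
have dens0' r : 0 <= density' r by exact: mass_density_ge0.
pose k := kernel_coef a n 1.
have k0 : 0 < k by exact: kernel_coef1_gt0.
(* A nonpositive constant is trivial; otherwise the upper bound may be multiplied by it. *)
have [neg|pos] := leP (EZ / z - e) 0.
  exists 1 => // r _; apply: le_trans (dens0 r).
  by rewrite mulr_le0_ge0.
(* The slack e k z is shared: k e1 is one half of it and (EZ / z) e2 at most the other half.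
   [EZ + 1] stands for [EZ] to avoid a zero denominator. *)
pose e1 := e * z / 2; pose e2 := e * k * z ^+ 2 / (2 * (EZ + 1)).
have EZ1 : 0 < EZ + 1 by rewrite ltr_wpDl.
have e10 : 0 < e1 by rewrite !mulr_gt0// invr_gt0.
have e20 : 0 < e2.
  exact: divr_gt0 (mulr_gt0 (mulr_gt0 e0 k0) (exprn_gt0 2 z0)) (mulr_gt0 (ltr0Sn R 1) EZ1).
have [r1 r10 L1] := mass_density_lower P a01 mA A0 mB B0 mZ Z0 mW W0 bWZ na e10.
have [r2 r20 L2] := mass_density_upper P a01 (@measurable_cst _ _ _ _ _ (0 : R))
  (fun=> lexx 0) mB' B0' mZ' Z0' mW' W0' bWZ' na z0 e20 WZz.
exists (Num.max r1 r2) => [|r]; first by rewrite lt_max r10.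
rewrite ge_max => /andP[rr1 rr2].
apply: le_trans (L1 _ rr1).
apply: (le_trans (ler_wpM2l (ltW pos) (L2 _ rr2))).
rewrite -/k -/EZ mulrCA [leRHS](_ : _ = r `^ kernel_exponent a n 1 * (k * (EZ - e1))); last first.
  by rewrite mulrA [_ * k]mulrC.
rewrite ler_wpM2l ?powR_ge0//.
have E2 : EZ / z * e2 <= e * k * z / 2.
  rewrite /e2 [leLHS](_ : _ = e * k * z / 2 * (EZ / (EZ + 1))); last first.
    by field; rewrite ?gt_eqF// ?(gt_eqF z0).
  rewrite ler_piMr//.
    exact: divr_ge0 (mulr_ge0 (mulr_ge0 (ltW e0) (ltW k0)) (ltW z0)) (ler0n R 2).
  by rewrite ler_pdivrMr// mul1r lerDl.
have E3 : EZ / z * (k * z) = k * EZ by field; rewrite gt_eqF.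
have : 0 <= e * e2 by rewrite mulr_ge0// ltW.
rewrite /e1 mulrBl [EZ / z * _]mulrDr E3.
lra.
Qed.

Lemma mass_density_gt0 : 0 < \int[P]_w (W w * Z w) ->
  exists2 r0 : R, 0 < r0 & forall r, r0 <= r -> 0 < density r.
Proof.
move=> EZ0.
have e0 : 0 < \int[P]_w (W w * Z w) / 2 by rewrite divr_gt0.
have [r1 r10 L1] := mass_density_lower P a01 mA A0 mB B0 mZ Z0 mW W0 bWZ na e0.
exists r1 => // r rr1; apply: lt_le_trans (L1 _ rr1).
have r0 : 0 < r by exact: lt_le_trans rr1.
apply: mulr_gt0; first exact: mulr_gt0 (kernel_coef1_gt0 a01 na) (powR_gt0 _ r0).
by rewrite subr_gt0 gtr_pMr// invf_lt1// ltr1n.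
Qed.

(** The comparison of densities is divided by r^n and integrated over [D]. A single [r0] serves all
    [D], however small, which is what the disintegration requires. *)
Lemma total_mass_comparison (e : R) : 0 < e ->
  exists2 r0 : R, 0 < r0 & forall D : set R, measurable D ->
    (forall r, D r -> r0 <= r) ->
    ((\int[P]_w (W w * Z w) / z - e)%:E * \int[P]_(w in B' @^-1` D) (W' w)%:E <=
     \int[P]_(w in (A \+ B)%R @^-1` D) (W w)%:E)%E.
Proof.
move=> /mass_density_ratio[r0 r00 L]; exists r0 => // D mD Dr0.
have D0 r : D r -> 0 < r by move=> /Dr0; exact: lt_le_trans.
apply: le_trans (mass_density_law_le mD D0).
(* For the reference weight the past mass is 0, so B' is the whole total mass, the ratio in
   [integral_total_mass_ratio] is 1, and the density is exact. *)
have E' : (\int[P]_(w in B' @^-1` D) (W' w)%:E =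
    \int[@lebesgue_measure R]_(r in D) (density' r / r ^+ n)%:E)%E.
  rewrite -(integral_total_mass_ratio a01 (@measurable_cst _ _ _ _ _ (0 : R))
    (fun=> lexx 0) mB' B0' mZ' Z0' mW' W0' bWZ' H' na mD D0).
  have -> : (fun w => 0 + B' w) = B' by apply/funext => w; rewrite add0r.
  apply: eq_integral => w /set_mem /D0 Bw; congr EFin.
  by rewrite /= add0r divff ?expr1n ?mulr1// gt_eqF.
have mdens : measurable_fun setT density by exact: measurable_mass_density.
have mdens' : measurable_fun setT density'.
  by apply: measurable_mass_density => //; exact: measurable_cst.
have mV : measurable_fun D (fun r : R => (r ^+ n)^-1).
  apply: (@eq_measurable_fun _ _ _ _ _ (fun r : R => r `^ (- n%:R))).
    by move=> r /set_mem /D0 r_gt0; rewrite powR_invn ?ltW.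
  exact: (measurable_funTS (measurable_powR (- n%:R))).
have m1 : measurable_fun D (fun r : R => (density r / r ^+ n)%:E).
  by apply/measurable_EFinP; exact: (measurable_funM (measurable_funTS mdens) mV).
have m1' : measurable_fun D (fun r : R => (density' r / r ^+ n)%:E).
  by apply/measurable_EFinP; exact: (measurable_funM (measurable_funTS mdens') mV).
have dens0 r : 0 <= density r by exact: mass_density_ge0.
have dens0' r : 0 <= density' r by exact: mass_density_ge0.
have p0 (f : R -> R) r : (forall r, 0 <= f r) -> D r -> 0 <= f r / r ^+ n.
  by move=> f0 /D0 rgt0; rewrite divr_ge0// exprn_ge0// ltW.
rewrite E'; have [neg|pos] := leP (\int[P]_w (W w * Z w) / z - e) 0.
  apply: (@le_trans _ _ 0%E).
    by rewrite mule_le0_ge0// ?lee_fin//; apply: integral_ge0 => r Dr; rewrite lee_fin p0.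
  by apply: integral_ge0 => r Dr; rewrite lee_fin p0.
rewrite -ge0_integralZl_EFin; [|exact: mD| |exact: m1'|exact: ltW].
- apply: ge0_le_integral; first exact: mD.
  + by move=> r Dr; rewrite -EFinM lee_fin mulr_ge0 ?(ltW pos)// p0.
  + exact: measurable_funeM m1'.
  + exact: m1.
  + move=> r Dr; rewrite -EFinM lee_fin mulrA ler_wpM2r ?invr_ge0 ?exprn_ge0 ?(ltW (D0 _ Dr))//.
    exact: L (Dr0 _ Dr).
- by move=> r Dr; rewrite lee_fin p0.
Qed.

End mass_comparison.

(** The density is strictly positive far out, so a set there that the weighted law does not charge
    is Lebesgue-null. This converts null sets for the law of the total mass into Lebesgue-null
    ones. *)
Lemma total_mass_law_null d (T : measurableType d) (R : realType)
    (P : probability T R) (a : R) (n : nat) (A B Z W : T -> R) :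
  0 < a < 1 -> 1 < n%:R * (1 - a) ->
  measurable_fun setT A -> (forall w, 0 <= A w) ->
  measurable_fun setT B -> (forall w, 0 <= B w) ->
  measurable_fun setT Z -> (forall w, 0 <= Z w) ->
  measurable_fun setT W -> (forall w, 0 <= W w) ->
  (forall j, exists M, forall w, W w * Z w ^+ j <= M) ->
  (forall (j : nat) (s l : R), 0 <= s -> 0 < l ->
  \int[P]_w (W w * Z w ^+ j * expR (- s * A w) * expR (- l * B w)) =
  \int[P]_w (W w * Z w ^+ j * expR (- s * A w) * expR (- Z w * l `^ a))) ->
  0 < \int[P]_w (W w * Z w) ->
  exists2 r0 : R, 0 < r0 & forall D : set R, measurable D ->
    (forall r, D r -> r0 <= r) ->
    (\int[P]_(w in (A \+ B)%R @^-1` D) (W w)%:E = 0)%E ->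
    (@lebesgue_measure R) D = 0%E.
Proof.
move=> a01 na mA A0 mB B0 mZ Z0 mW W0 bWZ H EZ.
have [r0 r00 dens_gt0] := mass_density_gt0 a01 na mA A0 mB B0 mZ Z0 mW W0 bWZ EZ.
exists r0 => // D mD Dr0 W_eq0.
have D0 r : D r -> 0 < r by move=> /Dr0; exact: lt_le_trans.
have := mass_density_law_le a01 na mA A0 mB B0 mZ Z0 mW W0 bWZ H mD D0.
rewrite W_eq0.
set g := fun r : R => mass_density P a A B Z W n r / r ^+ n.
have g0 r : D r -> 0 < g r.
  by move=> Dr; rewrite divr_gt0 ?dens_gt0 ?exprn_gt0 ?D0 ?Dr0.
move=> le0.
have mg : measurable_fun D g.
  apply: (@eq_measurable_fun _ _ _ _ _ (fun r : R => mass_density P a A B Z W n r * r `^ (- n%:R))).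
    by move=> r /set_mem /D0 r_gt0; rewrite powR_invn ?ltW.
  apply: measurable_funM; last exact: (measurable_funTS (measurable_powR (- n%:R))).
  by apply: measurable_funTS; exact: measurable_mass_density.
have : (\int[@lebesgue_measure R]_(r in D) `|(g r)%:E| = 0)%E.
  apply/eqP; rewrite eq_le; apply/andP; split; last by apply: integral_ge0 => r _.
  apply: le_trans le0; rewrite le_eqVlt; apply/orP; left; apply/eqP.
  by apply: eq_integral => r /set_mem Dr; rewrite gee0_abs// lee_fin ltW// g0.
have mEg : measurable_fun D (EFin \o g) by exact/measurable_EFinP.
move=> abs0; have [N [mN N0 gN]] := (ae_eq_integral_abs (@lebesgue_measure R) mD mEg).1 abs0.
have DN : D `<=` N.
  move=> r Dr; apply: gN => /= /(_ Dr) [g_eq0].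
  by have := g0 r Dr; rewrite g_eq0 ltxx.
apply/eqP; rewrite eq_le measure_ge0 andbT -N0; by apply: le_measure => //; exact: mem_set.
Qed.

(** * Right-continuous paths and Riemann sums *)

Lemma right_continuous_riemann_sum (R : realType) (f : R -> R) (t u M : R) :
  0 < u -> (forall s, t <= s <= t + u -> `|f s| <= M) ->
  (forall s, t <= s < t + u -> f y @[y --> s^'+] --> f s) ->
  measurable_fun `[t, t + u[%classic f /\
  (u / m.+1%:R * \sum_(k < m.+1) f (t + k.+1%:R * (u / m.+1%:R)))%:E @[m --> \oo]
    --> (\int[@lebesgue_measure R]_(s in `[t, (t + u)%R[) (f s)%:E)%E.
Proof.
move=> u0 fM frc.
pose h m : R := u / m.+1%:R.
have h0 m : 0 < h m by rewrite divr_gt0.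
have hu m : m.+1%:R * h m = u by rewrite /h mulrCA divff ?mulr1// pnatr_eq0.
pose I m (k : nat) : set R := `[t + k%:R * h m, t + k.+1%:R * h m[%classic.
pose step m s := \sum_(k < m.+1) f (t + k.+1%:R * h m) * \1_(I m k) s.
pose g s := f s * \1_`[t, t + u[%classic s.
pose K m s := Num.truncn ((s - t) / h m).
(* The right endpoint of the cell containing [s] lies strictly to the right of [s] and tends to [s],
   so right continuity alone makes the step functions converge. The measurability of [f] on the
   interval comes from the same limit. *)
pose y m s := t + (K m s).+1%:R * h m.
have KP m s : t <= s -> (K m s)%:R * h m <= s - t < (K m s).+1%:R * h m.
  move=> ts; have st : 0 <= (s - t) / h m by rewrite divr_ge0 ?subr_ge0// ltW.
  rewrite -ler_pdivlMr// -ltr_pdivrMr//; exact: truncn_itv.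
have IP m k s : t <= s -> I m k s -> k = K m s.
  rewrite /I/= in_itv/= => ts /andP[s1 s2].
  have st : 0 <= (s - t) / h m by rewrite divr_ge0 ?subr_ge0// ltW.
  apply/esym/eqP; rewrite truncn_eq// ler_pdivlMr// ltr_pdivrMr//.
  by rewrite lerBrDl s1 ltrBlDl.
have Km m s : t <= s < t + u -> (K m s < m.+1)%N.
  move=> /andP[ts su]; have /andP[k1 _] := KP m s ts.
  rewrite -(ltr_nat R) -(ltr_pM2r (h0 m)) (le_lt_trans k1)// hu ltrBlDl//.
have stepE m s : step m s = f (y m s) * \1_`[t, t + u[%classic s.
  have [/= sI|sI] := pselect (`[t, t + u[%classic s).
    rewrite [in RHS]indicE mem_set// mulr1.
    move: sI; rewrite /= in_itv/= => tsu; have /andP[ts su] := tsu.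
    rewrite /step (bigD1 (Ordinal (Km m s tsu)))//= big1 ?addr0.
      have Is : I m (K m s) s by rewrite /I/= in_itv/= -lerBrDl -ltrBlDl; exact: KP.
      by rewrite indicE mem_set// mulr1.
    move=> k kK; rewrite indicE memNset ?mulr0// => /(IP _ _ _ ts) kE.
    by move/eqP: kK; apply; exact: val_inj.
  rewrite [in RHS]indicE memNset// mulr0; apply: big1 => k _.
  rewrite indicE memNset ?mulr0// => Is; apply: sI.
  move: Is; rewrite /I/= !in_itv/= => /andP[s1 s2]; apply/andP; split.
    by apply: le_trans s1; rewrite lerDl mulr_ge0// ltW.
  apply: (lt_le_trans s2); rewrite lerD2l -(hu m) ler_wpM2r ?ler_nat ?(ltn_ord k)//.
  exact: ltW.
have yP m s : t <= s < t + u -> s < y m s <= s + h m.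
  move=> /andP[ts su]; have /andP[k1 k2] := KP m s ts.
  rewrite /y -ltrBlDl k2/= -natr1 mulrDl mul1r addrA lerD2r.
  by rewrite -lerBrDl.
have yT m s : t <= s < t + u -> t <= y m s <= t + u.
  move=> tsu; have /andP[ts su] := tsu; have /andP[sy _] := yP m s tsu.
  rewrite (le_trans ts (ltW sy))/= lerD2l -(hu m) ler_wpM2r ?ler_nat ?Km//.
  exact: ltW.
have hcvg : h m @[m --> \oo] --> (0 : R).
  by rewrite -[X in _ --> X](mulr0 u); apply: cvgMl_tmp; exact: cvg_harmonic.
have stepcvg s : step m s @[m --> \oo] --> g s.
  under eq_fun do rewrite stepE.
  have [/= sI|sI] := pselect (`[t, t + u[%classic s); last first.
    by rewrite /g indicE memNset// mulr0; under eq_fun do rewrite mulr0; exact: cvg_cst.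
  rewrite /g indicE mem_set// mulr1; under eq_fun do rewrite mulr1.
  move: sI; rewrite /= in_itv/= => tsu.
  have /cvg_at_rightP := frc s tsu; apply; split.
    by move=> m; case/andP: (yP m s tsu).
  have sh : s + h m @[m --> \oo] --> s.
    by rewrite -[X in _ --> X]addr0; apply: cvgD => //; exact: cvg_cst.
  apply: (squeeze_cvgr _ (cvg_cst s) sh).
  by near=> m; case/andP: (yP m s tsu) => /ltW -> ->.
have mstep m : measurable_fun setT (step m).
  apply: measurable_sum => k; apply: measurable_funM; first exact: measurable_cst.
  by apply: measurable_indic; exact: measurable_itv.
have mg : measurable_fun setT g.
  by apply: (measurable_fun_cvg mstep) => s _; exact: stepcvg.
split.
  apply: (@eq_measurable_fun _ _ _ _ _ g); last exact: measurable_funTS.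
  by move=> s sI; rewrite /g indicE sI mulr1.
rewrite integral_mkcond epatch_indic.
rewrite (_ : (fun s => _) = (fun s => (g s)%:E)); last by apply/funext => s; rewrite -EFinM.
rewrite (_ : (fun m => _) = (fun m => \int[@lebesgue_measure R]_s (step m s)%:E)%E); last first.
  apply/funext => m; rewrite /step; under [RHS]eq_integral do rewrite -sumEFin.
  rewrite integral_sum//; last first.
    move=> k; under eq_fun do rewrite EFinM; apply: integrableZl => //.
    exact: integrable_indic_itv.
  rewrite mulr_sumr -sumEFin; apply: eq_bigr => k _.
  under [RHS]eq_integral do rewrite EFinM.
  rewrite integralZl//; last exact: integrable_indic_itv.
  rewrite integral_indic; [|exact: measurableT|exact: measurable_itv].
  have Ih : (@lebesgue_measure R) (I m k) = (h m)%:E.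
    rewrite /I lebesgue_measure_itv/= lte_fin ltrD2l ltr_pM2r// ltr_nat ltnSn.
    by rewrite -EFinB; congr EFin; rewrite -natr1; ring.
  rewrite setIT [X in (_ * X)%E](_ : _ = (h m)%:E); last exact: Ih.
  by rewrite -EFinM mulrC.
apply: (@cvg_integral_dominated _ _ _ (@lebesgue_measure R) step g
  (fun s => M * \1_`[t, t + u[%classic s) mstep stepcvg).
- exact: (integrableZl measurableT M (integrable_indic_itv t (t + u) true true)).
- move=> m s; rewrite stepE.
  have [sI|sI] := pselect (`[t, t + u[%classic s); last first.
    by rewrite indicE memNset// !mulr0 normr0.
  by rewrite indicE mem_set// !mulr1 fM// yT.
Unshelve. all: by end_near. Qed.

(** One-sided limits bound [f] near each point, and compactness of [0, T] makes the bound
    uniform. *)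
Lemma rcll_bounded (R : realType) (f : R -> R) (T : R) : rcll f ->
  exists M : R, forall s : R, 0 <= s <= T -> `|f s| <= M.
Proof.
move=> [rc ll].
have loc (x : R) : 0 <= x -> exists M0 : R, \forall s \near x, 0 <= s -> `|f s| <= M0.
  move=> x0.
  have R1 : \forall s \near x, x < s -> `|f s| <= `|f x| + 1.
    suff: \forall s \near x^'+, `|f s| <= `|f x| + 1 by [].
    have /cvgrPdist_le/(_ 1 ltr01) := rc x x0.
    apply: filterS => s fs; rewrite -lerBlDl.
    by apply: le_trans fs; rewrite distrC; apply: le_trans (lerB_dist _ _); exact: lexx.
  have [l L1] : exists l : R, \forall s \near x, s < x -> 0 <= s -> `|f s| <= l.
    (* At 0 there is no left limit, but no [s >= 0] lies to the left either. *)
    move: x0; rewrite le_eqVlt => /predU1P[<-|x0].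
      by exists 0; near=> s => s0; rewrite leNgt s0.
    have /cvg_ex[l /cvgrPdist_le/(_ 1 ltr01) fl] := ll x x0.
    exists (`|l| + 1).
    suff: \forall s \near x^'-, 0 <= s -> `|f s| <= `|l| + 1 by [].
    apply: filterS fl => s fs _; rewrite -lerBlDl.
    by apply: le_trans fs; rewrite distrC; apply: le_trans (lerB_dist _ _); exact: lexx.
  exists (Num.max (`|f x| + 1) l); near=> s => s0; rewrite le_max.
  have [sx|sx|->] := ltgtP s x.
  - by apply/orP; right; move: sx s0; near: s.
  - by apply/orP; left; move: sx; near: s.
  - by rewrite lerDl ler01.
have /compact_near_coveringP/(_ R +oo%R (fun M (s : R) => 0 <= s -> `|f s| <= M)) :=
  @segment_compact R 0 T.
move=> /(_ _)[].
  move=> x; rewrite /= in_itv/= => /andP[x0 _]; have [M0 HM0] := loc x x0.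
  near=> s M => /= s0; apply: (@le_trans _ _ M0).
    by move: s0; near: s.
  by near: M; apply: nbhs_pinfty_ge; exact: num_real.
move=> M [_ HM]; exists (M + 1) => s /[dup] sT /andP[s0 _].
by apply: HM => //; rewrite ltrDl.
Unshelve. all: by end_near. Qed.

Lemma rcll_measurable (R : realType) (f : R -> R) : rcll f ->
  measurable_fun (`[0, +oo[ : set R) f.
Proof.
move=> rf.
have -> : (`[0, +oo[%classic : set R) = \bigcup_(n : nat) `[0, 0 + n.+1%:R[%classic.
  apply/seteqP; split => x /=; last first.
    by move=> [n _] /=; rewrite !in_itv/= => /andP[->].
  rewrite in_itv/= andbT => x0; exists (Num.truncn x) => //=.
  by rewrite in_itv/= x0 add0r truncnS_gt.
apply/measurable_fun_bigcup => // n.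
have [M HM] := rcll_bounded (n.+1%:R) rf.
have [//|||//] := @right_continuous_riemann_sum R f 0 n.+1%:R M.
- by move=> s; rewrite add0r; exact: HM.
- by move=> s /andP[s0 _]; exact: rf.1.
Qed.

(** * The cumulant equation *)

Section cumulant.
Context {R : realType}.
Variables (c gamma : R).
Hypotheses (c0 : 0 < c) (gamma1 : 1 < gamma).

Local Notation Phi := (fun l : R => c * l `^ gamma).

Let gamma0 : 0 <= gamma. Proof. exact/ltW/(lt_trans ltr01). Qed.

Let Phi_ge0 (l : R) : 0 <= c * l `^ gamma.
Proof. by rewrite mulr_ge0 ?powR_ge0// ltW. Qed.

Let le_Phi (x y : R) : 0 <= x -> x <= y -> c * x `^ gamma <= c * y `^ gamma.
Proof.
by move=> x0 xy; rewrite ler_pM2l// ge0_ler_powR ?nnegrE//; exact: le_trans xy.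
Qed.

Variables (l : R) (u : R -> R).
Hypotheses (l0 : 0 <= l) (uP : cumulant_solution Phi l u).

Lemma cumulant_ge0 t : 0 <= t -> 0 <= u t. Proof. by case: uP => + _ _ _; exact. Qed.

Lemma cumulant_le t : 0 <= t -> u t <= l.
Proof.
move=> t0; case: uP => _ _ _ /(_ t t0) ->.
by rewrite gerBl; apply: Rintegral_ge0 => s _; exact: Phi_ge0.
Qed.

Lemma cumulant_antitone s t : 0 <= s -> s <= t -> u t <= u s.
Proof.
move=> s0 st; have t0 := le_trans s0 st; case: uP => _ _ ui uE.
rewrite (uE t t0) (uE s s0) lerD2l lerN2 /Rintegral; apply: fine_le.
- by apply: integrable_fin_num => //; exact: ui.
- by apply: integrable_fin_num => //; exact: ui.
- apply: ge0_subset_integral => //.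
  + exact: measurable_int (ui t t0).
  + by move=> r _; rewrite lee_fin Phi_ge0.
  + by move=> r; rewrite /= !in_itv/= => /andP[-> rs]; exact: le_trans st.
Qed.

Let Rintegral_cst_itv (t k : R) : 0 <= t ->
  \int[@lebesgue_measure R]_(s in `[0, t]) k = k * t.
Proof.
move=> t0; rewrite Rintegral_cst//= lebesgue_measure_itv/= lte_fin.
by case: ltgtP t0 => //= [t0 _|<-]; rewrite ?subr0 ?mulr0.
Qed.

Let icst (t k : R) : 0 <= t ->
  (@lebesgue_measure R).-integrable `[0, t] (EFin \o (fun=> k)).
Proof.
move=> t0; apply: measurable_bounded_integrable => //.
  rewrite /= lebesgue_measure_itv/=; case: ifPn => _; by rewrite ?ltry.
by exists `|k|; split => // x kx y _ /=; exact: ltW.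
Qed.

(** On [0, t] the integrand Phi(u_s) lies between Phi(u_t) and Phi(l); this estimate and the next
    are the two resulting sides. *)
Lemma cumulant_lower t : 0 <= t -> l - u t <= t * (c * l `^ gamma).
Proof.
move=> t0; case: uP => u0 _ ui uE.
rewrite (uE t t0) opprB addrCA subrr addr0 mulrC -(Rintegral_cst_itv (c * l `^ gamma) t0).
apply: le_Rintegral => //; [exact: ui|exact: icst|].
move=> s; rewrite /= in_itv/= => /andP[s0 _].
by apply: le_Phi; [exact: u0|exact: cumulant_le].
Qed.

Lemma cumulant_upper t : 0 <= t -> t * (c * u t `^ gamma) <= l - u t.
Proof.
move=> t0; case: uP => u0 _ ui uE.
rewrite [X in _ <= _ - X](uE t t0) opprB addrCA subrr addr0 mulrC.
rewrite -(Rintegral_cst_itv (c * u t `^ gamma) t0).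
apply: le_Rintegral => //; [exact: icst|exact: ui|].
move=> s; rewrite /= in_itv/= => /andP[s0 st].
by apply: le_Phi; [exact: u0|exact: cumulant_antitone].
Qed.

(** The difference quotient over a step h is squeezed between Phi(u_h) and Phi(l), and Phi is
    continuous at [l > 0]. *)
Lemma cumulant_derivative x : 0 < l -> 0 < x ->
  (l - u (x / m.+1%:R)) / (x / m.+1%:R) @[m --> \oo] --> c * l `^ gamma.
Proof.
move=> lgt0 x0; pose h m : R := x / m.+1%:R.
have h0 m : 0 < h m by rewrite divr_gt0.
have hcvg : h m @[m --> \oo] --> (0 : R).
  by rewrite -[X in _ --> X](mulr0 x); apply: cvgMl_tmp; exact: cvg_harmonic.
have ucvg : u (h m) @[m --> \oo] --> l.
  have H : l - h m * (c * l `^ gamma) @[m --> \oo] --> l.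
    rewrite -[X in _ --> X]subr0 -[X in _ --> _ - X](mul0r (c * l `^ gamma)).
    by apply: cvgB; [exact: cvg_cst|exact: cvgMr_tmp].
  apply: (squeeze_cvgr _ H (cvg_cst l)); near=> m.
  by rewrite cumulant_le ?(ltW (h0 m))// andbT lerBlDr -lerBlDl cumulant_lower// ltW.
have c1 : {for l, continuous (fun u : R => u `^ gamma)}.
  apply/differentiable_continuous/derivable1_diffP.
  exact: (@ex_derive _ _ _ _ _ _ _ (is_derive1_powR gamma lgt0)).
have H1 : c * (u (h m)) `^ gamma @[m --> \oo] --> c * l `^ gamma.
  by apply: cvgMl_tmp; exact: (continuous_cvg _ c1 ucvg).
apply: (squeeze_cvgr _ H1 (cvg_cst _)); near=> m.
rewrite ler_pdivlMr ?(h0 m)// ler_pdivrMr ?(h0 m)// ![_ * (x / _)]mulrC.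
by rewrite cumulant_upper ?cumulant_lower// ltW// h0.
Unshelve. all: by end_near. Qed.

(** While u_t >= e, [cumulant_upper] gives t Phi(e) <= l, which fails for large t. *)
Lemma cumulant_cvg0 t : 0 <= t -> u (t + m%:R) @[m --> \oo] --> (0 : R).
Proof.
move=> t0; apply/cvgrPdist_lt => e e0; near=> m.
have tm : 0 <= t + m%:R by rewrite addr_ge0.
rewrite sub0r normrN ger0_norm ?cumulant_ge0// ltNge; apply/negP => eu.
have ce : 0 < c * e `^ gamma by rewrite mulr_gt0 ?powR_gt0.
have : m%:R * (c * e `^ gamma) <= l.
  apply: (@le_trans _ _ ((t + m%:R) * (c * u (t + m%:R) `^ gamma))).
    apply: ler_pM; rewrite ?ler0n ?(ltW ce) ?lerDr//.
    by apply: le_Phi => //; exact: ltW.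
  by rewrite (le_trans (cumulant_upper tm))// gerBl cumulant_ge0.
rewrite -ler_pdivlMr// leNgt; apply/negP; rewrite negbK.
by near: m; exact: nbhs_infty_gtr.
Unshelve. all: by end_near. Qed.

End cumulant.

(** * The Markov property *)

Section markov.
Context {R : realType} {d : measure_display} {T : measurableType d}.
Variables (P : R -> probability T R) (X : R -> T -> R).
Hypothesis PX : markov_family P X.

Let mX t : 0 <= t -> measurable_fun setT (X t). Proof. by case: PX => + _ _ _ _; exact. Qed.
Let X0 t w : 0 <= t -> 0 <= X t w. Proof. by case: PX => _ + _ _ _; exact. Qed.

Local Notation F_ t := (g_sigma_algebraType (past_events X t)).

Lemma past_events_measurable t : past_events X t `<=` @measurable d T.
Proof.
move=> _ [s st [B mB <-]]; rewrite setTI.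
by apply: preimage_measurable => //; apply: mX; move: st; rewrite /= in_itv/= => /andP[].
Qed.

Lemma natural_filtration_measurable t : natural_filtration X t `<=` @measurable d T.
Proof.
apply: smallest_sub; first exact: sigma_algebra_measurable.
exact: past_events_measurable.
Qed.

(** The identity onto the coarser sigma-algebra is the variable with which [eq_law_integral] passes
    from events of F_t to F_t-measurable weights. *)
Lemma measurable_id_filtration t : measurable_fun setT (id : T -> F_ t).
Proof.
move=> _ B mB; rewrite setTI; exact: (@natural_filtration_measurable t).
Qed.

Lemma filtration_measurable_fun t (W : T -> R) :
  measurable_fun setT (W : F_ t -> R) -> measurable_fun setT W.
Proof.
by move=> mW _ B mB; apply: (@natural_filtration_measurable t); exact: mW.
Qed.

Lemma le_filtration_measurable_fun s t (W : T -> R) : s <= t ->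
  measurable_fun setT (W : F_ s -> R) -> measurable_fun setT (W : F_ t -> R).
Proof.
move=> st mW _ B mB; have := mW measurableT B mB.
apply: smallest_sub; first exact: smallest_sigma_algebra.
move=> A [r rs HA]; apply: sub_sigma_algebra; exists r => //.
by move: rs; rewrite /= !in_itv/= => /andP[-> rs]; exact: le_trans st.
Qed.

Lemma filtration_measurable_X s t : 0 <= s -> s <= t ->
  measurable_fun setT (X s : F_ t -> R).
Proof.
move=> s0 st _ B mB; apply: sub_sigma_algebra; exists s.
  by rewrite /= in_itv/= s0.
by exists B.
Qed.

Lemma markov_integral x s t (A : set T) (f : R -> R) :
  0 <= x -> 0 <= s -> 0 <= t -> natural_filtration X t A ->
  measurable_fun setT f -> (forall y, 0 <= f y) ->
  (\int[P x]_(w in A) (f (X (t + s) w))%:E =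
   \int[P x]_(w in A) \int[P (X t w)]_w' (f (X s w'))%:E)%E.
Proof.
move=> x0 s0 t0 At mf f0.
have mA := natural_filtration_measurable At.
have ts0 : 0 <= t + s by rewrite addr_ge0.
pose k (f : R -> R) w := (\int[P (X t w)]_w' (f (X s w'))%:E)%E.
(* Measurability of the kernel integral is proved along with the identity, because additivity and
   monotone convergence on the right-hand side rely on it. *)
suff : measurable_fun setT (k f) /\
  (\int[P x]_(w in A) (f (X (t + s) w))%:E = \int[P x]_(w in A) k f w)%E by case.
have mfX (g : R -> R) r : 0 <= r -> measurable_fun setT g ->
    measurable_fun setT (fun w => (g (X r w))%:E).
  by move=> r0 mg; apply/measurable_EFinP/measurableT_comp => //; exact: mX.
have k0 (g : R -> R) w : (forall y, 0 <= g y) -> (0 <= k g w)%E.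
  by move=> g0; apply: integral_ge0 => w' _; rewrite lee_fin.
apply: (@ge0_measurable_fun_ind _ _ R (fun f => measurable_fun setT (k f) /\
  (\int[P x]_(w in A) (f (X (t + s) w))%:E = \int[P x]_(w in A) k f w)%E) _ _ _ _ f mf f0).
- move=> B mB.
  have kB : k \1_B = fun w => P (X t w) (X s @^-1` B).
    apply/funext => w; rewrite /k -[LHS]/(\int[P (X t w)]_w' (\1_(X s @^-1` B) w')%:E)%E.
    by rewrite integral_indic ?setIT//; apply: preimage_measurable => //; exact: mX.
  rewrite kB; split.
    case: PX => _ _ _ mP _.
    (* The kernel is assumed measurable on [0, +oo[ only, which is where [X t] takes its values. *)
    apply: (@measurable_comp _ _ _ _ _ _ (`[0, +oo[%classic : set R)
      (fun y => P y (X s @^-1` B)) setT (X t)) => //.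
    + by move=> _ [w _ <-]; rewrite /= in_itv/= X0.
    + exact: mP.
    + exact: mX.
  case: PX => _ _ _ _ /(_ x s t A B x0 s0 t0 At mB) <-.
  rewrite -[LHS]/(\int[P x]_(w in A) (\1_(X (t + s) @^-1` B) w)%:E)%E.
  rewrite integral_indic//; first by rewrite setIC.
  by apply: preimage_measurable => //; exact: mX.
- move=> g h mg mh g0 h0 [mkg Eg] [mkh Eh].
  have kD : k (fun y => g y + h y) = fun w => (k g w + k h w)%E.
    apply/funext => w; rewrite /k -ge0_integralD//; try exact: mfX;
      by move=> w' _; rewrite lee_fin.
  rewrite kD; split; first exact: emeasurable_funD.
  rewrite ge0_integralD//; try (by move=> *; exact: k0); try exact: measurable_funTS.
  rewrite -Eg -Eh -ge0_integralD//; try exact: measurable_funTS (mfX _ _ _ _);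
    by move=> w' _; rewrite lee_fin.
- move=> r g r0 mg g0 [mkg Eg].
  have kZ : k (fun y => r * g y) = fun w => (r%:E * k g w)%E.
    apply/funext => w; rewrite /k -ge0_integralZl_EFin//; [by move=> w' _; rewrite lee_fin|exact: mfX].
  rewrite kZ; split; first exact: measurable_funeM.
  rewrite ge0_integralZl_EFin//; [|by move=> *; exact: k0|exact: measurable_funTS].
  rewrite -Eg -ge0_integralZl_EFin//; [by move=> w' _; rewrite lee_fin|].
  exact: measurable_funTS (mfX _ _ _ _).
- move=> g_ g mg_ g_0 ndg mg g0 gcvg kg.
  have cv y : ((g_ n y)%:E @[n --> \oo] --> (g y)%:E).
    by apply: cvg_EFin; [exact: nearW|exact: gcvg].
  have kL w : k (g_ n) w @[n --> \oo] --> k g w.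
    rewrite /k (_ : (fun w' => (g (X s w'))%:E) = (fun w' => limn (fun n => (g_ n (X s w'))%:E))).
      apply: cvg_monotone_convergence => //.
      + by move=> n; exact: mfX.
      + by move=> n w' _; rewrite lee_fin.
      + by move=> w' _ m n mn; rewrite lee_fin; exact: ndg.
    by apply/funext => w'; apply/esym/cvg_lim => //; exact: cv.
  split.
    apply: (@emeasurable_fun_cvg _ _ _ setT (fun n => k (g_ n)) (k g) (fun n => (kg n).1)).
    by move=> w _; exact: kL.
  have L1 : (\int[P x]_(w in A) (g_ n (X (t + s) w))%:E)%E @[n --> \oo] -->
      (\int[P x]_(w in A) (g (X (t + s) w))%:E)%E.
    rewrite (_ : (fun w => (g _)%:E) = (fun w => limn (fun n => (g_ n (X (t + s) w))%:E))).
      apply: cvg_monotone_convergence => //.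
      + by move=> n; exact: measurable_funTS (mfX _ _ _ _).
      + by move=> n w' _; rewrite lee_fin.
      + by move=> w' _ m n mn; rewrite lee_fin; exact: ndg.
    by apply/funext => w'; apply/esym/cvg_lim => //; exact: cv.
  have L2 : (\int[P x]_(w in A) k (g_ n) w)%E @[n --> \oo] --> (\int[P x]_(w in A) k g w)%E.
    rewrite (_ : k g = (fun w => limn (fun n => k (g_ n) w))).
      apply: cvg_monotone_convergence => //.
      + by move=> n; exact: measurable_funTS (kg n).1.
      + by move=> n w' _; exact: k0.
      + move=> w' _ m n mn; apply: ge0_le_integral => //; try exact: mfX.
        * by move=> w'' _; rewrite lee_fin.
        * by move=> w'' _; rewrite lee_fin; exact: ndg.
    by apply/funext => w'; apply/esym/cvg_lim => //; exact: kL.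
  apply: cvg_unique L1 _ => //=.
  have E n : (\int[P x]_(w in A) (g_ n (X (t + s) w))%:E = \int[P x]_(w in A) k (g_ n) w)%E.
    exact: (kg n).2.
  by under eq_fun do rewrite E.
Qed.

End markov.

(** * The mass of a CB process *)

Section cb_process.
Context {R : realType} {d : measure_display} {T : measurableType d}.
Variables (P : R -> probability T R) (X : R -> T -> R) (c gamma : R).
Hypotheses (c0 : 0 < c) (gamma1 : 1 < gamma).
Local Notation Phi := (fun l : R => c * l `^ gamma).
Hypotheses (PX : markov_family P X) (Xrcll : forall w, rcll (X ^~ w)).
Variable v : R -> R -> R.
Hypothesis vP : forall l, 0 <= l -> cumulant_solution Phi l (v ^~ l).
Hypothesis Xv : forall l x t, 0 <= l -> 0 <= x -> 0 <= t ->
  (\int[P x]_w (expR (- l * X t w))%:E = (expR (- x * v t l))%:E)%E.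

Local Notation F_ t := (g_sigma_algebraType (past_events X t)).
Variables (x : R) (x0 : 0 <= x).

Let mX t : 0 <= t -> measurable_fun setT (X t). Proof. by case: PX => + _ _ _ _; exact. Qed.
Let X0 t w : 0 <= t -> 0 <= X t w. Proof. by case: PX => _ + _ _ _; exact. Qed.

(** The Markov property, applied to y -> exp(-l y) on events of F_t, is an equality of two measures
    on F_t; W is then integrated against both. *)
Lemma cb_one_step s t l (W : T -> R) : 0 <= s -> 0 <= t -> 0 <= l ->
  measurable_fun setT (W : F_ t -> R) -> (forall w, 0 <= W w) ->
  (\int[P x]_w (W w * expR (- l * X (t + s) w))%:E =
   \int[P x]_w (W w * expR (- v s l * X t w))%:E)%E.
Proof.
move=> s0 t0 l0 mW W0.
have ts0 : 0 <= t + s by rewrite addr_ge0.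
have mE r u : 0 <= r -> measurable_fun setT (fun w => expR (- u * X r w)).
  by move=> r0; apply: measurableT_comp => //; apply: measurable_funM => //; exact: mX.
under eq_integral do rewrite mulrC; under [RHS]eq_integral do rewrite mulrC.
apply: (@eq_law_integral _ _ _ T T (F_ t) R (P x) (P x)
  (fun w => expR (- l * X (t + s) w)) (fun w => expR (- v s l * X t w)) id id
  (mE _ _ ts0) (fun w => expR_ge0 _) (mE _ _ t0) (fun w => expR_ge0 _)
  (measurable_id_filtration PX (t := t)) (measurable_id_filtration PX (t := t)) _ W mW W0).
move=> A mA; have At : natural_filtration X t A by exact: mA.
rewrite !preimage_id (markov_integral PX (f := fun y => expR (- l * y)) x0 s0 t0 At).
- by apply: eq_integral => w _; rewrite Xv// ?X0// mulrC mulrN -mulNr.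
- by apply: measurableT_comp => //; exact: measurable_funM.
- by move=> y; exact: expR_ge0.
Qed.

(** One step replaces [l] by v_h(l). The factor exp(-(l - v_h(l)) X) at the left end of the step
    restores [l], so that the steps can be chained. *)
Lemma cb_discrete_martingale m h t l (W : T -> R) : 0 <= h -> 0 <= t -> 0 <= l ->
  measurable_fun setT (W : F_ t -> R) -> (forall w, 0 <= W w) ->
  (\int[P x]_w (W w * expR (- l * X (t + m%:R * h) w
      - (l - v h l) * \sum_(k < m) X (t + k%:R * h) w))%:E =
   \int[P x]_w (W w * expR (- l * X t w))%:E)%E.
Proof.
move=> h0 t0 l0 mW W0.
elim: m => [|m IH].
  by apply: eq_integral => w _; rewrite big_ord0 mulr0 subr0 mul0r addr0.
(* [W'] collects the factors up to time t + m h; all of them belong to the past of that time. *)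
rewrite -IH; pose W' w := W w * expR (- (l - v h l) * \sum_(k < m.+1) X (t + k%:R * h) w).
have tm0 : 0 <= t + m%:R * h by rewrite addr_ge0// mulr_ge0.
have mW' : measurable_fun setT (W' : F_ (t + m%:R * h) -> R).
  apply: measurable_funM.
    by apply: le_filtration_measurable_fun mW; rewrite lerDl mulr_ge0.
  apply: measurableT_comp => //; apply: measurable_funM => //.
  apply: measurable_sum => k; apply: filtration_measurable_X.
    by rewrite addr_ge0// mulr_ge0.
  by rewrite lerD2l ler_wpM2r// ler_nat -ltnS.
have W'0 w : 0 <= W' w by rewrite mulr_ge0 ?expR_ge0.
have := cb_one_step h0 tm0 l0 mW' W'0.
rewrite (_ : t + m%:R * h + h = t + m.+1%:R * h); last by rewrite -natr1 mulrDl mul1r addrA.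
move=> E; transitivity (\int[P x]_w (W' w * expR (- l * X (t + m.+1%:R * h) w))%:E)%E.
  by apply: eq_integral => w _; rewrite /W' -mulrA -expRD; congr (_ * expR _)%:E; ring.
rewrite E; apply: eq_integral => w _; rewrite /W' -mulrA -expRD big_ord_recr/=.
by congr (_ * expR _)%:E; ring.
Qed.

(** For [s >= 0], [fine] loses nothing here, since rcll paths are bounded on bounded intervals. *)
Definition mass_between (s u : R) (w : T) : R :=
  fine (\int[@lebesgue_measure R]_(r in `[s, (s + u)%R[) (X r w)%:E)%E.

Lemma mass_betweenE s u w : 0 <= s ->
  ((mass_between s u w)%:E = \int[@lebesgue_measure R]_(r in `[s, (s + u)%R[) (X r w)%:E)%E.
Proof.
move=> s0; have [M HM] := rcll_bounded (s + u) (Xrcll w).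
rewrite fineK//; apply: integrable_fin_num => //; apply: measurable_bounded_integrable => //.
- by rewrite /= lebesgue_measure_itv/=; case: ifPn => _; rewrite ?ltry.
- apply: measurable_funS (rcll_measurable (Xrcll w)) => // r.
  by rewrite /= !in_itv/= andbT => /andP[+ _]; exact: le_trans.
exists `|M|; split => // y My r /=; rewrite in_itv/= => /andP[sr ru].
by rewrite (le_trans (HM _ _)) ?(ltW ru) ?(le_trans s0)// ltW// (le_lt_trans _ My)// ler_norm.
Qed.

Lemma mass_between_riemann s u w : 0 <= s -> 0 < u ->
  u / m.+1%:R * \sum_(k < m.+1) X (s + k.+1%:R * (u / m.+1%:R)) w @[m --> \oo]
    --> mass_between s u w.
Proof.
move=> s0 u0; have [M HM] := rcll_bounded (s + u) (Xrcll w).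
have [] := @right_continuous_riemann_sum R (X ^~ w) s u M u0.
- by move=> r /andP[sr ru]; apply: HM; rewrite ru (le_trans s0).
- by move=> r /andP[sr _]; apply: (Xrcll w).1; exact: le_trans sr.
by move=> _; rewrite -mass_betweenE// => /fine_cvgP[].
Qed.

Lemma mass_between_ge0 s u w : 0 <= s -> 0 <= mass_between s u w.
Proof.
move=> s0; rewrite fine_ge0//; apply: integral_ge0 => r.
by rewrite /= in_itv/= => /andP[sr _]; rewrite lee_fin X0// (le_trans s0).
Qed.

(** The Riemann sums only involve times up to [s + u]. *)
Lemma filtration_measurable_mass_between s u : 0 <= s -> 0 < u ->
  measurable_fun setT (mass_between s u : F_ (s + u) -> R).
Proof.
move=> s0 u0; pose f m (w : T) := u / m.+1%:R * \sum_(k < m.+1) X (s + k.+1%:R * (u / m.+1%:R)) w.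
apply: (@measurable_fun_cvg _ (F_ (s + u)) _ setT f).
  move=> m; apply: measurable_funM => //; apply: measurable_sum => k.
  have um : 0 <= u / m.+1%:R by rewrite divr_ge0// ltW.
  apply: filtration_measurable_X; first by rewrite addr_ge0// mulr_ge0.
  rewrite lerD2l (@le_trans _ _ (m.+1%:R * (u / m.+1%:R)))//.
    by rewrite ler_wpM2r// ler_nat.
  by rewrite mulrCA divff ?mulr1// pnatr_eq0.
by move=> w _; exact: mass_between_riemann.
Qed.

(** The mesh h tends to 0 in the discrete identity: (l - v_h(l)) / h tends to Phi(l), and h times
    the sum to the integral. Boundedness of W gives the domination. *)
Lemma cb_martingale t u l (W : T -> R) : 0 <= t -> 0 < u -> 0 < l ->
  measurable_fun setT (W : F_ t -> R) -> (forall w, 0 <= W w) ->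
  (exists M, forall w, W w <= M) ->
  (\int[P x]_w (W w * expR (- l * X (t + u) w - Phi l * mass_between t u w))%:E =
   \int[P x]_w (W w * expR (- l * X t w))%:E)%E.
Proof.
move=> t0 u0 l0 mW W0 [M HM].
pose h m : R := u / m.+1%:R.
have h0 m : 0 < h m by rewrite divr_gt0.
have hu m : m.+1%:R * h m = u by rewrite /h mulrCA divff ?mulr1// pnatr_eq0.
pose D m := l - v (h m) l.
have D0 m : 0 <= D m.
  by rewrite subr_ge0; apply: (cumulant_le c0 (vP (ltW l0))); exact: ltW.
pose f m w := W w * expR (- l * X (t + m.+1%:R * h m) w
      - D m * \sum_(k < m.+1) X (t + k%:R * h m) w).
have E m : (\int[P x]_w (f m w)%:E = \int[P x]_w (W w * expR (- l * X t w))%:E)%E.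
  by apply: cb_discrete_martingale => //; exact: ltW.
have mW' := filtration_measurable_fun PX mW.
have tk m (k : nat) : 0 <= t + k%:R * h m by rewrite addr_ge0// mulr_ge0// ltW.
have mf m : measurable_fun setT (f m).
  apply: measurable_funM => //; apply: measurableT_comp => //; apply: measurable_funB.
    by apply: measurable_funM => //; exact: mX.
  by apply: measurable_funM => //; apply: measurable_sum => k; exact: mX.
have fM m w : `|f m w| <= M.
  rewrite ger0_norm ?mulr_ge0 ?expR_ge0//; apply: le_trans (HM w); rewrite ler_piMr//.
  rewrite expR_le1 mulNr -opprD oppr_le0 addr_ge0// mulr_ge0// ?X0// ?(ltW l0)//.
  by apply: sumr_ge0 => k _; rewrite X0.
have Dh : D m / h m @[m --> \oo] --> Phi l.
  by have := cumulant_derivative c0 gamma1 (vP (ltW l0)) l0 u0.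
have hcvg : h m @[m --> \oo] --> (0 : R).
  by rewrite -[X in _ --> X](mulr0 u); apply: cvgMl_tmp; exact: cvg_harmonic.
have Dcvg : D m @[m --> \oo] --> (0 : R).
  rewrite -[X in _ --> X](mulr0 (Phi l)).
  rewrite (_ : (fun m => D m) = (fun m => D m / h m * h m)); first exact: cvgM.
  by apply/funext => m; rewrite divfK// gt_eqF.
have fcvg w : f m w @[m --> \oo] -->
    W w * expR (- l * X (t + u) w - Phi l * mass_between t u w).
  apply: cvgMl_tmp; apply: continuous_cvg; first exact: continuous_expR.
  (* The discrete sum runs over left endpoints and the Riemann sum over right endpoints; they differ
     by X_t - X_(t+u), whose coefficient [D m] tends to 0. *)
  rewrite (_ : (fun m => _) = (fun m => - l * X (t + u) w -
     (D m / h m * (u / m.+1%:R * \sum_(k < m.+1) X (t + k.+1%:R * (u / m.+1%:R)) w)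
      + D m * (X t w - X (t + u) w)))); last first.
    apply/funext => m; rewrite hu; congr (_ - _).
    rewrite big_ord_recl/= mul0r addr0 [in RHS]big_ord_recr/= -/(h m) hu.
    rewrite mulrA divfK ?gt_eqF// -mulrDr; congr (_ * _).
    transitivity (X t w + \sum_(k < m) X (t + k.+1%:R * h m) w); [by []|ring].
  apply: cvgB; first exact: cvg_cst.
  rewrite -[X in _ --> X]addr0 -[X in _ --> _ + X](mul0r (X t w - X (t + u) w)).
  apply: cvgD; last exact: cvgMr_tmp.
  by apply: cvgM => //; exact: mass_between_riemann.
have := @cvg_integral_dominated _ T _ (P x) f
  (fun w => W w * expR (- l * X (t + u) w - Phi l * mass_between t u w)) (cst M) mf fcvg
  (finite_measure_integrable_cst _ _ measurableT)
  (fun m w => fM m w).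
under eq_fun do rewrite E.
by move=> /cvg_unique; apply; [exact: ereal_hausdorff|exact: cvg_cst].
Qed.

Definition mass_from (t : R) (w : T) : \bar R :=
  (\int[@lebesgue_measure R]_(r in `[t, +oo[) (X r w)%:E)%E.

Lemma mass_from_ge0 t w : 0 <= t -> (0 <= mass_from t w)%E.
Proof.
move=> t0; apply: integral_ge0 => r; rewrite /= in_itv/= andbT => tr.
by rewrite lee_fin X0// (le_trans t0).
Qed.

Lemma mass_between_cvg t w : 0 <= t ->
  ((mass_between t N.+1%:R w)%:E @[N --> \oo] --> mass_from t w)%E.
Proof.
move=> t0; under eq_fun do rewrite mass_betweenE//.
have cover : (`[t, +oo[%classic : set R) = \bigcup_(n : nat) `[t, t + n.+1%:R[%classic.
  apply/seteqP; split => r /=; last first.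
    by move=> [n _] /=; rewrite !in_itv/= => /andP[->].
  rewrite in_itv/= andbT => tr; exists (Num.truncn (r - t)) => //=.
  by rewrite in_itv/= tr -ltrBlDl truncnS_gt.
rewrite /mass_from cover; apply: ge0_nondecreasing_set_cvg_integral.
- move=> m n mn; rewrite subsetEset => r; rewrite /= !in_itv/= => /andP[-> rm]/=.
  by apply: lt_le_trans rm _; rewrite lerD2l ler_nat ltnS.
- by move=> n; exact: measurable_itv.
- move=> n; apply/measurable_EFinP.
  apply: measurable_funS (rcll_measurable (Xrcll w)) => // r.
  by rewrite /= !in_itv/= andbT => /andP[+ _]; exact: le_trans.
- move=> n r; rewrite /= in_itv/= => /andP[tr _].
  by rewrite lee_fin X0// (le_trans t0).
Qed.

Lemma measurable_mass_between t u : 0 <= t -> 0 < u ->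
  measurable_fun setT (mass_between t u).
Proof.
move=> t0 u0.
exact: (filtration_measurable_fun PX (filtration_measurable_mass_between t0 u0)).
Qed.

Lemma measurable_mass_from t : 0 <= t -> measurable_fun setT (mass_from t).
Proof.
move=> t0.
apply: (@emeasurable_fun_cvg _ _ _ setT (fun N w => (mass_between t N.+1%:R w)%:E)).
  by move=> N; apply/measurable_EFinP; exact: measurable_mass_between.
by move=> w _; exact: mass_between_cvg.
Qed.

(* The indicator is needed because [fine +oo = 0]. *)
Definition exp_mass_from (k t : R) w : R :=
  expR (- k * fine (mass_from t w)) * \1_[set w | (mass_from t w < +oo)%E] w.

Lemma mass_between_exp_cvg k t w : 0 < k -> 0 <= t ->
  expR (- k * mass_between t N.+1%:R w) @[N --> \oo] --> exp_mass_from k t w.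
Proof.
move=> k0 t0; have := @mass_between_cvg t w t0; have := @mass_from_ge0 t w t0.
rewrite /exp_mass_from indicE; case E : (mass_from t w) => [r| |] //= _.
- move=> /fine_cvgP[_ cv]; rewrite mem_set ?mulr1/= ?E ?ltry//.
  by apply: continuous_cvg; [exact: continuous_expR|exact: cvgMl_tmp].
- move=> /cvgeryP cv; rewrite memNset ?mulr0/= ?E//.
  under eq_fun do rewrite mulNr.
  have h : k * r @[r --> +oo] --> +oo by exact: (gt0_cvgMry k0 cvg_id).
  exact: (cvg_comp _ _ cv (cvg_comp _ _ h (@cvgr_expR R))).
Qed.

(** The horizon N tends to infinity in [cb_martingale]. Dropping exp(-k X_(t+N)) costs at most M
    E[1 - exp(-k X_(t+N))], up to the shift of N by one, and this is M (1 - exp(-x v_(t+N)(k))),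
    which tends to 0. *)
Lemma exp_mass_from_integral k t (W : T -> R) : 0 <= t -> 0 < k ->
  measurable_fun setT (W : F_ t -> R) -> (forall w, 0 <= W w) ->
  (exists M, forall w, W w <= M) ->
  (\int[P x]_w (W w * exp_mass_from (Phi k) t w)%:E =
   \int[P x]_w (W w * expR (- k * X t w))%:E)%E.
Proof.
move=> t0 k0 mW W0 [M HM]; pose J N := mass_between t N.+1%:R.
have J0 N w : 0 <= J N w by exact: mass_between_ge0.
have mW' := filtration_measurable_fun PX mW.
have Phik : 0 < Phi k by rewrite mulr_gt0// powR_gt0.
have mJ N : measurable_fun setT (J N) by exact: measurable_mass_between.
have mE a (g : T -> R) : measurable_fun setT g -> measurable_fun setT (fun w => expR (a * g w)).
  by move=> mg; apply: measurableT_comp => //; exact: measurable_funM.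
have E1 a (y : R) : 0 <= a -> 0 <= y -> expR (- a * y) <= 1.
  by move=> a0 y0; rewrite expR_le1 mulNr oppr_le0 mulr_ge0.
pose f N w := W w * expR (- Phi k * J N w).
have mf N : measurable_fun setT (f N) by apply: measurable_funM => //; exact: mE.
have f0 N w : 0 <= f N w := mulr_ge0 (W0 w) (expR_ge0 _).
have fM N w : `|f N w| <= M.
  rewrite ger0_norm//; apply: le_trans (HM w); rewrite ler_piMr//.
  by apply: E1 => //; exact: ltW.
pose L := (\int[P x]_w (W w * exp_mass_from (Phi k) t w)%:E)%E.
have fL : (\int[P x]_w (f N w)%:E @[N --> \oo] --> L)%E.
  have fcvg w : f N w @[N --> \oo] --> W w * exp_mass_from (Phi k) t w.
    by apply: cvgMl_tmp; exact: mass_between_exp_cvg.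
  have h := @cvg_integral_dominated _ T _ (P x) f _ (cst M) mf fcvg
    (finite_measure_integrable_cst _ _ measurableT) fM.
  exact: h.
set C := (\int[P x]_w (W w * expR (- k * X t w))%:E)%E.
have tN N : 0 <= t + N.+1%:R by rewrite addr_ge0.
pose g N w := W w * expR (- k * X (t + N.+1%:R) w - Phi k * J N w).
have mg N : measurable_fun setT (g N).
  apply: measurable_funM => //; apply: measurableT_comp => //; apply: measurable_funB.
    by apply: measurable_funM => //; exact: mX.
  by apply: measurable_funM => //; exact: mJ.
have g0 N w : 0 <= g N w := mulr_ge0 (W0 w) (expR_ge0 _).
have gC N : (\int[P x]_w (g N w)%:E = C)%E by apply: cb_martingale => //; exists M.
have gE N w : g N w = f N w * expR (- k * X (t + N.+1%:R) w).
  by rewrite /g /f -[RHS]mulrA -expRD; congr (_ * expR _); ring.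
have gf N w : g N w <= f N w.
  by rewrite gE ler_piMr// E1 ?(ltW k0)// X0.
apply/eqP; rewrite eq_le; apply/andP; split; last first.
  rewrite -/L; apply: (lee_cvg_to (@cvg_cst _ C _ _ _) fL); apply: nearW => N.
  rewrite -(gC N); apply: ge0_le_integral.
  + exact: measurableT.
  + by move=> w _; rewrite lee_fin.
  + by apply/measurable_EFinP; exact: mg.
  + by apply/measurable_EFinP; exact: mf.
  + by move=> w _; rewrite lee_fin.
have M0 : 0 <= M by apply: (le_trans _ (HM point)).
pose e N := (\int[P x]_w (M * expR (- k * X (t + N.+1%:R) w))%:E)%E.
have meX N : measurable_fun setT (fun w => expR (- k * X (t + N.+1%:R) w)).
  by apply: mE; exact: mX.
have eE N : e N = (M * expR (- x * v (t + N.+1%:R) k))%:E.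
  rewrite /e; under eq_integral do rewrite EFinM.
  rewrite ge0_integralZl_EFin.
  - by rewrite Xv// ltW.
  - exact: measurableT.
  - by move=> w _; rewrite lee_fin expR_ge0.
  - by apply/measurable_EFinP; exact: meX.
  - exact: M0.
have ecvg : (e N @[N --> \oo] --> M%:E)%E.
  under eq_fun do rewrite eE.
  rewrite (_ : M%:E = (M * expR (- x * 0))%:E); last by rewrite mulr0 expR0 mulr1.
  apply: cvg_EFin; first exact: nearW.
  apply: cvgMl_tmp; apply: continuous_cvg; first exact: continuous_expR.
  apply: cvgMl_tmp.
  have := cumulant_cvg0 c0 gamma1 (vP (ltW k0)) t0.
  by rewrite -(cvg_shiftS (fun N => v (t + N%:R) k)).
(* Stated with sums to avoid subtracting extended reals; pointwise it says (M - f) (1 - exp(-k X))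
   >= 0. *)
have le N : (\int[P x]_w (f N w)%:E + e N <= C + M%:E)%E.
  rewrite -(gC N) /e.
  have -> : M%:E = (\int[P x]_w M%:E)%E.
    rewrite (@integral_cst _ _ _ (P x) _ measurableT).
    by have := probability_setT (P x) => /= ->; rewrite mule1.
  rewrite -ge0_integralD; last 5 first.
  - exact: measurableT.
  - by move=> w _; rewrite lee_fin.
  - by apply/measurable_EFinP; exact: mf.
  - by move=> w _; rewrite lee_fin mulr_ge0// expR_ge0.
  - by apply/measurable_EFinP; apply: measurable_funM => //; exact: meX.
  rewrite -ge0_integralD; last 5 first.
  - exact: measurableT.
  - by move=> w _; rewrite lee_fin.
  - by apply/measurable_EFinP; exact: mg.
  - by move=> w _; rewrite lee_fin.
  - exact: measurable_cst.
  apply: ge0_le_integral.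
  + exact: measurableT.
  + by move=> w _; rewrite -EFinD lee_fin addr_ge0// mulr_ge0// expR_ge0.
  + by apply: emeasurable_funD; apply/measurable_EFinP;
      [exact: mf|apply: measurable_funM => //; exact: meX].
  + by apply: emeasurable_funD; [apply/measurable_EFinP; exact: mg|exact: measurable_cst].
  + move=> w _; rewrite -!EFinD lee_fin gE -subr_ge0.
    rewrite (_ : _ - _ = (M - f N w) * (1 - expR (- k * X (t + N.+1%:R) w))); last by ring.
    rewrite mulr_ge0// subr_ge0; last by rewrite E1 ?(ltW k0)// X0.
    by rewrite (le_trans (ler_norm _)).
have LM : (L + M%:E <= C + M%:E)%E.
  have h : (\int[P x]_w (f N w)%:E + e N @[N --> \oo] --> L + M%:E)%E.
    by have h := cvgeD (fin_num_adde_defl L (_ : M%:E \is a fin_num)) fL ecvg; exact: h.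
  by apply: (lee_cvg_to h (@cvg_cst _ (C + M%:E)%E _ _ _)); apply: nearW => N; exact: le.
by rewrite leeD2rE in LM.
Qed.

Lemma measurable_mass_from_finite t : 0 <= t ->
  measurable [set w | (mass_from t w < +oo)%E].
Proof.
move=> t0; rewrite -[X in measurable X]setTI.
exact: (emeasurable_fun_infty_o measurableT (measurable_mass_from t0)).
Qed.

(** With W = 1 the probability is at least exp(-x v_t(k)) >= 1 - k x, and [k] is arbitrarily
    small. *)
Lemma mass_from_finite t : 0 <= t -> {ae P x, forall w, (mass_from t w < +oo)%E}.
Proof.
move=> t0; set N := [set w | (mass_from t w < +oo)%E].
have mN : measurable N by exact: measurable_mass_from_finite.
have PN k : 0 < k -> ((1 - k * x)%:E <= P x N)%E.
  move=> k0; have bW : exists M : R, forall w : T, cst 1 w <= M by exists 1.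
  have := exp_mass_from_integral t0 k0 (@measurable_cst _ _ (F_ t) _ _ (1 : R))
    (fun=> ler01) bW.
  under [X in _ = X -> _]eq_integral do rewrite mul1r.
  rewrite Xv ?(ltW k0)// => E.
  have -> : P x N = (\int[P x]_w (\1_N w)%:E)%E by rewrite integral_indic ?setIT.
  apply: (@le_trans _ _ (expR (- x * v t k))%:E).
    rewrite lee_fin; apply: le_trans (expR_ge1Dx _).
    rewrite lerD2l mulNr lerN2 [leRHS]mulrC; apply: ler_wpM2l => //.
    exact: (cumulant_le c0 (vP (ltW k0)) t0).
  have Phik : 0 < Phi k by rewrite mulr_gt0// powR_gt0.
  rewrite -E; apply: ge0_le_integral.
  - exact: measurableT.
  - by move=> w _; rewrite lee_fin mul1r mulr_ge0// expR_ge0.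
  - apply/measurable_EFinP; apply: measurable_funM; first exact: measurable_cst.
    apply: measurable_funM; last exact: measurable_indic.
    apply: measurableT_comp => //; apply: measurable_funM; first exact: measurable_cst.
    apply: measurableT_comp; first exact: fine_measurable.
    exact: measurable_mass_from.
  - by apply/measurable_EFinP; exact: measurable_indic.
  - move=> w _; rewrite lee_fin mul1r ler_piMl//.
    by rewrite expR_le1 mulNr oppr_le0 mulr_ge0 ?(ltW Phik)// fine_ge0// mass_from_ge0.
have P1 : P x N = 1%E.
  apply/eqP; rewrite eq_le probability_le1//=; apply/lee_addgt0Pr => e e0.
  (* The denominator is x + 1 because [x] may be 0 here. *)
  have ex0 : 0 < e / (x + 1) by rewrite divr_gt0// ltr_wpDl.
  rewrite -leeBlDr//; apply: le_trans (PN _ ex0).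
  rewrite -EFinB lee_fin lerD2l lerN2 -mulrA ler_piMr ?(ltW e0)//.
  by rewrite mulrC ler_pdivrMr ?ltr_wpDl// mul1r lerDl.
exists (~` N); split => //; first exact: measurableC.
by have := probability_setC (P x) mN; rewrite P1 subee.
Qed.

Local Notation a := (gamma^-1).

(** The value k = (l / c)^a solves Phi(k) = l, and almost sure finiteness removes the indicator from
    [exp_mass_from]. *)
Lemma laplace_mass_from t l (W : T -> R) : 0 <= t -> 0 < l ->
  measurable_fun setT (W : F_ t -> R) -> (forall w, 0 <= W w) ->
  (exists M, forall w, W w <= M) ->
  \int[P x]_w (W w * expR (- l * fine (mass_from t w))) =
  \int[P x]_w (W w * expR (- (c^-1 `^ a * X t w) * l `^ a)).
Proof.
move=> t0 l0 mW W0 bW; pose k := (l / c) `^ a.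
have k0 : 0 < k by rewrite powR_gt0// divr_gt0.
have mW' := filtration_measurable_fun PX mW.
have gamma_gt0 : 0 < gamma := lt_trans ltr01 gamma1.
have Phik : Phi k = l.
  by rewrite /= /k -powRrM mulVf ?gt_eqF// powRr1 ?divr_ge0 ?ltW// mulrC divfK// gt_eqF.
have mB : measurable_fun setT (fun w => fine (mass_from t w)).
  by apply: measurableT_comp; [exact: fine_measurable|exact: measurable_mass_from].
have mE : measurable_fun setT (fun w => expR (- l * fine (mass_from t w))).
  by apply: measurableT_comp => //; apply: measurable_funM; [exact: measurable_cst|exact: mB].
congr fine; transitivity (\int[P x]_w (W w * expR (- k * X t w))%:E)%E; last first.
  apply: eq_integral => w _; congr (_ * expR _)%:E.
  by rewrite /k powRM ?invr_ge0 ?ltW//; ring.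
rewrite -(exp_mass_from_integral t0 k0 mW W0 bW) Phik; apply: ge0_ae_eq_integral.
- exact: measurableT.
- by apply/measurable_EFinP; exact: measurable_funM.
- apply/measurable_EFinP; apply: measurable_funM; first exact: mW'.
  apply: measurable_funM; first exact: mE.
  by apply: measurable_indic; exact: measurable_mass_from_finite.
- by move=> w _; rewrite lee_fin mulr_ge0// expR_ge0.
- by move=> w _; rewrite lee_fin mulr_ge0// /exp_mass_from mulr_ge0// expR_ge0.
- apply: filterS (mass_from_finite t0) => w fw _.
  by rewrite /exp_mass_from indicE mem_set// mulr1.
Qed.

Lemma integral_one_sub_exp t k : 0 <= t -> 0 < k ->
  (\int[P x]_w ((1 - expR (- k * X t w)) / k)%:E = ((1 - expR (- x * v t k)) / k)%:E)%E.
Proof.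
move=> t0 k0.
have mE : measurable_fun setT (fun w => expR (- k * X t w) / k).
  apply: measurable_funM; last exact: measurable_cst.
  by apply: measurableT_comp => //; apply: measurable_funM; [exact: measurable_cst|exact: mX].
have iE : (P x).-integrable setT (fun w => (expR (- k * X t w) / k)%:E).
  apply: (@integrable_bounded _ _ _ (P x) _ k^-1 mE) => w.
  rewrite ger0_norm ?divr_ge0 ?expR_ge0 ?(ltW k0)// ler_piMl ?invr_ge0 ?(ltW k0)//.
  by rewrite expR_le1 mulNr oppr_le0 mulr_ge0 ?(ltW k0)// X0.
have i1 : (P x).-integrable setT (fun=> (k^-1)%:E).
  exact: finite_measure_integrable_cst.
under eq_integral do rewrite mulrBl mul1r EFinB.
rewrite (integralB_EFin measurableT i1 iE).
rewrite (@integral_cst _ _ _ (P x) _ measurableT); have := probability_setT (P x) => /= ->.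
rewrite mule1; under eq_integral do rewrite mulrC EFinM.
rewrite ge0_integralZl_EFin.
- by rewrite Xv ?(ltW k0)// -EFinM -EFinB mulrBl mul1r [_ / k]mulrC.
- exact: measurableT.
- by move=> w _; rewrite lee_fin expR_ge0.
- apply/measurable_EFinP; apply: measurableT_comp => //.
  by apply: measurable_funM; [exact: measurable_cst|exact: mX].
- by rewrite invr_ge0 ltW.
Qed.

(** The quotients (1 - exp(-k X_t)) / k lie below X_t and converge to it as k tends to 0: Fatou's
    lemma bounds the mean by [x], and an estimate at one small k bounds it below by x - e. *)
Lemma cb_expectation t : 0 <= t -> (\int[P x]_w (X t w)%:E = x%:E)%E.
Proof.
move=> t0; pose f k w : R := (1 - expR (- k * X t w)) / k.
have mf k : measurable_fun setT (f k).
  apply: measurable_funM; last exact: measurable_cst.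
  apply: measurable_funB; first exact: measurable_cst.
  by apply: measurableT_comp => //; apply: measurable_funM; [exact: measurable_cst|exact: mX].
have f0 k w : 0 < k -> 0 <= f k w.
  move=> k0; rewrite divr_ge0 ?(ltW k0)// subr_ge0 expR_le1 mulNr oppr_le0.
  by rewrite mulr_ge0 ?(ltW k0)// X0.
have fX (k y : R) : 0 < k -> 0 <= y -> (1 - expR (- k * y)) / k <= y.
  move=> k0 y0; rewrite ler_pdivrMr// lerBlDr -lerBlDl.
  by apply: le_trans (expR_ge1Dx _); rewrite mulNr mulrC.
apply/eqP; rewrite eq_le; apply/andP; split.
  pose h n : R := n.+1%:R^-1.
  have h0 n : 0 < h n by rewrite invr_gt0.
  have cv w : ((f (h n) w)%:E @[n --> \oo] --> (X t w)%:E)%E.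
    apply: cvg_EFin; first exact: nearW.
    have Xw := @X0 t w t0.
    have up : (X t w @[_ --> \oo] --> X t w) by exact: cvg_cst.
    have low : X t w - h n * X t w ^+ 2 @[n --> \oo] --> X t w.
      rewrite -[X in _ --> X]subr0 -[X in _ --> _ - X](mul0r (X t w ^+ 2)).
      by apply: cvgB; [exact: cvg_cst|apply: cvgMr_tmp; exact: cvg_harmonic].
    apply: (squeeze_cvgr _ low up); apply: nearW => n.
    rewrite fX// andbT ler_pdivlMr// lerBrDr.
    have y0 : 0 <= h n * X t w by rewrite mulr_ge0 ?(ltW (h0 n)).
    have y1 : 0 < 1 + h n * X t w by rewrite ltr_pwDl.
    have e1 : expR (- h n * X t w) <= (1 + h n * X t w)^-1.
      by rewrite mulNr expRN lef_pV2 ?posrE ?expR_gt0// expR_ge1Dx.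
    have e2 : (1 + h n * X t w)^-1 <= 1 - h n * X t w + (h n * X t w) ^+ 2.
      rewrite -[leLHS]div1r ler_pdivrMr//.
      have : 0 <= (h n * X t w) ^+ 3 by rewrite exprn_ge0.
      lra.
    have := le_trans e1 e2; lra.
  have /= := @fatou _ _ _ (P x) setT measurableT (fun n w => (f (h n) w)%:E).
  move=> /(_ _ _)/le_trans H.
  rewrite (_ : (fun w => (X t w)%:E) = (fun w => limn_einf (fun n => (f (h n) w)%:E))); last first.
    apply/funext => w; rewrite is_cvg_limn_einfE; last by apply/cvg_ex; eexists; exact: cv.
    by apply/esym/cvg_lim; [exact: ereal_hausdorff|exact: cv].
  apply: H.
  - by move=> n; apply/measurable_EFinP; exact: mf.
  - by move=> n w _; rewrite lee_fin f0.
  rewrite limn_einf_lim; apply: lime_le; first exact: is_cvg_einfs.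
  apply: nearW => n; apply: (@le_trans _ _ (\int[P x]_w (f (h n) w)%:E)%E).
    by apply: ereal_inf_lbound; exists n => /=.
  rewrite integral_one_sub_exp// lee_fin.
  have vk : v t (h n) <= h n by exact: (cumulant_le c0 (vP (ltW (h0 n))) t0).
  rewrite ler_pdivrMr//; apply: (@le_trans _ _ (x * v t (h n))); last by rewrite ler_wpM2l.
  by rewrite lerBlDr -lerBlDl; apply: le_trans (expR_ge1Dx _); rewrite mulNr.
apply/lee_addgt0Pr => e e0.
(* The errors will be x t c y k, from the decrease of the cumulant, and x^2 y k, from the
   second-order term of the exponential; [y] makes their sum at most e k. *)
have [y [y0 ye]] : exists y : R, 0 < y /\ (x * t * c + x ^+ 2) * y <= e.
  have K1 : 0 < x * t * c + x ^+ 2 + 1.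
    by rewrite ltr_wpDl// addr_ge0 ?sqr_ge0// mulr_ge0 ?(ltW c0)// mulr_ge0.
  exists (e / (x * t * c + x ^+ 2 + 1)); split; first by rewrite divr_gt0.
  rewrite mulrCA ler_piMr ?(ltW e0)// ler_pdivrMr// mul1r lerDl//.
have g1 : 0 < gamma - 1 by rewrite subr_gt0.
(* The second entry yields k^gamma <= y k, so Phi(k) is negligible against k. This is criticality,
   where [gamma > 1] enters. *)
pose k := Num.min y (y `^ (gamma - 1)^-1).
have k0 : 0 < k by rewrite lt_min y0 powR_gt0.
have ky : k <= y by rewrite ge_min lexx.
have kg : k `^ gamma <= y * k.
  rewrite (_ : gamma = (gamma - 1) + 1); last by ring.
  rewrite powRD; last by rewrite (gt_eqF k0) implybT.
  rewrite powRr1 ?(ltW k0)// ler_wpM2r ?(ltW k0)//.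
  rewrite -[leRHS](powRr1 (ltW y0)) -[X in _ <= y `^ X](mulVf (lt0r_neq0 g1)) powRrM.
  by rewrite ge0_ler_powR ?nnegrE ?powR_ge0 ?(ltW k0) ?(ltW g1)// ge_min lexx orbT.
apply: (@le_trans _ _ (\int[P x]_w (f k w)%:E + e%:E)%E); last first.
  rewrite leeD2r//; apply: ge0_le_integral.
  - exact: measurableT.
  - by move=> w _; rewrite lee_fin f0.
  - by apply/measurable_EFinP; exact: mf.
  - by apply/measurable_EFinP; exact: mX.
  - by move=> w _; rewrite lee_fin fX// X0.
rewrite integral_one_sub_exp// -EFinD lee_fin -lerBlDr ler_pdivlMr//.
have vk : v t k <= k by exact: (cumulant_le c0 (vP (ltW k0)) t0).
have v0 : 0 <= v t k by exact: (cumulant_ge0 (vP (ltW k0)) t0).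
have vl : k - v t k <= t * (c * k `^ gamma) by exact: (cumulant_lower c0 gamma1 (vP (ltW k0)) t0).
pose z := x * v t k.
have z0 : 0 <= z by rewrite mulr_ge0.
have ez : expR (- x * v t k) <= 1 - z + z ^+ 2.
  apply: (@le_trans _ _ (1 + z)^-1).
    by rewrite mulNr expRN lef_pV2 ?posrE ?expR_gt0 ?ltr_pwDl// expR_ge1Dx.
  rewrite -[leLHS]div1r ler_pdivrMr ?ltr_pwDl//.
  have : 0 <= z ^+ 3 by rewrite exprn_ge0.
  lra.
have z2 : z ^+ 2 <= x ^+ 2 * (y * k).
  rewrite /z exprMn ler_wpM2l ?sqr_ge0// expr2 ler_pM//.
  exact: le_trans ky.
have xz : x * k - z <= x * t * c * (y * k).
  rewrite /z -mulrBr -!mulrA ler_wpM2l//; apply: (le_trans vl).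
  by rewrite ler_wpM2l// ler_wpM2l// ltW.
have : (x * t * c + x ^+ 2) * y * k <= e * k by rewrite ler_wpM2r// ltW.
rewrite mulrBl; lra.
Qed.

(** * The conditional laws *)

Lemma total_mass_split t w : 0 <= t ->
  total_mass X w = ((mass_between 0 t w)%:E + mass_from t w)%E.
Proof.
move=> t0; rewrite mass_betweenE// add0r /total_mass /mass_from.
have mX0 : measurable_fun (`[0%R, +oo[%classic : set R) (fun r => (X r w)%:E).
  by apply/measurable_EFinP; exact: rcll_measurable.
have U : (`[0, t[%classic `|` `[t, +oo[%classic : set R) = `[0, +oo[%classic.
  by rewrite -itv_bndbnd_setU// bnd_simp.
rewrite -[in LHS]U ge0_integral_setU//.
- by rewrite U.
- by move=> r; rewrite U/= in_itv/= andbT => r0; rewrite lee_fin X0.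
- rewrite disj_set2E; apply/eqP/seteqP; split => // r [] /=.
  by rewrite !in_itv/= andbT => /andP[_ rt]; rewrite leNgt rt.
Qed.

Lemma filtration_measurable_past_mass t : 0 <= t ->
  measurable_fun setT (mass_between 0 t : F_ t -> R).
Proof.
rewrite le_eqVlt => /predU1P[<-|t0].
  rewrite (_ : mass_between 0 0 = cst 0); first exact: measurable_cst.
  by apply/funext => w; rewrite /mass_between addr0 set_itvco0 integral_set0.
by have := filtration_measurable_mass_between (lexx 0) t0; rewrite add0r.
Qed.

Lemma laplace_mass_from_bounded t (W : T -> R) : 0 <= t ->
  measurable_fun setT (W : F_ t -> R) -> (forall w, 0 <= W w) ->
  (forall j, exists M, forall w, W w * (c^-1 `^ a * X t w) ^+ j <= M) ->
  forall (j : nat) (s l : R), 0 <= s -> 0 < l ->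
  \int[P x]_w (W w * (c^-1 `^ a * X t w) ^+ j * expR (- s * mass_between 0 t w)
    * expR (- l * fine (mass_from t w))) =
  \int[P x]_w (W w * (c^-1 `^ a * X t w) ^+ j * expR (- s * mass_between 0 t w)
    * expR (- (c^-1 `^ a * X t w) * l `^ a)).
Proof.
move=> t0 mW W0 bW j s l s0 l0.
have Z0 w : 0 <= (c^-1 `^ a * X t w) ^+ j by rewrite exprn_ge0// mulr_ge0 ?powR_ge0 ?X0.
apply: laplace_mass_from => //.
- apply: measurable_funM.
    apply: measurable_funM => //; apply: measurable_funX.
    by apply: measurable_funM; [exact: measurable_cst|exact: filtration_measurable_X].
  apply: measurableT_comp => //; apply: measurable_funM; first exact: measurable_cst.
  exact: filtration_measurable_past_mass.
- by move=> w; rewrite !mulr_ge0 ?expR_ge0.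
- have [M HM] := bW j; exists M => w; apply: le_trans (HM w); rewrite ler_piMr ?mulr_ge0//.
  by rewrite expR_le1 mulNr oppr_le0 mulr_ge0// mass_between_ge0.
Qed.

Hypothesis x_gt0 : 0 < x.
Local Notation th := (c^-1 `^ a).
Local Notation S := (fun w => fine (total_mass X w)).
(** Almost surely equal to 1 under P_x. It replaces the constant 1 as reference weight because the
    bounds W Z^j <= z^j are required at every point. *)
Local Notation start_indic := (\1_[set w | X 0 w = x] : T -> R).

Let a01 : 0 < a < 1.
Proof. by rewrite invr_gt0 (lt_trans ltr01)//= invf_lt1// (lt_trans ltr01). Qed.

Let th_gt0 : 0 < th. Proof. by rewrite powR_gt0// invr_gt0. Qed.

Lemma exists_kernel_order : exists n : nat, 1 < n%:R * (1 - a).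
Proof.
have a1 : 0 < 1 - a by rewrite subr_gt0; case/andP: a01.
exists (Num.truncn (1 - a)^-1).+1.
by rewrite -ltr_pdivrMr// div1r; exact: truncnS_gt.
Qed.

Lemma measurable_start : measurable [set w | X 0 w = x].
Proof.
rewrite (_ : [set w | _] = X 0 @^-1` [set x])//; apply: preimage_measurable => //.
exact: mX.
Qed.

Lemma filtration_measurable_start : measurable_fun setT (start_indic : F_ 0 -> R).
Proof.
apply: measurable_indic; rewrite (_ : [set w | _] = X 0 @^-1` [set x])//.
by apply: (@preimage_measurable _ _ (F_ 0)) => //; exact: filtration_measurable_X.
Qed.

Lemma start_moment_le j w : start_indic w * (th * X 0 w) ^+ j <= (th * x) ^+ j.
Proof.
have thx : 0 <= (th * x) ^+ j by rewrite exprn_ge0// mulr_ge0// ltW.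
rewrite indicE; have [wx|wx] := pselect (X 0 w = x).
  by rewrite mem_set// mul1r wx.
by rewrite memNset// mul0r.
Qed.

Let measurable_mass_from_fine t : 0 <= t -> measurable_fun setT (fun w => fine (mass_from t w)).
Proof.
by move=> t0; apply: measurableT_comp; [exact: fine_measurable|exact: measurable_mass_from].
Qed.

Let mZ t : 0 <= t -> measurable_fun setT (fun w => th * X t w).
Proof. by move=> t0; apply: measurable_funM; [exact: measurable_cst|exact: mX]. Qed.

Let Z0 t w : 0 <= t -> 0 <= th * X t w.
Proof. by move=> t0; rewrite mulr_ge0 ?(ltW th_gt0)// X0. Qed.

Let mass_from_fine_ge0 t w : 0 <= t -> 0 <= fine (mass_from t w).
Proof. by move=> t0; rewrite fine_ge0// mass_from_ge0. Qed.

Let start_laplace (j : nat) (s l : R) : 0 <= s -> 0 < l ->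
  \int[P x]_w (start_indic w * (th * X 0 w) ^+ j * expR (- s * 0) * expR (- l * S w)) =
  \int[P x]_w (start_indic w * (th * X 0 w) ^+ j * expR (- s * 0) * expR (- (th * X 0 w) * l `^ a)).
Proof.
move=> s0 l0; have bW i : exists M, forall w, start_indic w * (th * X 0 w) ^+ i <= M.
  by exists ((th * x) ^+ i) => w; exact: start_moment_le.
have mb0 w : mass_between 0 0 w = 0.
  by rewrite /mass_between addr0 set_itvco0 integral_set0.
have := laplace_mass_from_bounded (lexx 0) filtration_measurable_start _ bW j s0 l0.
under eq_Rintegral do rewrite mb0; under [RHS]eq_Rintegral do rewrite mb0.
by apply => w; rewrite indicE.
Qed.

Lemma start_ae : ae_eq (P x) setT start_indic (cst 1).
Proof.
exists (~` [set w | X 0 w = x]); split.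
- exact: measurableC measurable_start.
- have := probability_setC (P x) measurable_start.
  by case: PX => _ _ /(_ x x0) -> _ _; rewrite subee.
- by move=> w /= h1 h2; apply: h1 => _; rewrite indicE mem_set.
Qed.

Lemma integral_start (A : set T) : measurable A ->
  (\int[P x]_(w in A) (start_indic w)%:E = P x A)%E.
Proof.
move=> mA; rewrite -[RHS]mul1e -(integral_cst (P x) mA 1).
apply: ge0_ae_eq_integral.
- exact: mA.
- by apply/measurable_EFinP; apply: measurable_indic; exact: measurable_start.
- exact: measurable_cst.
- by move=> w _; rewrite lee_fin indicE.
- by move=> w _; exact: lee01.
- by apply: filterS start_ae => w /(_ I) -> _.
Qed.

Lemma total_mass_ae t : 0 <= t ->
  {ae P x, forall w, S w = mass_between 0 t w + fine (mass_from t w)}.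
Proof.
move=> t0; apply: filterS (mass_from_finite t0) => w fw.
have fB : mass_from t w \is a fin_num by rewrite ge0_fin_numE// mass_from_ge0.
by rewrite (total_mass_split w t0) -[X in (_ + X)%E](fineK fB).
Qed.

Lemma integrable_X t : 0 <= t -> (P x).-integrable setT (fun w => (X t w)%:E).
Proof.
move=> t0; apply/integrableP; split; first by apply/measurable_EFinP; exact: mX.
under eq_integral do rewrite gee0_abs ?lee_fin ?X0//.
by rewrite cb_expectation// ltry.
Qed.

Lemma integrable_bounded_mulX t (G : T -> R) M : 0 <= t -> measurable_fun setT G ->
  (forall w, `|G w| <= M) -> (P x).-integrable setT (fun w => (G w * X t w)%:E).
Proof.
move=> t0 mG GM.
apply: (le_integrable measurableT _ _ (integrableZl measurableT M (integrable_X t0))).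
  by apply/measurable_EFinP; apply: measurable_funM => //; exact: mX.
move=> w _; rewrite -EFinM !abse_EFin lee_fin !normrM ler_wpM2r//.
by rewrite (le_trans (GM w))// ler_norm.
Qed.

(** The reference is the same total mass split at time 0, with z = c^(-a) x; the constants c^(-a)
    cancel in the ratio. *)
Lemma cb_mass_comparison t (G : T -> R) M e : 0 <= t -> 0 < e ->
  measurable_fun setT (G : F_ t -> R) -> (forall w, 0 <= G w) -> (forall w, G w <= M) ->
  exists2 r0 : R, 0 < r0 & forall D : set R, measurable D -> (forall r, D r -> r0 <= r) ->
    ((\int[P x]_w (G w * X t w) / x - e)%:E * P x (S @^-1` D) <=
     \int[P x]_(w in S @^-1` D) (G w)%:E)%E.
Proof.
move=> t0 e0 mG G0 GM; have mG' := filtration_measurable_fun PX mG.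
have M0 : 0 <= M by rewrite (le_trans (G0 point)).
have e2 : 0 < e / 2 by rewrite divr_gt0.
(* Truncation makes every W Z^j bounded, while integrability of X_t lets the first moment be
   recovered for large K. *)
pose W (K : nat) w := G w * \1_[set w | X t w <= K%:R] w.
have mXK K : measurable (X t @^-1` `]-oo, K%:R]%classic : set (F_ t)).
  by apply: preimage_measurable; [exact: filtration_measurable_X|exact: measurable_itv].
have XKE K : [set w | X t w <= K%:R] = X t @^-1` `]-oo, K%:R]%classic.
  by apply/seteqP; split => w /=; rewrite in_itv.
have mW K : measurable_fun setT (W K : F_ t -> R).
  by apply: measurable_funM => //; apply: measurable_indic; rewrite XKE.
have mW' K := filtration_measurable_fun PX (mW K).
have WK0 K w : 0 <= W K w by rewrite mulr_ge0.
have WG K w : W K w <= G w by rewrite ler_piMr// indicE lern1 leq_b1.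
have bW K j : exists M, forall w, W K w * (th * X t w) ^+ j <= M.
  exists (M * (th * K%:R) ^+ j) => w; rewrite /W indicE.
  have [wK|wK] := pselect (X t w <= K%:R); last first.
    rewrite memNset// mulr0 mul0r mulr_ge0// exprn_ge0//.
    by rewrite mulr_ge0// ltW.
  rewrite mem_set// mulr1; apply: ler_pM => //; first by rewrite exprn_ge0// Z0.
  by apply: lerXn2r; rewrite ?nnegrE ?Z0// ?mulr_ge0 ?(ltW th_gt0)// ler_wpM2l// ltW.
(* Half of [e] pays for the truncation, the other half for [total_mass_comparison]. *)
have [K HK] : exists K, \int[P x]_w (G w * X t w) / x - e / 2 <= \int[P x]_w (W K w * X t w) / x.
  have cv : ((\int[P x]_w (W K w * X t w)%:E)%E @[K --> \oo] -->
             (\int[P x]_w (G w * X t w)%:E)%E).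
    have h := @cvg_integral_dominated _ T _ (P x) (fun K w => W K w * X t w)
      (fun w => G w * X t w) (fun w => G w * X t w).
    apply: h.
    - by move=> n; apply: measurable_funM; [exact: mW'|exact: mX].
    - move=> w; apply: cvg_near_cst; near=> n.
      rewrite /W indicE mem_set ?mulr1//=.
      by near: n; exact: nbhs_infty_ger.
    - apply: (integrable_bounded_mulX (M := M)) => // w.
      by rewrite ger0_norm.
    - by move=> n w; rewrite ger0_norm ?mulr_ge0 ?X0// ler_wpM2r ?X0// WG.
  have fin : (\int[P x]_w (G w * X t w)%:E)%E \is a fin_num.
    apply: integrable_fin_num => //; apply: (integrable_bounded_mulX (M := M)) => // w.
    by rewrite ger0_norm.
  move: cv; rewrite -(fineK fin) => /fine_cvgP[_ /cvgrPdist_le].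
  have xe : 0 < x * (e / 2) by rewrite mulr_gt0.
  move=> /(_ _ xe)[K _ /(_ K (leqnn K))] /=; rewrite ler_distl => /andP[_ h].
  exists K; rewrite lerBlDr -[X in _ <= _ + X](mulKf (lt0r_neq0 x_gt0)) mulrC.
  by rewrite [_ / x]mulrC -mulrDr ler_wpM2l ?invr_ge0.
have HW := laplace_mass_from_bounded t0 (mW K) (WK0 K) (bW K).
have W00 w : 0 <= start_indic w by rewrite indicE.
have [n na] := exists_kernel_order.
have [r0 r00 H] := total_mass_comparison a01 na
  (filtration_measurable_fun PX (filtration_measurable_past_mass t0))
  (fun w => mass_between_ge0 t w (lexx 0)) (measurable_mass_from_fine t0)
  (fun w => mass_from_fine_ge0 w t0) (mZ t0) (fun w => Z0 w t0) (mW' K) (WK0 K) (bW K) HW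
  (measurable_mass_from_fine (lexx 0)) (fun w => mass_from_fine_ge0 w (lexx 0))
  (mZ (lexx 0)) (fun w => Z0 w (lexx 0)) (measurable_indic measurable_start)
  W00 (mulr_gt0 th_gt0 x_gt0) start_moment_le start_laplace e2.
exists r0 => // D mD Dr0.
have mS : measurable_fun setT S := measurable_mass_from_fine (lexx 0).
have mSD : measurable (S @^-1` D) by exact: preimage_measurable.
have mAB : measurable_fun setT (fun w => mass_between 0 t w + fine (mass_from t w)).
  apply: measurable_funD; last exact: measurable_mass_from_fine.
  exact: (filtration_measurable_fun PX (filtration_measurable_past_mass t0)).
have mABD := preimage_measurable mAB mD.
have := H D mD Dr0; rewrite (integral_start mSD) => {}H.
have ratio : \int[P x]_w (G w * X t w) / x - e <=
    \int[P x]_w (W K w * (th * X t w)) / (th * x) - e / 2.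
  rewrite (_ : \int[P x]_w (W K w * (th * X t w)) = th * \int[P x]_w (W K w * X t w)).
    by rewrite -mulf_div divff ?gt_eqF// mul1r; lra.
  rewrite -RintegralZl//.
    by apply: eq_Rintegral => w _; rewrite mulrCA.
  apply: (integrable_bounded_mulX (M := M) t0 (mW' K)) => w.
  by rewrite ger0_norm// (le_trans (WG K w)).
apply: (@le_trans _ _ _ _ _ (le_trans (lee_wpmul2r _ _) H)).
- exact: measure_ge0.
- by rewrite lee_fin.
rewrite [leRHS](_ : _ = (\int[P x]_(w in
    (mass_between 0 t \+ (fun w => fine (mass_from t w)))%R @^-1` D) (G w)%:E)%E).
  apply: ge0_le_integral.
  - exact: mABD.
  - by move=> w _; rewrite lee_fin.
  - by apply/measurable_EFinP; exact: measurable_funTS (mW' K).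
  - by apply/measurable_EFinP; exact: measurable_funTS mG'.
  - by move=> w _; rewrite lee_fin.
rewrite integral_mkcond [RHS]integral_mkcond !epatch_indic.
have mI A : measurable A -> measurable_fun setT (fun w => (G w * \1_A w)%:E).
  by move=> mA; apply/measurable_EFinP; apply: measurable_funM => //; exact: measurable_indic.
apply: ge0_ae_eq_integral.
- exact: measurableT.
- exact: mI.
- exact: mI mABD.
- by move=> w _; rewrite lee_fin mulr_ge0.
- by move=> w _; rewrite lee_fin mulr_ge0.
- apply: filterS (total_mass_ae t0) => w Sw _.
  congr (_ * _)%E; rewrite /= !indicE; congr (nat_of_bool _)%:R%:E.
  by apply/idP/idP => /set_mem h; apply/mem_set; move: h; rewrite /preimage/= Sw.
Unshelve. all: by end_near. Qed.

Let mS : measurable_fun setT S := measurable_mass_from_fine (lexx 0).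

(** The lower bound is applied to M + F and M - F. As E[X_t] = x, the constant M contributes M times
    the probability of the event on both sides and cancels, leaving lower bounds for F and for
    -F. *)
Lemma cb_mass_conditional t (F : T -> R) M e : 0 <= t -> 0 < e ->
  measurable_fun setT (F : F_ t -> R) -> (forall w, `|F w| <= M) ->
  exists2 r0 : R, 0 < r0 & forall D : set R, measurable D -> (forall r, D r -> r0 <= r) ->
    `|\int[P x]_(w in S @^-1` D) F w
      - \int[P x]_w (F w * X t w) / x * fine (P x (S @^-1` D))| <=
    e * fine (P x (S @^-1` D)).
Proof.
move=> t0 e0 mF FM; have mF' := filtration_measurable_fun PX mF.
have iF D : measurable D -> (P x).-integrable D (EFin \o F).
  by move=> mD; exact: (integrableS measurableT mD (@subsetT _ _) (integrable_bounded (P x) mF' FM)).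
have iFX := integrable_bounded_mulX t0 mF' FM.
have half (H : T -> R) : measurable_fun setT (H : F_ t -> R) -> (forall w, `|H w| <= M) ->
  exists2 r0 : R, 0 < r0 & forall D : set R, measurable D -> (forall r, D r -> r0 <= r) ->
    (\int[P x]_w (H w * X t w) / x - e) * fine (P x (S @^-1` D)) <=
    \int[P x]_(w in S @^-1` D) H w.
  move=> mH HM; have mH' := filtration_measurable_fun PX mH.
  have mMH : measurable_fun setT ((fun w => M + H w) : F_ t -> R).
    by apply: measurable_funD => //; exact: measurable_cst.
  have MH0 w : 0 <= M + H w by have := HM w; rewrite ler_norml -lerBlDl sub0r => /andP[].
  have MHM w : M + H w <= M + M by rewrite lerD2l (le_trans _ (HM w))// ler_norm.
  have [r0 r00 cmp] := cb_mass_comparison t0 e0 mMH MH0 MHM.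
  exists r0 => // D mD Dr0; have mSD := preimage_measurable mS mD.
  have := cmp D mD Dr0.
  have iH A : measurable A -> (P x).-integrable A (EFin \o H).
    by move=> mA; exact: (integrableS measurableT mA (@subsetT _ _) (integrable_bounded (P x) mH' HM)).
  have iM A : measurable A -> (P x).-integrable A (EFin \o cst M).
    by move=> mA; exact: finite_measure_integrable_cst.
  have E1 : (\int[P x]_(w in S @^-1` D) (M + H w)%:E =
      (M * fine (P x (S @^-1` D)) + \int[P x]_(w in S @^-1` D) H w)%:E)%E.
    rewrite EFinD -(Rintegral_cst (P x) mSD M).
    rewrite /Rintegral !fineK;
      [|exact: integrable_fin_num (iH _ mSD)|exact: integrable_fin_num (iM _ mSD)].
    by rewrite -(integralD mSD (iM _ mSD) (iH _ mSD)); apply: eq_integral => w _.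
  have E2 : \int[P x]_w ((M + H w) * X t w) = M * x + \int[P x]_w (H w * X t w).
    have iX := integrable_X t0.
    rewrite [X in M * X](_ : x = \int[P x]_w (X t w)); last by rewrite /Rintegral cb_expectation.
    rewrite -RintegralZl// -RintegralD//.
    - by apply: eq_Rintegral => w _; rewrite mulrDl.
    - exact: (integrable_bounded_mulX (G := cst M) (M := `|M|) t0
        (@measurable_cst _ _ _ _ _ M) (fun=> lexx _)).
    - exact: (integrable_bounded_mulX t0 mH' HM).
  rewrite E1 E2 -[X in (_ * X)%E](@fineK _ (P x (S @^-1` D))) ?fin_num_measure//.
  by rewrite -EFinM lee_fin [_ / x]mulrDl mulfK ?gt_eqF// -addrA mulrDl lerD2l.
have [r1 r10 H1] := half F mF FM.
have mNF : measurable_fun setT ((fun w => - F w) : F_ t -> R).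
  exact: (measurableT_comp (@oppr_measurable R _) mF).
have [|r2 r20 H2] := half (fun w => - F w) mNF; first by move=> w; rewrite normrN.
exists (Num.max r1 r2) => [|D mD Dr]; first by rewrite lt_max r10.
have Dr1 r : D r -> r1 <= r by move=> /Dr; rewrite ge_max => /andP[].
have Dr2 r : D r -> r2 <= r by move=> /Dr; rewrite ge_max => /andP[].
have mSD := preimage_measurable mS mD.
have := H1 D mD Dr1; have := H2 D mD Dr2.
rewrite (_ : \int[P x]_w (- F w * X t w) = - \int[P x]_w (F w * X t w)); last first.
  by rewrite -mulN1r -RintegralZl//; apply: eq_Rintegral => w _; rewrite mulN1r mulNr.
rewrite (_ : \int[P x]_(w in _) - F w = - \int[P x]_(w in S @^-1` D) F w); last first.
  rewrite -mulN1r -RintegralZl//; last exact: iF.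
  by apply: eq_Rintegral => w _; rewrite mulN1r.
rewrite ler_norml; set p := fine _; set I := \int[P x]_(w in _) F w.
set q := \int[P x]_w (F w * X t w); rewrite mulNr => h2 h1.
by apply/andP; split; lra.
Qed.

Lemma cb_mass_law_null : exists2 r0 : R, 0 < r0 & forall D : set R, measurable D ->
  (forall r, D r -> r0 <= r) -> P x (S @^-1` D) = 0%E -> (@lebesgue_measure R) D = 0%E.
Proof.
have W00 w : 0 <= start_indic w by rewrite indicE.
have [n na] := exists_kernel_order.
have bW j : exists M, forall w, start_indic w * (th * X 0 w) ^+ j <= M.
  by exists ((th * x) ^+ j) => w; exact: start_moment_le.
have mW0 : measurable_fun setT start_indic by apply: measurable_indic; exact: measurable_start.
have EZ : 0 < \int[P x]_w (start_indic w * (th * X 0 w)).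
  rewrite (_ : \int[P x]_w _ = th * x); first exact: mulr_gt0.
  rewrite -[RHS]mulr1 (_ : 1 = \int[P x]_w start_indic w); last first.
    by rewrite /Rintegral integral_start//; have := probability_setT (P x) => /= ->.
  rewrite -RintegralZl//; last first.
    by apply: (@integrable_bounded _ _ _ (P x) start_indic 1 mW0) => w;
      rewrite indicE ger0_norm ?lern1 ?leq_b1.
  apply: eq_Rintegral => w _; rewrite indicE; have [wx|wx] := pselect (X 0 w = x).
    by rewrite mem_set// wx mulrC.
  by rewrite memNset// mul0r mulr0.
have [r0 r00 H] := total_mass_law_null a01 na (@measurable_cst _ _ _ _ setT (0 : R))
  (fun=> lexx 0) mS (fun w => mass_from_fine_ge0 w (lexx 0))
  (mZ (lexx 0)) (fun w => Z0 w (lexx 0)) mW0 W00 bW start_laplace EZ.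
exists r0 => // D mD Dr0 PD; apply: (H D mD Dr0).
rewrite (_ : (_ \+ _)%R = S); last by apply/funext => w /=; rewrite add0r.
by rewrite integral_start//; exact: preimage_measurable.
Qed.

Lemma total_mass_finite : {ae P x, forall w, total_mass X w = (S w)%:E}.
Proof.
apply: filterS (mass_from_finite (lexx 0)) => w fw; rewrite fineK// ge0_fin_numE//.
exact: mass_from_ge0.
Qed.

Lemma integral_total_mass_preimage (B : set \bar R) (f : T -> \bar R) :
  measurable B -> measurable_fun setT f ->
  (\int[P x]_(w in total_mass X @^-1` B) f w =
   \int[P x]_(w in S @^-1` (EFin @^-1` B)) f w)%E.
Proof.
move=> mB mf; rewrite integral_mkcond [RHS]integral_mkcond.
have mT : measurable (total_mass X @^-1` B).
  by apply: preimage_measurable => //; exact: measurable_mass_from (lexx 0).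
have mSB : measurable (S @^-1` (EFin @^-1` B)).
  apply: preimage_measurable => //; rewrite -[X in measurable X]setTI.
  exact: (@EFin_measurable _ setT).
apply: ae_eq_integral.
- exact: measurableT.
- by apply/(measurable_restrictT _ mT); exact: measurable_funTS.
- by apply/(measurable_restrictT _ mSB); exact: measurable_funTS.
- apply: filterS total_mass_finite => w Sw _; rewrite /patch.
  suff -> : (w \in total_mass X @^-1` B) = (w \in S @^-1` (EFin @^-1` B)) by [].
  by apply/idP/idP => /set_mem h; apply/mem_set; move: h; rewrite /preimage/= -Sw.
Qed.

Lemma law_total_mass_preimage (B : set \bar R) : measurable B ->
  P x (total_mass X @^-1` B) = P x (S @^-1` (EFin @^-1` B)).
Proof.
move=> mB; have := integral_total_mass_preimage mB (@measurable_cst _ _ _ _ setT 1%E).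
rewrite !integral_cst ?mul1e//.
  apply: preimage_measurable => //; rewrite -[X in measurable X]setTI.
  exact: (@EFin_measurable _ setT).
by apply: preimage_measurable => //; exact: measurable_mass_from (lexx 0).
Qed.

(** * The two conditional limits *)

Section limits.
Variables (t : R) (F : T -> R) (M : R).
Hypotheses (t0 : 0 <= t) (mF : measurable_fun setT (F : F_ t -> R)).
Hypothesis FM : forall w, `|F w| <= M.
Local Notation limit := (\int[P x]_w (F w * X t w) / x).

Let mF' := filtration_measurable_fun PX mF.

Let iF D : measurable D -> (P x).-integrable D (EFin \o F).
Proof.
move=> mD.
exact: (integrableS measurableT mD (@subsetT _ _) (integrable_bounded (P x) mF' FM)).
Qed.

(** Only the real points of [B] are constrained, as the total mass is almost surely finite. *)
Lemma cb_conditional_limit e : 0 < e ->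
  exists2 r0 : R, 0 < r0 & forall B : set \bar R, measurable B ->
    (forall r : R, B r%:E -> r0 <= r) ->
    `|\int[P x]_(w in total_mass X @^-1` B) F w
      - limit * fine (P x (total_mass X @^-1` B))| <=
      e * fine (P x (total_mass X @^-1` B)) /\
    (P x (total_mass X @^-1` B) = 0%E -> (@lebesgue_measure R) (EFin @^-1` B) = 0%E).
Proof.
move=> e0; have [r1 r10 H1] := cb_mass_conditional t0 e0 mF FM.
have [r2 r20 H2] := cb_mass_law_null.
exists (Num.max r1 r2) => [|B mB Br]; first by rewrite lt_max r10.
have mD : measurable (EFin @^-1` B : set R).
  by rewrite -[X in measurable X]setTI; exact: (@EFin_measurable _ setT).
have Br1 r : B r%:E -> r1 <= r by move=> /Br; rewrite ge_max => /andP[].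
have Br2 r : B r%:E -> r2 <= r by move=> /Br; rewrite ge_max => /andP[].
have mFe : measurable_fun setT (fun w => (F w)%:E) by apply/measurable_EFinP; exact: mF'.
rewrite /Rintegral (integral_total_mass_preimage mB mFe) law_total_mass_preimage//.
by split; [exact: H1|exact: H2].
Qed.

Lemma cb_tail_limit :
  cond_expectation_event (P x) F [set w | (r%:E < total_mass X w)%E] @[r --> +oo] --> limit.
Proof.
apply/cvgrPdist_le => e e0; have [r0 r00 H] := cb_conditional_limit e0.
near=> r; rewrite distrC.
have rr0 : r0 <= r by near: r; apply: nbhs_pinfty_ge; exact: num_real.
have mB : measurable (`]r%:E, +oo[ : set \bar R) by exact: emeasurable_itv.
have setE : [set w | (r%:E < total_mass X w)%E] = total_mass X @^-1` `]r%:E, +oo[%classic.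
  by apply/seteqP; split => w /=; rewrite in_itv/= ?andbT.
have [|h1 h2] := H _ mB.
  by move=> s; rewrite /= in_itv/= andbT lte_fin => /ltW; exact: le_trans.
rewrite /cond_expectation_event setE.
(* A tail event of probability 0 would make the half-line ]r, +oo[ Lebesgue-null. *)
set p := fine _; have p0 : 0 < p.
  rewrite lt_neqAle fine_ge0// andbT eq_sym; apply/eqP => p0.
  have : (@lebesgue_measure R) (EFin @^-1` `]r%:E, +oo[%classic) = 0%E.
    apply: h2; rewrite -[LHS]fineK ?fin_num_measure//; last first.
      by apply: preimage_measurable => //; exact: measurable_mass_from (lexx 0).
    by rewrite -/p p0.
  rewrite (_ : EFin @^-1` _ = `]r, +oo[%classic); last first.
    by apply/seteqP; split => s /=; rewrite !in_itv/= ?andbT.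
  by rewrite lebesgue_measure_itv/= ltry.
rewrite -(ler_pM2r p0) -[X in _ * X <= _](gtr0_norm p0) -normrM mulrBl divfK ?gt_eqF//.
Unshelve. all: by end_near. Qed.

(** On the set of r >= r0_k where [g] exceeds the limit by at least 2 e_k, the integral of g - limit
    is at least 2 e_k p and at most e_k p, with p the probability of that set; so p = 0 and the set
    is Lebesgue-null. The same holds below the limit, and N is the countable union of these sets. *)
Lemma cb_disintegration_limit (g : \bar R -> R) :
  cond_expectation_given (P x) F (total_mass X) g ->
  exists2 N : set R, (@lebesgue_measure R).-negligible N &
    g r%:E @[r --> within (~` N) (pinfty_nbhs R)] --> limit.
Proof.
move=> [mg ig gE]; pose e (k : nat) : R := k.+1%:R^-1.
have e0 k : 0 < e k by rewrite invr_gt0.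
pose r0 k := sval (cid2 (cb_conditional_limit (e0 k))).
(* The sign treats both sides at once: [b = true] means that [g] falls below the limit. *)
pose D k (b : bool) := [set r : R | r0 k <= r /\ 2 * e k <= (-1) ^+ b * (g r%:E - limit)].
have mgE : measurable_fun setT (fun r : R => g r%:E).
  by apply: (measurableT_comp mg); exact: EFin_measurable.
have mD k b : measurable (D k b).
  rewrite (_ : D k b = `[r0 k, +oo[%classic `&`
     (fun r => (-1) ^+ b * (g r%:E - limit)) @^-1` `[2 * e k, +oo[%classic); last first.
    by apply/seteqP; split => r /=; rewrite /D/= !in_itv/= !andbT => -[].
  apply: measurableI; first exact: measurable_itv.
  apply: preimage_measurable; last exact: measurable_itv.
  apply: measurable_funM; first exact: measurable_cst.
  by apply: measurable_funB; [exact: mgE|exact: measurable_cst].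
have D0 k b : (@lebesgue_measure R) (D k b) = 0%E.
  have [_ H] := svalP (cid2 (cb_conditional_limit (e0 k))).
  have mB := measurable_image_EFin (mD k b).
  have DE : EFin @^-1` (EFin @` D k b) = D k b.
    by apply/seteqP; split => [r [s Ds [<-]]//|r Dr]; exists r.
  have [|h1 h2] := H _ mB; first by move=> r [s [Ds _] [<-]].
  rewrite -[LHS]/(lebesgue_measure (D k b)) -DE; apply: h2.
  set E := total_mass X @^-1` _; have mE : measurable E.
    by apply: preimage_measurable => //; exact: measurable_mass_from (lexx 0).
  have fE : P x E \is a fin_num by exact: fin_num_measure.
  have igE : (P x).-integrable E (EFin \o (fun w => g (total_mass X w))).
    exact: (integrableS measurableT mE (@subsetT _ _) ig).
  have icst m : (P x).-integrable E (EFin \o cst m) by exact: finite_measure_integrable_cst.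
  have FE : \int[P x]_(w in E) F w = \int[P x]_(w in E) g (total_mass X w).
    by rewrite /Rintegral; congr fine; exact: gE.
  have ige := integrableZl mE ((-1) ^+ b) (integrableB mE igE (icst limit)).
  have low : 2 * e k * fine (P x E) <= (-1) ^+ b * (\int[P x]_(w in E) F w - limit * fine (P x E)).
    rewrite FE -!(Rintegral_cst (P x) mE) -RintegralB//; last exact: icst.
    rewrite -RintegralZl//; last exact: (integrableB mE igE (icst limit)).
    apply: (le_Rintegral mE (icst _) ige).
    by move=> w [r [_ Dr] /= <-].
  have up : (-1) ^+ b * (\int[P x]_(w in E) F w - limit * fine (P x E)) <= e k * fine (P x E).
    apply: le_trans h1; apply: le_trans (ler_norm _) _.
    by rewrite normrM normrX normrN1 expr1n mul1r.
  have p0 : 0 <= fine (P x E) by rewrite fine_ge0.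
  have ep : 0 <= e k * fine (P x E) by rewrite mulr_ge0 ?(ltW (e0 k)).
  have : e k * fine (P x E) = 0 by apply/eqP; rewrite eq_le ep andbT; lra.
  move/eqP; rewrite mulf_eq0 gt_eqF//= => /eqP E0.
  by rewrite -(fineK fE) E0.
exists (\bigcup_k (D k true `|` D k false)).
  apply: negligible_bigcup => k.
  have nD b : (@lebesgue_measure R).-negligible (D k b).
    by exists (D k b); split; [exact: mD|exact: D0|].
  exact: negligibleU.
apply/cvgrPdist_le => d0 d00.
have [k ek] : exists k, 2 * e k <= d0.
  exists (Num.truncn (2 / d0)); rewrite -ler_pdivlMl// /e -[leRHS]invrK.
  rewrite lef_pV2 ?posrE ?invr_gt0 ?mulr_gt0//.
  by rewrite invfM invrK; apply/ltW; exact: truncnS_gt.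
rewrite near_withinE; near=> r => rN.
have rk : r0 k <= r by near: r; apply: nbhs_pinfty_ge; exact: num_real.
rewrite leNgt; apply/negP => dlt; apply: rN; exists k => //.
have {}dlt := le_lt_trans ek dlt.
have [gl|gl] := leP (g r%:E) limit.
  by left; split => //; rewrite expr1 mulN1r opprB -[leRHS]ger0_norm ?subr_ge0// ltW.
by right; split => //; rewrite expr0 mul1r; apply: ltW; move: dlt; rewrite ltr0_norm ?subr_lt0// opprB.
Unshelve. all: by end_near. Qed.

End limits.

End cb_process.

Theorem proposition4p10 (R : realType) (d : measure_display)
    (T : measurableType d) (P : R -> probability T R) (X : R -> T -> R)
    (c gamma x : R) (hc : 0 < c) (hgamma : 1 < gamma <= 2)
    (hX : CB_process (fun l : R => c * l `^ gamma) P X) (hx : 0 < x)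
    (t : R) (ht : 0 <= t) (F : T -> R)
    (hF : measurable_fun setT
            (F : g_sigma_algebraType (past_events X t) -> R))
    (hFb : exists M : R, forall w, `|F w| <= M) :
  (forall g : \bar R -> R,
     cond_expectation_given (P x) F (total_mass X) g ->
     exists2 N : set R, (@lebesgue_measure R).-negligible N &
       (g r%:E)%:E @[r --> within (~` N) (pinfty_nbhs R)]
         --> ((x^-1)%:E * 'E_(P x)[fun w => (X t w * F w)%R])%E) /\
  (cond_expectation_event (P x) F [set w | (r%:E < total_mass X w)%E])%:E
    @[r --> +oo] --> ((x^-1)%:E * 'E_(P x)[fun w => (X t w * F w)%R])%E.
Proof.
have [PX Xrcll [v Hv]] := hX.
have gamma1 : 1 < gamma by case/andP: hgamma.
have vP l : 0 <= l -> cumulant_solution (fun l : R => c * l `^ gamma) l (v ^~ l).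
  by move=> /Hv[[]].
have Xv l y s : 0 <= l -> 0 <= y -> 0 <= s ->
    (\int[P y]_w (expR (- l * X s w))%:E = (expR (- y * v s l))%:E)%E.
  by move=> /Hv[_ H] y0 s0; have := H y s y0 s0; rewrite unlock.
have [M FM] := hFb.
pose limit := \int[P x]_w (F w * X t w) / x.
(* Integrability of F X_t makes the expectation finite, so that both limits can be taken in R. *)
have -> : ((x^-1)%:E * 'E_(P x)[fun w => (X t w * F w)%R] = limit%:E)%E.
  have iFX := integrable_bounded_mulX hc gamma1 PX vP Xv (ltW hx) ht
    (filtration_measurable_fun PX hF) FM.
  rewrite unlock; under eq_integral do rewrite mulrC.
  by rewrite -(fineK (integrable_fin_num measurableT iFX)) -EFinM mulrC.
split; last first.
  apply: cvg_EFin; first exact: nearW.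
  exact: (cb_tail_limit hc gamma1 PX Xrcll vP Xv (ltW hx) hx ht hF FM).
move=> g /(cb_disintegration_limit hc gamma1 PX Xrcll vP Xv (ltW hx) hx ht hF FM)[N N0 cv].
by exists N => //; apply: cvg_EFin; [exact: nearW|exact: cv].
Qed.
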